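(* Let $b>0$. (i) The operator $\mathcal{H}_b$ is bounded on $H^1$, and its restriction to $H^1_0$ satisfies $$\|\mathcal{H}_b\|_{H^1_0\to H^1}=B(1,b).$$ (ii) The operator $\mathcal{H}_b$ is unbounded on $H^\infty$ (that is, $\mathcal{H}_b$ is not a bounded operator from $H^\infty$ to $H^\infty$).
   Context: $\mathbb{D}=\{z\in\mathbb{C}:|z|<1\}$ and $H(\mathbb{D})$ is the space of analytic functions on $\mathbb{D}$. The Hardy space $H^1$ consists of those $f\in H(\mathbb{D})$ with $\|f\|_{H^1}:=\sup_{0\le r<1}\frac{1}{2\pi}\int_0^{2\pi}|f(re^{i\theta})|\,d\theta<\infty$; $H^\infty$ is the space of bounded analytic functions on $\mathbb{D}$ with $\|f\|_{H^\infty}=\sup_{z\in\mathbb{D}}|f(z)|$. $H^1_0:=\{f\in H^1: f(0)=0\}$, with the norm of $H^1$. For $b>0$, the generalized Hilbert operator is $$\mathcal{H}_b f(z)=\int_0^1 f(t)\,\frac{(1-t)^b}{(1-tz)^{b+1}}\,dt,\qquad z\in\mathbb{D}.$$ The Beta function is $B(s,t)=\int_0^1 x^{s-1}(1-x)^{t-1}\,dx=\frac{\Gamma(s)\Gamma(t)}{\Gamma(s+t)}$ for $\operatorname{Re}s,\operatorname{Re}t>0$. For normed spaces $X,Y$, $\|\mathcal{H}_b\|_{X\to Y}=\sup\{\|\mathcal{H}_bf\|_Y: f\in X,\ \|f\|_X\le 1\}$. *)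

(* Defs.v *)
From Stdlib Require Import Reals.
From Coquelicot Require Import Coquelicot.

Open Scope R_scope.

(** Functions on the unit disk are represented by total functions [C -> C];
    every notion below depends only on their values on the disk. *)
Definition disk (z : C) : Prop := Cmod z < 1.

Definition analytic_on_disk (f : C -> C) : Prop :=
  forall z : C, disk z -> @ex_derive C_AbsRing C_NormedModule f z.

Definition circle (r theta : R) : C := (r * cos theta, r * sin theta).

Definition H1_norm (f : C -> C) : Rbar :=
  Lub_Rbar (fun y : R => exists r : R, 0 <= r < 1 /\
    y = / (2 * PI) * RInt (fun theta => Cmod (f (circle r theta))) 0 (2 * PI)).

Definition H1 (f : C -> C) : Prop :=
  analytic_on_disk f /\ Rbar_lt (H1_norm f) p_infty.

Definition H10 (f : C -> C) : Prop := H1 f /\ f (RtoC 0) = RtoC 0.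

Definition Hinf_norm (f : C -> C) : Rbar :=
  Lub_Rbar (fun y : R => exists z : C, disk z /\ y = Cmod (f z)).

Definition Hinf (f : C -> C) : Prop :=
  analytic_on_disk f /\ Rbar_lt (Hinf_norm f) p_infty.

(** Principal branch of [w ^ a] on the half-plane [Re w > 0], where the
    principal argument of [w] is [atan (Im w / Re w)].  It is only applied to
    [w = 1 - t z] with [0 <= t < 1] and [|z| < 1]. *)
Definition Cpower (w : C) (a : R) : C :=
  (RtoC (Rpower (Cmod w) a)
    * (cos (a * atan (Im w / Re w)), sin (a * atan (Im w / Re w))))%C.

Definition Hb_integrand (b : R) (f : C -> C) (z : C) (t : R) : C :=
  (f (RtoC t) * (RtoC (Rpower (1 - t) b) / Cpower (1 - RtoC t * z) (b + 1)))%C.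

(** The integrals over [0, 1] are improper at [1], since [f] is only given on
    the open disk. *)
Definition Hb_converges (b : R) (f : C -> C) : Prop :=
  forall z : C, disk z ->
    @ex_RInt_gen C_R_NormedModule (Hb_integrand b f z) (at_point 0) (at_left 1).

Definition Hb (b : R) (f : C -> C) (z : C) : C :=
  @RInt_gen C_R_CompleteNormedModule (Hb_integrand b f z)
    (at_point 0) (at_left 1).

Definition Beta (s t : R) : R :=
  RInt_gen (fun x => Rpower x (s - 1) * Rpower (1 - x) (t - 1))
    (at_right 0) (at_left 1).

Definition op_norm (X : (C -> C) -> Prop) (normX normY : (C -> C) -> Rbar)
    (T : (C -> C) -> (C -> C)) : Rbar :=
  Rbar_lub (fun y : Rbar => exists f : C -> C,
    X f /\ Rbar_le (normX f) 1 /\ y = normY (T f)).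

Definition bounded_operator (X : (C -> C) -> Prop) (normX : (C -> C) -> Rbar)
    (Y : (C -> C) -> Prop) (normY : (C -> C) -> Rbar)
    (T : (C -> C) -> (C -> C)) : Prop :=
  (forall f : C -> C, X f -> Y (T f)) /\
  exists M : R, forall f : C -> C, X f ->
    Rbar_le (normY (T f)) (Rbar_mult M (normX f)).

(* Main.v *)
Require Import Defs.
From Stdlib Require Import Reals Lra Psatz ClassicalEpsilon.
From Coquelicot Require Import Coquelicot.

(** Write [c = 1 - t] and [phi t z = t / (1 - c z)].  Moving the path of integration in
    [Hb b f z] from the segment [[0, 1]] to the curve [t |-> phi t z], on which
    [1 - s = c (1 - s z)], gives

      [Hb b f z = int_0^1 c^b f (phi t z) / (1 - c z) dt].

    The path may be moved by Goursat's theorem, because [f s] is [O(1 / (1 - |s|))] and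
    the segment from [t] to [phi t z] that closes the contour has length [O(c)]; the
    factor [c^b] then sends its contribution to [0] ([contour_shift]).

    Upper bound.  Let [f] vanish at [0].  The heart of the matter is [contraction]: the
    means of [f (phi t z) / (1 - c z)] over circles are at most [norm f / c].  With
    [f s = s g s] the function is [g (phi t z) phi_t' z] up to the factor [1 / c], so this
    says that the integral of [|g|] over the circle [phi t (T)], tangent to the unit
    circle [T] at [1], is at most its integral over [T].  To see it, bound
    [|g s| |1 - s|^2] at [s = phi t z] by its Poisson integral over boundary points [u].
    On [|z| = 1] the powers of [|1 - z|] cancel, and what remains, as a function of [z],
    is again a multiple of a Poisson kernel, with mean exactly [1 / |1 - u|^2], which
    cancels the weight [|1 - u|^2] ([boundary_estimate], [kernel_integral]).  Integrating
    [c^b * norm f / c] over [t] yields [norm f / b] ([Hb_mean_bound]), and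
    [Beta 1 b = 1 / b].  A general [f] differs from a function vanishing at [0] by
    [f 0 (1 - z)], whose image is bounded by [|f 0|] since [1 - t <= |1 - t z|]; this
    gives boundedness on [H1] ([Hb_bounded_means]).

    Lower bound.  For [f z = z / (1 - a z)] with [a] close to [1] and
    [L = - ln (1 - a)], the norm of [f] is at most [(L + O(1)) / PI]
    ([pole_function_means]).  Cauchy's theorem on the two half disks bounds the integral
    over a diameter by [PI] times the mean over the circle ([diameter_integral_bound]).
    On the real axis [Hb b f] is positive, and its integral over [[0, 1]] is
    at least [L / b - O(1)] by exchanging the integrals ([pole_function_image_bound]).  Hence the
    ratio of the norms tends to [1 / b].

    On bounded functions: [Hb b 1] is unbounded near the point [1], where it grows
    like a logarithm ([Hb_one_lower_bound]).

    Since only the existence of the complex derivative is assumed, everything rests on a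
    Goursat theorem for parametrized rectangles ([goursat]), which serves in turn for
    Cauchy's formula, for the half disks and for the change of path. *)

Set Bullet Behavior "Strict Subproofs".
Open Scope R_scope.


(** * Inequalities for quotients and for the complex modulus *)

Lemma le_div_of_mul_le (a b c : R) : 0 < c -> a * c <= b -> a <= b / c.
Proof. intros Hc H. apply Rle_div_r; assumption. Qed.

Lemma div_le_of_le_mul (a b c : R) : 0 < c -> a <= b * c -> a / c <= b.
Proof. intros Hc H. apply Rle_div_l; assumption. Qed.

Lemma div_lt_of_lt_mul (a b c : R) : 0 < c -> a < b * c -> a / c < b.
Proof. intros Hc H. apply Rlt_div_l; assumption. Qed.

Lemma Cmod_sqr (z : C) : Cmod z * Cmod z = fst z * fst z + snd z * snd z.
Proof.
  unfold Cmod. rewrite sqrt_sqrt; [ring|].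
  apply Rplus_le_le_0_compat; apply pow2_ge_0.
Qed.

Lemma Cmod_le_of_sqr (z : C) (m : R) :
  0 <= m -> fst z * fst z + snd z * snd z <= m * m -> Cmod z <= m.
Proof.
  intros Hm H. rewrite <- Cmod_sqr in H. assert (H0 := Cmod_ge_0 z). nra.
Qed.

Lemma Rabs_fst_le_Cmod (z : C) : Rabs (fst z) <= Cmod z.
Proof. eapply Rle_trans; [apply Rmax_l | apply Rmax_Cmod]. Qed.

Lemma Rabs_snd_le_Cmod (z : C) : Rabs (snd z) <= Cmod z.
Proof. eapply Rle_trans; [apply Rmax_r | apply Rmax_Cmod]. Qed.

Lemma Cmod_le_abs_sum (z : C) : Cmod z <= Rabs (fst z) + Rabs (snd z).
Proof.
  apply Cmod_le_of_sqr.
  - generalize (Rabs_pos (fst z)) (Rabs_pos (snd z)); lra.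
  - rewrite <- (Rabs_pos_eq (fst z * fst z)), <- (Rabs_pos_eq (snd z * snd z)) by nra.
    rewrite !Rabs_mult.
    generalize (Rabs_pos (fst z)) (Rabs_pos (snd z)); nra.
Qed.

Lemma Cmod_triangle_sub (x y : C) : Cmod (x - y) <= Cmod x + Cmod y.
Proof.
  unfold Cminus. rewrite <- (Cmod_opp y). apply Cmod_triangle.
Qed.

Lemma Cmod_sub_comm (x y : C) : Cmod (x - y) = Cmod (y - x).
Proof. rewrite <- Cmod_opp. f_equal. ring. Qed.

Lemma Cmod_triangle_rev (x y : C) : Cmod x - Cmod y <= Cmod (x - y).
Proof.
  assert (H := Cmod_triangle (x - y) y).
  replace (x - y + y)%C with x in H by ring. lra.
Qed.

Lemma Cmod_eq_0_sub (x y : C) : Cmod (x - y) = 0 -> x = y.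
Proof. intros H. apply Cmod_eq_0 in H. apply Ceq_minus. exact H. Qed.

(** * Continuity of complex-valued maps *)

Lemma continuous_C_components {T : UniformSpace} (f : T -> C) (x : T) :
  continuous (fun y => fst (f y)) x -> continuous (fun y => snd (f y)) x ->
  continuous f x.
Proof.
  intros H1 H2.
  apply (filterlim_ext (fun y => (fst (f y), snd (f y)))).
  { intros y. destruct (f y); reflexivity. }
  intros P [eps HP].
  assert (A1 := H1 _ (locally_ball (fst (f x)) eps)).
  assert (A2 := H2 _ (locally_ball (snd (f x)) eps)).
  unfold filtermap in *.
  generalize (filter_and _ _ A1 A2). apply filter_imp.
  intros y [B1 B2]. apply HP. split; assumption.
Qed.

Lemma continuous_C_fst {T : UniformSpace} (f : T -> C) (x : T) :
  continuous f x -> continuous (fun y => fst (f y)) x.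
Proof.
  intros H. apply (continuous_comp f (fun z : C => fst z)); [exact H|].
  apply continuous_fst.
Qed.

Lemma continuous_C_snd {T : UniformSpace} (f : T -> C) (x : T) :
  continuous f x -> continuous (fun y => snd (f y)) x.
Proof.
  intros H. apply (continuous_comp f (fun z : C => snd z)); [exact H|].
  apply continuous_snd.
Qed.

Lemma continuous_R_plus {T : UniformSpace} (f g : T -> R) (x : T) :
  continuous f x -> continuous g x -> continuous (fun y => f y + g y) x.
Proof. exact (@continuous_plus T R_AbsRing R_NormedModule f g x). Qed.

Lemma continuous_R_minus {T : UniformSpace} (f g : T -> R) (x : T) :
  continuous f x -> continuous g x -> continuous (fun y => f y - g y) x.
Proof. exact (@continuous_minus T R_AbsRing R_NormedModule f g x). Qed.

Lemma continuous_R_opp {T : UniformSpace} (f : T -> R) (x : T) :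
  continuous f x -> continuous (fun y => - f y) x.
Proof. exact (@continuous_opp T R_AbsRing R_NormedModule f x). Qed.

Lemma continuous_R_mult {T : UniformSpace} (f g : T -> R) (x : T) :
  continuous f x -> continuous g x -> continuous (fun y => f y * g y) x.
Proof. exact (@continuous_mult T R_AbsRing f g x). Qed.

Lemma continuous_R_inv {T : UniformSpace} (f : T -> R) (x : T) :
  continuous f x -> f x <> 0 -> continuous (fun y => / f y) x.
Proof.
  intros H H0. apply (continuous_comp f Rinv); [exact H|].
  apply continuity_pt_filterlim. apply continuity_pt_inv; [|exact H0].
  apply continuity_pt_id.
Qed.

Lemma continuous_R_div {T : UniformSpace} (f g : T -> R) (x : T) :
  continuous f x -> continuous g x -> g x <> 0 ->
  continuous (fun y => f y / g y) x.
Proof.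
  intros H1 H2 H0. apply continuous_R_mult; [exact H1|].
  apply continuous_R_inv; assumption.
Qed.

Lemma continuous_Cplus {T : UniformSpace} (f g : T -> C) (x : T) :
  continuous f x -> continuous g x -> continuous (fun y => (f y + g y)%C) x.
Proof.
  intros Hf Hg. apply continuous_C_components; simpl; apply continuous_R_plus;
  auto using @continuous_C_fst, @continuous_C_snd.
Qed.

Lemma continuous_Copp {T : UniformSpace} (f : T -> C) (x : T) :
  continuous f x -> continuous (fun y => (- f y)%C) x.
Proof.
  intros Hf. apply continuous_C_components; simpl; apply continuous_R_opp;
  auto using @continuous_C_fst, @continuous_C_snd.
Qed.

Lemma continuous_Cminus {T : UniformSpace} (f g : T -> C) (x : T) :
  continuous f x -> continuous g x -> continuous (fun y => (f y - g y)%C) x.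
Proof.
  intros Hf Hg. apply continuous_Cplus; [exact Hf|]. apply continuous_Copp; exact Hg.
Qed.

Lemma continuous_Cmult {T : UniformSpace} (f g : T -> C) (x : T) :
  continuous f x -> continuous g x -> continuous (fun y => (f y * g y)%C) x.
Proof.
  intros Hf Hg. apply continuous_C_components; simpl;
  [apply continuous_R_minus | apply continuous_R_plus]; apply continuous_R_mult;
  auto using @continuous_C_fst, @continuous_C_snd.
Qed.

Lemma C_norm_sqr_neq_0 (z : C) : z <> 0 -> fst z ^ 2 + snd z ^ 2 <> 0.
Proof.
  intros Hz H. apply Hz. apply Cmod_eq_0.
  assert (H1 := Cmod_sqr z). assert (H2 := Cmod_ge_0 z). nra.
Qed.

Lemma continuous_C_norm_sqr {T : UniformSpace} (f : T -> C) (x : T) :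
  continuous f x -> continuous (fun y => fst (f y) ^ 2 + snd (f y) ^ 2) x.
Proof.
  intros Hf.
  apply (continuous_R_plus (fun y => fst (f y) ^ 2) (fun y => snd (f y) ^ 2)).
  - apply (continuous_R_mult (fun y => fst (f y)) (fun y => fst (f y) ^ 1));
    [|apply (continuous_R_mult (fun y => fst (f y)) (fun _ => 1)); [|apply continuous_const]];
    apply continuous_C_fst; exact Hf.
  - apply (continuous_R_mult (fun y => snd (f y)) (fun y => snd (f y) ^ 1));
    [|apply (continuous_R_mult (fun y => snd (f y)) (fun _ => 1)); [|apply continuous_const]];
    apply continuous_C_snd; exact Hf.
Qed.

Lemma continuous_Cinv {T : UniformSpace} (f : T -> C) (x : T) :
  continuous f x -> f x <> 0 -> continuous (fun y => (/ f y)%C) x.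
Proof.
  intros Hf H0. assert (H1 := C_norm_sqr_neq_0 _ H0).
  assert (Hd : continuous (fun y => fst (f y) ^ 2 + snd (f y) ^ 2) x).
  { apply continuous_C_norm_sqr; exact Hf. }
  apply continuous_C_components; simpl; apply continuous_R_div; auto.
  - apply continuous_C_fst; exact Hf.
  - apply continuous_R_opp, continuous_C_snd; exact Hf.
Qed.

Lemma continuous_Cdiv {T : UniformSpace} (f g : T -> C) (x : T) :
  continuous f x -> continuous g x -> g x <> 0 ->
  continuous (fun y => (f y / g y)%C) x.
Proof.
  intros Hf Hg H0. apply continuous_Cmult; [exact Hf|].
  apply continuous_Cinv; assumption.
Qed.

Lemma continuous_RtoC {T : UniformSpace} (f : T -> R) (x : T) :
  continuous f x -> continuous (fun y => RtoC (f y)) x.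
Proof.
  intros Hf. apply continuous_C_components; simpl; [exact Hf|].
  apply continuous_const.
Qed.

Lemma continuous_Cmod {T : UniformSpace} (f : T -> C) (x : T) :
  continuous f x -> continuous (fun y => Cmod (f y)) x.
Proof.
  intros Hf. unfold Cmod.
  apply (continuous_comp (fun y => fst (f y) ^ 2 + snd (f y) ^ 2) sqrt).
  - apply continuous_C_norm_sqr; exact Hf.
  - apply continuous_sqrt.
Qed.

Lemma continuous_cos_comp {T : UniformSpace} (f : T -> R) (x : T) :
  continuous f x -> continuous (fun y => cos (f y)) x.
Proof. intros H. apply (continuous_comp f cos); [exact H|]. apply continuous_cos. Qed.

Lemma continuous_sin_comp {T : UniformSpace} (f : T -> R) (x : T) :
  continuous f x -> continuous (fun y => sin (f y)) x.
Proof. intros H. apply (continuous_comp f sin); [exact H|]. apply continuous_sin. Qed.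

Lemma continuous_pair_C {T : UniformSpace} (f g : T -> R) (x : T) :
  continuous f x -> continuous g x ->
  continuous (U := C_UniformSpace) (fun y => (f y, g y)) x.
Proof. intros Hf Hg. apply continuous_C_components; simpl; assumption. Qed.

Lemma continuous_circle {T : UniformSpace} (r th : T -> R) (x : T) :
  continuous r x -> continuous th x -> continuous (fun y => circle (r y) (th y)) x.
Proof.
  intros Hr Ht. apply continuous_pair_C; apply continuous_R_mult;
  auto using @continuous_cos_comp, @continuous_sin_comp.
Qed.

Lemma continuous_circle_angle (r th : R) : continuous (circle r) th.
Proof.
  apply (continuous_circle (fun _ => r) (fun t => t)); [apply continuous_const | apply continuous_id].
Qed.

Lemma continuous_Rpower_base {T : UniformSpace} (f : T -> R) (a : R) (x : T) :
  continuous f x -> 0 < f x -> continuous (fun y => Rpower (f y) a) x.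
Proof.
  intros Hf H0. apply (continuous_comp f (fun u => Rpower u a)); [exact Hf|].
  apply @ex_derive_continuous with (K := R_AbsRing) (V := R_NormedModule).
  unfold Rpower. auto_derive. exact H0.
Qed.

(** Descends through the arithmetic head symbol of a map, leaving the
    continuity of the atoms and the non-vanishing of denominators. *)
Ltac cont_step :=
  lazymatch goal with
  | |- continuous (fun _ => ?c) _ => apply continuous_const
  | |- continuous (fun y => y) _ => apply continuous_id
  | |- continuous (circle ?r) _ => apply continuous_circle_angle
  | |- continuous (fun y => Rplus (@?a y) (@?b y)) _ => apply (continuous_R_plus a b)
  | |- continuous (fun y => Rminus (@?a y) (@?b y)) _ => apply (continuous_R_minus a b)
  | |- continuous (fun y => Rmult (@?a y) (@?b y)) _ => apply (continuous_R_mult a b)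
  | |- continuous (fun y => Ropp (@?a y)) _ => apply (continuous_R_opp a)
  | |- continuous (fun y => Rinv (@?a y)) _ => apply (continuous_R_inv a)
  | |- continuous (fun y => Rdiv (@?a y) (@?b y)) _ => apply (continuous_R_div a b)
  | |- continuous (fun y => pow (@?a y) 2) _ =>
      apply (continuous_R_mult a (fun y => pow (a y) 1))
  | |- continuous (fun y => pow (@?a y) 1) _ =>
      apply (continuous_R_mult a (fun y => 1))
  | |- continuous (fun y => cos (@?a y)) _ => apply (continuous_cos_comp a)
  | |- continuous (fun y => sin (@?a y)) _ => apply (continuous_sin_comp a)
  | |- continuous (fun y => Cmod (@?a y)) _ => apply (continuous_Cmod a)
  | |- continuous (fun y => RtoC (@?a y)) _ => apply (continuous_RtoC a)
  | |- continuous (fun y => circle (@?a y) (@?b y)) _ => apply (continuous_circle a b)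
  | |- continuous (fun y => Cplus (@?a y) (@?b y)) _ => apply (continuous_Cplus a b)
  | |- continuous (fun y => Cminus (@?a y) (@?b y)) _ => apply (continuous_Cminus a b)
  | |- continuous (fun y => Cmult (@?a y) (@?b y)) _ => apply (continuous_Cmult a b)
  | |- continuous (fun y => Copp (@?a y)) _ => apply (continuous_Copp a)
  | |- continuous (fun y => Cinv (@?a y)) _ => apply (continuous_Cinv a)
  | |- continuous (fun y => Cdiv (@?a y) (@?b y)) _ => apply (continuous_Cdiv a b)
  | |- continuous (fun y => Rpower (@?a y) ?c) _ => apply (continuous_Rpower_base a c)
  | |- continuous (fun y => fst (@?a y)) _ => first [assumption | apply continuous_fst | apply (continuous_C_fst a)]
  | |- continuous (fun y => snd (@?a y)) _ => first [assumption | apply continuous_snd | apply (continuous_C_snd a)]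
  end.

Ltac cont := repeat (try assumption; cont_step); try assumption.

Lemma continuous_C_eps {T : UniformSpace} (f : T -> C) (x : T) :
  continuous f x <->
  (forall eps, 0 < eps -> locally x (fun y => Cmod (f y - f x) < eps)).
Proof.
  split.
  - intros H eps He.
    assert (Hs : 0 < eps / 2) by lra.
    generalize (H _ (locally_ball (f x) (mkposreal _ Hs))).
    unfold filtermap. apply filter_imp. intros y [B1 B2].
    eapply Rle_lt_trans; [apply Cmod_le_abs_sum|].
    change (Rabs (fst (f y) - fst (f x)) < eps / 2) in B1.
    change (Rabs (snd (f y) - snd (f x)) < eps / 2) in B2.
    change (Rabs (fst (f y) - fst (f x)) + Rabs (snd (f y) - snd (f x)) < eps).
    lra.
  - intros H P [eps HP]. generalize (H eps (cond_pos eps)).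
    unfold filtermap. apply filter_imp. intros y Hy. apply HP.
    apply C_NormedModule_mixin_compat1. exact Hy.
Qed.

(** Continuity at a point of the plane, with Euclidean balls in place of the
    coordinate boxes of the product topology. *)
Lemma continuous_C_ball (f : C -> C) (z : C) :
  continuous f z <->
  (forall eps, 0 < eps -> exists del, 0 < del /\
     forall w, Cmod (w - z) < del -> Cmod (f w - f z) < eps).
Proof.
  rewrite continuous_C_eps. split; intros H eps He.
  - destruct (H eps He) as [d Hd]. exists d. split; [apply cond_pos|].
    intros w Hw. apply Hd. apply C_NormedModule_mixin_compat1. exact Hw.
  - destruct (H eps He) as [d [Hd0 Hd]].
    assert (Hs : 0 < d / 2) by lra.
    exists (mkposreal _ Hs). intros w [B1 B2]. apply Hd.
    eapply Rle_lt_trans; [apply Cmod_le_abs_sum|].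
    change (Rabs (fst w - fst z) < d / 2) in B1.
    change (Rabs (snd w - snd z) < d / 2) in B2.
    change (Rabs (fst w - fst z) + Rabs (snd w - snd z) < d).
    lra.
Qed.

(** * Complex derivatives and derivatives of paths *)

(** The complex derivative in the form in which remainders are estimated below. *)
Definition cder (f : C -> C) (z l : C) : Prop :=
  forall eps, 0 < eps -> exists del, 0 < del /\ forall w, Cmod (w - z) < del ->
    Cmod (f w - f z - l * (w - z)) <= eps * Cmod (w - z).

Definition cdiff (f : C -> C) (z : C) : Prop := exists l, cder f z l.

Lemma cder_is_derive (f : C -> C) (z l : C) :
  cder f z l <-> @is_derive C_AbsRing C_NormedModule f z l.
Proof.
  split.
  - intros H. split; [apply is_linear_scal_l|].
    intros x Hx.
    apply (@is_filter_lim_locally_unique C_AbsRing (AbsRing_NormedModule C_AbsRing)) in Hx.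
    subst x.
    intros eps. destruct (H eps (cond_pos eps)) as [d [Hd0 Hd]].
    exists (mkposreal d Hd0). intros w Hw.
    assert (Hw' : Cmod (w - z) < d) by exact Hw.
    generalize (Hd w Hw').
    change (Cmod (f w - f z - l * (w - z)) <= eps * Cmod (w - z) ->
            Cmod (f w - f z - (w - z) * l) <= eps * Cmod (w - z)).
    rewrite (Cmult_comm l). auto.
  - intros [_ H] eps He.
    destruct (H z (fun P HP => HP) (mkposreal eps He)) as [d Hd].
    exists d. split; [apply cond_pos|]. intros w Hw.
    generalize (Hd w Hw).
    change (Cmod (f w - f z - (w - z) * l) <= eps * Cmod (w - z) ->
            Cmod (f w - f z - l * (w - z)) <= eps * Cmod (w - z)).
    rewrite (Cmult_comm l). auto.
Qed.

Lemma cdiff_ex_derive (f : C -> C) (z : C) :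
  cdiff f z <-> @ex_derive C_AbsRing C_NormedModule f z.
Proof. split; intros [l Hl]; exists l; apply cder_is_derive; exact Hl. Qed.

Lemma cder_continuous (f : C -> C) (z l : C) : cder f z l -> continuous f z.
Proof.
  intros H. apply continuous_C_ball. intros eps He.
  destruct (H 1 Rlt_0_1) as [d [Hd0 Hd]].
  assert (Hl := Cmod_ge_0 l).
  exists (Rmin d (eps / (2 + Cmod l))). split.
  { apply Rmin_glb_lt; [exact Hd0|]. apply Rdiv_lt_0_compat; lra. }
  intros w Hw.
  assert (H1 : Cmod (w - z) < d) by (eapply Rlt_le_trans; [exact Hw | apply Rmin_l]).
  assert (H2 : Cmod (w - z) < eps / (2 + Cmod l))
    by (eapply Rlt_le_trans; [exact Hw | apply Rmin_r]).
  specialize (Hd w H1).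
  replace (f w - f z)%C with ((f w - f z - l * (w - z)) + l * (w - z))%C by ring.
  eapply Rle_lt_trans; [apply Cmod_triangle|]. rewrite Cmod_mult.
  apply Rmult_lt_compat_r with (r := 2 + Cmod l) in H2; [|lra].
  unfold Rdiv in H2. rewrite Rmult_assoc, Rinv_l in H2 by lra.
  assert (H3 := Cmod_ge_0 (w - z)). nra.
Qed.

Lemma cdiff_continuous (f : C -> C) (z : C) : cdiff f z -> continuous f z.
Proof. intros [l Hl]. exact (cder_continuous _ _ _ Hl). Qed.

Lemma cder_const (c z : C) : cder (fun _ => c) z 0.
Proof. apply cder_is_derive. exact (is_derive_const (V := C_NormedModule) c z). Qed.

Lemma cder_id (z : C) : cder (fun s => s) z 1.
Proof.
  intros eps He. exists 1. split; [lra|]. intros w _.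
  replace (w - z - 1 * (w - z))%C with (RtoC 0) by ring.
  rewrite Cmod_0. apply Rmult_le_pos; [lra | apply Cmod_ge_0].
Qed.

Lemma cder_plus (f g : C -> C) (z l m : C) :
  cder f z l -> cder g z m -> cder (fun s => (f s + g s)%C) z (l + m).
Proof.
  intros Hf Hg. apply cder_is_derive.
  apply (is_derive_plus (V := C_NormedModule) f g); apply cder_is_derive; assumption.
Qed.

Lemma cder_mult (f g : C -> C) (z l m : C) :
  cder f z l -> cder g z m -> cder (fun s => (f s * g s)%C) z (l * g z + f z * m).
Proof.
  intros Hf Hg eps He.
  assert (Pf := Cmod_ge_0 (f z)). assert (Pg := Cmod_ge_0 (g z)).
  assert (Pl := Cmod_ge_0 l). assert (Pm := Cmod_ge_0 m).
  set (K := 1 + Cmod (f z) + Cmod (g z) + Cmod l).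
  assert (HK : 0 < K) by (unfold K; lra).
  assert (He3 : 0 < eps / (3 * K)) by (apply Rdiv_lt_0_compat; lra).
  set (e := eps / (3 * K)) in *.
  assert (HeK : e * K = eps / 3) by (unfold e; field; lra).
  destruct (Hf e He3) as [d1 [Hd1 H1]].
  destruct (Hg e He3) as [d2 [Hd2 H2]].
  destruct (proj1 (continuous_C_ball g z) (cder_continuous _ _ _ Hg) e He3)
    as [d3 [Hd3 H3]].
  destruct (Hf 1 Rlt_0_1) as [d4 [Hd4 H4]].
  exists (Rmin (Rmin d1 d2) (Rmin d3 d4)).
  split; [repeat apply Rmin_glb_lt; assumption|]. intros w Hw.
  assert (A1 : Cmod (w - z) < Rmin d1 d2) by (eapply Rlt_le_trans; [exact Hw | apply Rmin_l]).
  assert (A2 : Cmod (w - z) < Rmin d3 d4) by (eapply Rlt_le_trans; [exact Hw | apply Rmin_r]).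
  specialize (H1 w (Rlt_le_trans _ _ _ A1 (Rmin_l _ _))).
  specialize (H2 w (Rlt_le_trans _ _ _ A1 (Rmin_r _ _))).
  specialize (H3 w (Rlt_le_trans _ _ _ A2 (Rmin_l _ _))).
  specialize (H4 w (Rlt_le_trans _ _ _ A2 (Rmin_r _ _))).
  assert (Pw := Cmod_ge_0 (w - z)).
  assert (H5 : Cmod (f w - f z) <= (1 + Cmod l) * Cmod (w - z)).
  { replace (f w - f z)%C with ((f w - f z - l * (w - z)) + l * (w - z))%C by ring.
    eapply Rle_trans; [apply Cmod_triangle|]. rewrite Cmod_mult. lra. }
  replace (f w * g w - f z * g z - (l * g z + f z * m) * (w - z))%C
    with ((f w - f z - l * (w - z)) * g z + f z * (g w - g z - m * (w - z))
          + (f w - f z) * (g w - g z))%C by ring.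
  eapply Rle_trans; [apply Cmod_triangle|].
  eapply Rle_trans; [apply Rplus_le_compat_r, Cmod_triangle|].
  rewrite !Cmod_mult.
  assert (B1 : Cmod (f w - f z - l * (w - z)) * Cmod (g z) <= e * Cmod (w - z) * Cmod (g z))
    by (apply Rmult_le_compat_r; assumption).
  assert (B2 : Cmod (f z) * Cmod (g w - g z - m * (w - z)) <= Cmod (f z) * (e * Cmod (w - z)))
    by (apply Rmult_le_compat_l; assumption).
  assert (B3 : Cmod (f w - f z) * Cmod (g w - g z) <= (1 + Cmod l) * Cmod (w - z) * e).
  { apply Rmult_le_compat; try apply Cmod_ge_0; [exact H5 | lra]. }
  assert (B4 : e * K * Cmod (w - z) = eps / 3 * Cmod (w - z)) by (rewrite HeK; reflexivity).
  unfold K in B4. nra.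
Qed.

Lemma cder_comp (f g : C -> C) (z l m : C) :
  cder f (g z) l -> cder g z m -> cder (fun s => f (g s)) z (l * m).
Proof.
  intros Hf Hg. apply cder_is_derive. rewrite Cmult_comm.
  apply (is_derive_comp (K := C_AbsRing) (V := C_NormedModule) f g z l m).
  - apply cder_is_derive; exact Hf.
  - generalize (proj1 (cder_is_derive _ _ _) Hg). intros [H1 H2]. split.
    + apply is_linear_scal_l.
    + exact H2.
Qed.

Lemma cder_inv (z : C) : z <> 0 -> cder Cinv z (- / (z * z)).
Proof.
  intros Hz eps He.
  assert (Hm : 0 < Cmod z) by (apply Cmod_gt_0; exact Hz).
  set (m := Cmod z) in *.
  exists (Rmin (m / 2) (eps * m * m * m / 2)). split.
  { apply Rmin_glb_lt; [lra|]. apply Rdiv_lt_0_compat; [|lra].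
    repeat apply Rmult_lt_0_compat; assumption. }
  intros w Hw.
  assert (A1 : Cmod (w - z) < m / 2) by (eapply Rlt_le_trans; [exact Hw | apply Rmin_l]).
  assert (A2 : Cmod (w - z) < eps * m * m * m / 2)
    by (eapply Rlt_le_trans; [exact Hw | apply Rmin_r]).
  assert (Hwm : m / 2 <= Cmod w).
  { assert (H := Cmod_triangle_rev z w). rewrite Cmod_sub_comm in H. fold m in H. lra. }
  assert (Hw0 : w <> 0).
  { intros E. rewrite E, Cmod_0 in Hwm. lra. }
  replace (/ w - / z - - / (z * z) * (w - z))%C
    with ((w - z) * ((w - z) / (w * (z * z))))%C by (field; split; assumption).
  rewrite Cmod_mult, Rmult_comm. apply Rmult_le_compat_r; [apply Cmod_ge_0|].
  rewrite Cmod_div by (repeat apply Cmult_neq_0; assumption).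
  rewrite !Cmod_mult. fold m.
  apply div_le_of_le_mul.
  { apply Rmult_lt_0_compat; [lra|]. apply Rmult_lt_0_compat; lra. }
  assert (H : eps * (m / 2 * (m * m)) <= eps * (Cmod w * (m * m))).
  { apply Rmult_le_compat_l; [lra|]. apply Rmult_le_compat_r; [nra | exact Hwm]. }
  lra.
Qed.

Lemma cdiff_const (c z : C) : cdiff (fun _ => c) z.
Proof. exists (RtoC 0). apply cder_const. Qed.

Lemma cdiff_id (z : C) : cdiff (fun s => s) z.
Proof. exists (RtoC 1). apply cder_id. Qed.

Lemma cdiff_plus (f g : C -> C) (z : C) :
  cdiff f z -> cdiff g z -> cdiff (fun s => (f s + g s)%C) z.
Proof. intros [l Hl] [m Hm]. eexists. apply cder_plus; eassumption. Qed.

Lemma cdiff_mult (f g : C -> C) (z : C) :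
  cdiff f z -> cdiff g z -> cdiff (fun s => (f s * g s)%C) z.
Proof. intros [l Hl] [m Hm]. eexists. apply cder_mult; eassumption. Qed.

Lemma cder_ext (f g : C -> C) (z l : C) :
  (forall s, f s = g s) -> cder f z l -> cder g z l.
Proof.
  intros E H eps He. destruct (H eps He) as [d [Hd0 Hd]].
  exists d. split; [exact Hd0|]. intros w Hw. rewrite <- !E. auto.
Qed.

Lemma cder_opp (f : C -> C) (z l : C) :
  cder f z l -> cder (fun s => (- f s)%C) z (- l).
Proof.
  intros H. apply (cder_ext (fun s => (-(1)) * f s)%C); [intros s; ring|].
  replace (- l)%C with (0 * f z + (-(1)) * l)%C by ring.
  apply (cder_mult (fun _ => (-(1))%C)); [apply cder_const | exact H].
Qed.

Lemma cdiff_opp (f : C -> C) (z : C) : cdiff f z -> cdiff (fun s => (- f s)%C) z.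
Proof. intros [l Hl]. eexists. apply cder_opp; eassumption. Qed.

Lemma cdiff_minus (f g : C -> C) (z : C) :
  cdiff f z -> cdiff g z -> cdiff (fun s => (f s - g s)%C) z.
Proof. intros Hf Hg. apply cdiff_plus; [exact Hf | apply cdiff_opp; exact Hg]. Qed.

Lemma cdiff_comp (f g : C -> C) (z : C) :
  cdiff f (g z) -> cdiff g z -> cdiff (fun s => f (g s)) z.
Proof. intros [l Hl] [m Hm]. eexists. apply cder_comp; eassumption. Qed.

Lemma cdiff_inv (f : C -> C) (z : C) :
  cdiff f z -> f z <> 0 -> cdiff (fun s => (/ f s)%C) z.
Proof.
  intros Hf H0. apply (cdiff_comp Cinv f); [|exact Hf].
  eexists. apply cder_inv; exact H0.
Qed.

Lemma cdiff_div (f g : C -> C) (z : C) :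
  cdiff f z -> cdiff g z -> g z <> 0 -> cdiff (fun s => (f s / g s)%C) z.
Proof.
  intros Hf Hg H0. apply cdiff_mult; [exact Hf|]. apply cdiff_inv; assumption.
Qed.

(** A path is differentiated componentwise, so that its derivatives can be
    computed by the real calculus. *)
Definition rder (g : R -> C) (t : R) (l : C) : Prop :=
  is_derive (fun s => fst (g s)) t (fst l) /\ is_derive (fun s => snd (g s)) t (snd l).

Lemma is_derive_eps (f : R -> R) (t l : R) :
  is_derive f t l <->
  (forall eps, 0 < eps -> exists del, 0 < del /\ forall s, Rabs (s - t) < del ->
     Rabs (f s - f t - l * (s - t)) <= eps * Rabs (s - t)).
Proof.
  split.
  - intros [_ H] eps He.
    destruct (H t (fun P HP => HP) (mkposreal eps He)) as [d Hd].
    exists d. split; [apply cond_pos|]. intros s Hs.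
    generalize (Hd s Hs).
    change (Rabs (f s - f t - (s - t) * l) <= eps * Rabs (s - t) ->
            Rabs (f s - f t - l * (s - t)) <= eps * Rabs (s - t)).
    rewrite (Rmult_comm l). auto.
  - intros H. split; [apply is_linear_scal_l|].
    intros x Hx. apply (@is_filter_lim_locally_unique R_AbsRing R_NormedModule) in Hx. subst x.
    intros eps. destruct (H eps (cond_pos eps)) as [d [Hd0 Hd]].
    exists (mkposreal d Hd0). intros s Hs. generalize (Hd s Hs).
    change (Rabs (f s - f t - l * (s - t)) <= eps * Rabs (s - t) ->
            Rabs (f s - f t - (s - t) * l) <= eps * Rabs (s - t)).
    rewrite (Rmult_comm l). auto.
Qed.

Lemma rder_eps (g : R -> C) (t : R) (l : C) :
  rder g t l <->
  (forall eps, 0 < eps -> exists del, 0 < del /\ forall s, Rabs (s - t) < del ->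
     Cmod (g s - g t - l * RtoC (s - t)) <= eps * Rabs (s - t)).
Proof.
  unfold rder. rewrite !is_derive_eps. split.
  - intros [H1 H2] eps He.
    destruct (H1 (eps / 2)) as [d1 [Hd1 A1]]; [lra|].
    destruct (H2 (eps / 2)) as [d2 [Hd2 A2]]; [lra|].
    exists (Rmin d1 d2). split; [apply Rmin_glb_lt; assumption|]. intros s Hs.
    specialize (A1 s (Rlt_le_trans _ _ _ Hs (Rmin_l _ _))).
    specialize (A2 s (Rlt_le_trans _ _ _ Hs (Rmin_r _ _))).
    eapply Rle_trans; [apply Cmod_le_abs_sum|]. simpl.
    replace (fst (g s) + - fst (g t) + - (fst l * (s - t) - snd l * 0))
      with (fst (g s) - fst (g t) - fst l * (s - t)) by ring.
    replace (snd (g s) + - snd (g t) + - (fst l * 0 + snd l * (s - t)))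
      with (snd (g s) - snd (g t) - snd l * (s - t)) by ring.
    lra.
  - intros H. split; intros eps He; destruct (H eps He) as [d [Hd0 Hd]];
    exists d; (split; [exact Hd0|]); intros s Hs; specialize (Hd s Hs);
    (eapply Rle_trans; [|exact Hd]).
    + eapply Rle_trans; [|apply Rabs_fst_le_Cmod]. simpl. right. f_equal. ring.
    + eapply Rle_trans; [|apply Rabs_snd_le_Cmod]. simpl. right. f_equal. ring.
Qed.

Lemma rder_continuous (g : R -> C) (t : R) (l : C) : rder g t l -> continuous g t.
Proof.
  intros [H1 H2]. apply continuous_C_components;
  apply @ex_derive_continuous with (K := R_AbsRing) (V := R_NormedModule);
  eexists; eassumption.
Qed.

Lemma rder_comp (f : C -> C) (g : R -> C) (t : R) (l m : C) :
  cder f (g t) l -> rder g t m -> rder (fun s => f (g s)) t (l * m).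
Proof.
  intros Hf Hg. apply rder_eps. intros eps He.
  assert (Hg' := proj1 (rder_eps _ _ _) Hg).
  assert (Pl := Cmod_ge_0 l). assert (Pm := Cmod_ge_0 m).
  destruct (Hg' 1 Rlt_0_1) as [d1 [Hd1 H1]].
  set (e := eps / (2 * (1 + Cmod l + Cmod m))).
  assert (He' : 0 < e) by (apply Rdiv_lt_0_compat; lra).
  assert (HeK : e * (1 + Cmod l + Cmod m) = eps / 2) by (unfold e; field; lra).
  destruct (Hg' e He') as [d2 [Hd2 H2]].
  destruct (Hf e He') as [d3 [Hd3 H3]].
  exists (Rmin (Rmin d1 d2) (d3 / (1 + Cmod m))). split.
  { repeat apply Rmin_glb_lt; try assumption. apply Rdiv_lt_0_compat; lra. }
  intros s Hs.
  assert (A1 : Rabs (s - t) < Rmin d1 d2) by (eapply Rlt_le_trans; [exact Hs | apply Rmin_l]).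
  assert (A2 : Rabs (s - t) < d3 / (1 + Cmod m))
    by (eapply Rlt_le_trans; [exact Hs | apply Rmin_r]).
  specialize (H1 s (Rlt_le_trans _ _ _ A1 (Rmin_l _ _))).
  specialize (H2 s (Rlt_le_trans _ _ _ A1 (Rmin_r _ _))).
  assert (Ps := Rabs_pos (s - t)).
  assert (B : Cmod (g s - g t) <= (1 + Cmod m) * Rabs (s - t)).
  { replace (g s - g t)%C with ((g s - g t - m * RtoC (s - t)) + m * RtoC (s - t))%C by ring.
    eapply Rle_trans; [apply Cmod_triangle|]. rewrite Cmod_mult, Cmod_R. lra. }
  assert (B2 : Cmod (g s - g t) < d3).
  { eapply Rle_lt_trans; [exact B|].
    apply Rmult_lt_compat_l with (r := 1 + Cmod m) in A2; [|lra].
    replace ((1 + Cmod m) * (d3 / (1 + Cmod m))) with d3 in A2 by (field; lra).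
    exact A2. }
  specialize (H3 _ B2).
  replace (f (g s) - f (g t) - l * m * RtoC (s - t))%C
    with ((f (g s) - f (g t) - l * (g s - g t)) + l * (g s - g t - m * RtoC (s - t)))%C by ring.
  eapply Rle_trans; [apply Cmod_triangle|]. rewrite Cmod_mult.
  assert (C1 : Cmod l * Cmod (g s - g t - m * RtoC (s - t)) <= Cmod l * (e * Rabs (s - t)))
    by (apply Rmult_le_compat_l; assumption).
  assert (C2 : e * Cmod (g s - g t) <= e * ((1 + Cmod m) * Rabs (s - t)))
    by (apply Rmult_le_compat_l; lra).
  assert (C3 : e * (1 + Cmod l + Cmod m) * Rabs (s - t) = eps / 2 * Rabs (s - t))
    by (rewrite HeK; reflexivity).
  nra.
Qed.

Lemma rder_RtoC (t : R) : rder RtoC t 1.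
Proof.
  split; simpl; [apply @is_derive_id | apply @is_derive_const].
Qed.

Lemma rder_real (f : C -> C) (t : R) (l : C) :
  cder f (RtoC t) l -> rder (fun s => f (RtoC s)) t l.
Proof.
  intros H. rewrite <- (Cmult_1_r l). apply rder_comp; [exact H | apply rder_RtoC].
Qed.

Lemma rder_circle (r th : R) : rder (circle r) th (Ci * circle r th).
Proof.
  unfold rder, circle; simpl. split; auto_derive; auto; ring.
Qed.

(** Mean value inequality: it is the real mean value theorem applied to the
    component of the path in the direction of the total displacement. *)
Lemma path_mean_value (g g' : R -> C) (a b m : R) (q : C) :
  a <= b -> (forall t, a <= t <= b -> rder g t (g' t)) ->
  (forall t, a <= t <= b -> Cmod (g' t - q) <= m) ->
  Cmod (g b - g a - q * RtoC (b - a)) <= m * (b - a).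
Proof.
  intros Hab Hg Hm.
  set (D := (g b - g a - q * RtoC (b - a))%C).
  destruct (Req_dec (Cmod D) 0) as [E|E].
  { rewrite E. apply Rmult_le_pos; [|lra].
    eapply Rle_trans; [apply Cmod_ge_0 | apply (Hm a); lra]. }
  assert (HD : 0 < Cmod D) by (generalize (Cmod_ge_0 D); lra).
  set (psi := fun t => fst D * (fst (g t) - fst q * t) + snd D * (snd (g t) - snd q * t)).
  set (dpsi := fun t => fst D * (fst (g' t) - fst q) + snd D * (snd (g' t) - snd q)).
  destruct (MVT_gen psi a b dpsi) as [c [Hc Ec]].
  - intros t Ht. rewrite Rmin_left, Rmax_right in Ht by lra.
    destruct (Hg t) as [H1 H2]; [lra|]. unfold psi, dpsi.
    evar_last.
    { apply @is_derive_plus; apply @is_derive_scal; apply @is_derive_minus.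
      - exact H1.
      - apply @is_derive_scal. apply @is_derive_id.
      - exact H2.
      - apply @is_derive_scal. apply @is_derive_id. }
    unfold minus, plus, opp, mult, one; simpl. unfold scal; simpl. unfold mult, one; simpl. ring.
  - intros t Ht. rewrite Rmin_left, Rmax_right in Ht by lra.
    apply continuity_pt_filterlim. assert (Hc := rder_continuous _ _ _ (Hg t Ht)).
    assert (Hc1 := continuous_C_fst _ _ Hc). assert (Hc2 := continuous_C_snd _ _ Hc).
    change (continuous psi t). unfold psi. cont.
  - rewrite Rmin_left, Rmax_right in Hc by lra.
    assert (E1 : psi b - psi a = Cmod D * Cmod D).
    { rewrite Cmod_sqr. unfold psi. unfold D at 5 6. simpl. unfold D. simpl. ring. }
    assert (E2 : dpsi c <= Cmod D * m).
    { assert (B := Hm c Hc). assert (P := Cmod_ge_0 (g' c - q)).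
      assert (S1 := Cmod_sqr D). assert (S2 := Cmod_sqr (g' c - q)).
      apply Rle_trans with (Cmod D * Cmod (g' c - q)); [|apply Rmult_le_compat_l; lra].
      unfold dpsi. simpl in S2.
      set (u := fst (g' c) + - fst q) in *. set (v := snd (g' c) + - snd q) in *.
      change (fst D * u + snd D * v <= Cmod D * Cmod (g' c - q)).
      set (x := Cmod (g' c - q)) in *.
      apply Rsqr_incr_0_var; [|apply Rmult_le_pos; lra]. unfold Rsqr.
      replace (Cmod D * x * (Cmod D * x)) with ((Cmod D * Cmod D) * (x * x)) by ring.
      rewrite S1, S2.
      generalize (Rle_0_sqr (fst D * v - snd D * u)). unfold Rsqr. lra. }
    rewrite Ec in E1.
    apply Rmult_le_reg_l with (Cmod D); [exact HD|].
    apply Rle_trans with (dpsi c * (b - a)); [lra|].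
    replace (Cmod D * (m * (b - a))) with ((Cmod D * m) * (b - a)) by ring.
    apply Rmult_le_compat_r; lra.
Qed.


(** * Integrals of continuous functions *)

(** [ring] and [field] do not see through the canonical structures on [R] in which
    the lemmas on integrals state their equations. *)
Ltac R_equation := match goal with |- @eq _ ?x ?y => change (@eq R x y) end.

Lemma ex_RInt_cont (f : R -> R) (a b : R) :
  a <= b -> (forall t, a <= t <= b -> continuous f t) -> ex_RInt f a b.
Proof.
  intros Hab H. apply (ex_RInt_continuous (V := R_CompleteNormedModule)).
  rewrite Rmin_left, Rmax_right by lra. exact H.
Qed.

Lemma RInt_le_cont (f g : R -> R) (a b : R) :
  a <= b -> (forall t, a <= t <= b -> continuous f t) ->
  (forall t, a <= t <= b -> continuous g t) ->
  (forall t, a <= t <= b -> f t <= g t) -> RInt f a b <= RInt g a b.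
Proof.
  intros Hab Hf Hg H. apply RInt_le; auto using ex_RInt_cont.
  intros t Ht. apply H. lra.
Qed.

Lemma RInt_nonneg_cont (f : R -> R) (a b : R) :
  a <= b -> (forall t, a <= t <= b -> continuous f t) ->
  (forall t, a <= t <= b -> 0 <= f t) -> 0 <= RInt f a b.
Proof.
  intros Hab Hf H. apply RInt_ge_0; auto using ex_RInt_cont.
  intros t Ht. apply H. lra.
Qed.

Lemma RInt_Chasles_cont (f : R -> R) (a b c : R) :
  a <= b -> b <= c -> (forall t, a <= t <= c -> continuous f t) ->
  RInt f a c = RInt f a b + RInt f b c.
Proof.
  intros Hab Hbc Hf. symmetry.
  apply (RInt_Chasles (V := R_CompleteNormedModule)); apply ex_RInt_cont; auto;
  intros t Ht; apply Hf; lra.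
Qed.

Lemma RInt_scal_cont (f : R -> R) (k a b : R) :
  a <= b -> (forall t, a <= t <= b -> continuous f t) ->
  RInt (fun t => k * f t) a b = k * RInt f a b.
Proof.
  intros Hab Hf.
  apply (RInt_scal (V := R_CompleteNormedModule) f a b k). apply ex_RInt_cont; auto.
Qed.

Lemma RInt_plus_cont (f g : R -> R) (a b : R) :
  a <= b -> (forall t, a <= t <= b -> continuous f t) ->
  (forall t, a <= t <= b -> continuous g t) ->
  RInt (fun t => f t + g t) a b = RInt f a b + RInt g a b.
Proof.
  intros Hab Hf Hg.
  apply (RInt_plus (V := R_CompleteNormedModule) f g a b); apply ex_RInt_cont; auto.
Qed.

Lemma RInt_minus_cont (f g : R -> R) (a b : R) :
  a <= b -> (forall t, a <= t <= b -> continuous f t) ->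
  (forall t, a <= t <= b -> continuous g t) ->
  RInt (fun t => f t - g t) a b = RInt f a b - RInt g a b.
Proof.
  intros Hab Hf Hg.
  apply (RInt_minus (V := R_CompleteNormedModule) f g a b); apply ex_RInt_cont; auto.
Qed.

Lemma RInt_const_R (k a b : R) : RInt (fun _ => k) a b = k * (b - a).
Proof. rewrite RInt_const. unfold scal; simpl; unfold mult; simpl. ring. Qed.

Lemma RInt_ext_le (f g : R -> R) (a b : R) :
  a <= b -> (forall t, a <= t <= b -> f t = g t) -> RInt f a b = RInt g a b.
Proof.
  intros Hab H. apply RInt_ext. rewrite Rmin_left, Rmax_right by lra.
  intros t Ht. apply H. lra.
Qed.

Lemma RInt_FTC (f df : R -> R) (a b : R) :
  a <= b -> (forall t, a <= t <= b -> is_derive f t (df t)) ->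
  (forall t, a <= t <= b -> continuous df t) -> RInt df a b = f b - f a.
Proof.
  intros Hab Hf Hd. apply is_RInt_unique.
  apply (is_RInt_derive (V := R_CompleteNormedModule) f df a b);
  rewrite Rmin_left, Rmax_right by lra; assumption.
Qed.

Lemma RInt_abs_le_const (f : R -> R) (a b m : R) :
  a <= b -> (forall t, a <= t <= b -> continuous f t) ->
  (forall t, a <= t <= b -> Rabs (f t) <= m) -> Rabs (RInt f a b) <= m * (b - a).
Proof.
  intros Hab Hf H. rewrite Rmult_comm. apply abs_RInt_le_const; auto using ex_RInt_cont.
Qed.

(** Defined through real integrals so that linearity, Chasles and the fundamental
    theorem are inherited from [RInt] without integrability witnesses. *)
Definition CI (f : R -> C) (a b : R) : C :=
  (RInt (fun t => fst (f t)) a b, RInt (fun t => snd (f t)) a b).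

Section ComplexIntegral.
Context (a b : R) (Hab : a <= b).

Lemma CI_is_RInt (f : R -> C) :
  (forall t, a <= t <= b -> continuous f t) ->
  @is_RInt C_R_NormedModule f a b (CI f a b).
Proof.
  intros Hf. apply (is_RInt_fct_extend_pair (U := R_NormedModule) (V := R_NormedModule));
  apply (RInt_correct (V := R_CompleteNormedModule)); apply ex_RInt_cont; auto;
  intros t Ht; [apply continuous_C_fst | apply continuous_C_snd]; auto.
Qed.

Lemma CI_ext (f g : R -> C) :
  (forall t, a <= t <= b -> f t = g t) -> CI f a b = CI g a b.
Proof.
  intros H. unfold CI. f_equal; apply RInt_ext_le; auto;
  intros t Ht; rewrite H; auto.
Qed.

Lemma CI_plus (f g : R -> C) :
  (forall t, a <= t <= b -> continuous f t) ->
  (forall t, a <= t <= b -> continuous g t) ->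
  CI (fun t => (f t + g t)%C) a b = (CI f a b + CI g a b)%C.
Proof.
  intros Hf Hg. unfold CI, Cplus. simpl.
  f_equal; apply RInt_plus_cont; auto; intros t Ht;
  first [apply continuous_C_fst | apply continuous_C_snd]; auto.
Qed.

Lemma CI_scal (c : C) (f : R -> C) :
  (forall t, a <= t <= b -> continuous f t) ->
  CI (fun t => (c * f t)%C) a b = (c * CI f a b)%C.
Proof.
  intros Hf.
  assert (H1 : forall t, a <= t <= b -> continuous (fun t => fst (f t)) t)
    by (intros; apply continuous_C_fst; auto).
  assert (H2 : forall t, a <= t <= b -> continuous (fun t => snd (f t)) t)
    by (intros; apply continuous_C_snd; auto).
  unfold CI, Cmult. simpl. f_equal.
  - rewrite RInt_minus_cont, !RInt_scal_cont; auto; intros; cont; auto.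
  - rewrite RInt_plus_cont, !RInt_scal_cont; auto; intros; cont; auto.
Qed.

Lemma CI_minus (f g : R -> C) :
  (forall t, a <= t <= b -> continuous f t) ->
  (forall t, a <= t <= b -> continuous g t) ->
  CI (fun t => (f t - g t)%C) a b = (CI f a b - CI g a b)%C.
Proof.
  intros Hf Hg.
  transitivity (CI (fun t => (f t + (-(1)) * g t)%C) a b).
  { apply CI_ext. intros. ring. }
  rewrite CI_plus, CI_scal; auto; [ring|]. intros; cont; auto.
Qed.

(** The triangle inequality for vector-valued integrals: the norm of [C] as a
    product of two copies of [R] is the modulus. *)
Lemma CI_norm (f : R -> C) :
  (forall t, a <= t <= b -> continuous f t) ->
  Cmod (CI f a b) <= RInt (fun t => Cmod (f t)) a b.
Proof.
  intros Hf.
  assert (E : forall z : C, norm (V := C_R_NormedModule) z = Cmod z).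
  { intros [x y]. unfold Cmod. simpl.
    change (sqrt (Rabs x ^ 2 + Rabs y ^ 2) = sqrt (x * (x * 1) + y * (y * 1))).
    f_equal. rewrite !pow2_abs. ring. }
  rewrite <- E.
  apply (norm_RInt_le (V := C_R_NormedModule) f (fun t => Cmod (f t)) a b).
  - exact Hab.
  - intros t _. rewrite E. apply Rle_refl.
  - apply CI_is_RInt. exact Hf.
  - apply (RInt_correct (V := R_CompleteNormedModule)). apply ex_RInt_cont; auto.
    intros; cont; auto.
Qed.

Lemma CI_norm_const (f : R -> C) (m : R) :
  (forall t, a <= t <= b -> continuous f t) ->
  (forall t, a <= t <= b -> Cmod (f t) <= m) -> Cmod (CI f a b) <= m * (b - a).
Proof.
  intros Hf Hm. eapply Rle_trans; [apply CI_norm; exact Hf|].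
  rewrite <- RInt_const_R. apply RInt_le_cont; auto; intros; cont; auto.
Qed.

Lemma CI_FTC (g g' : R -> C) :
  (forall t, a <= t <= b -> rder g t (g' t)) ->
  (forall t, a <= t <= b -> continuous g' t) -> CI g' a b = (g b - g a)%C.
Proof.
  intros Hg Hc. unfold CI. apply injective_projections; simpl.
  - rewrite (RInt_FTC (fun t => fst (g t))); auto; intros t Ht;
    [apply Hg | apply continuous_C_fst]; auto.
  - rewrite (RInt_FTC (fun t => snd (g t))); auto; intros t Ht;
    [apply Hg | apply continuous_C_snd]; auto.
Qed.

Lemma CI_conj (f : R -> C) :
  (forall t, a <= t <= b -> continuous f t) ->
  CI (fun t => Cconj (f t)) a b = Cconj (CI f a b).
Proof.
  intros Hf. unfold CI, Cconj. simpl. f_equal.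
  rewrite <- (RInt_opp (V := R_CompleteNormedModule)); [reflexivity|].
  apply ex_RInt_cont; auto. intros; apply continuous_C_snd; auto.
Qed.

Lemma CI_const (c : C) : CI (fun _ => c) a b = (c * RtoC (b - a))%C.
Proof.
  unfold CI. rewrite !RInt_const_R. unfold Cmult. simpl. f_equal; ring.
Qed.

Lemma CI_RtoC (f : R -> R) : CI (fun t => RtoC (f t)) a b = RtoC (RInt f a b).
Proof.
  unfold CI, RtoC; simpl. f_equal. rewrite (RInt_const_R 0). apply Rmult_0_l.
Qed.

End ComplexIntegral.

Lemma CI_Chasles (f : R -> C) (a b c : R) :
  a <= b -> b <= c -> (forall t, a <= t <= c -> continuous f t) ->
  CI f a c = (CI f a b + CI f b c)%C.
Proof.
  intros Hab Hbc Hf. unfold CI, Cplus. simpl.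
  f_equal; apply RInt_Chasles_cont; auto; intros t Ht;
  first [apply continuous_C_fst | apply continuous_C_snd]; auto.
Qed.

(** * Integrals depending on a parameter *)

Lemma continuous_2d (K : R -> R -> R) (x y : R) :
  continuous (fun p : R * R => K (fst p) (snd p)) (x, y) <-> continuity_2d_pt K x y.
Proof. symmetry. apply continuity_2d_pt_filterlim. Qed.

Lemma continuous_slice_1 {U : UniformSpace} (K : R -> R -> U) (x y : R) :
  continuous (fun p : R * R => K (fst p) (snd p)) (x, y) ->
  continuous (fun t => K t y) x.
Proof.
  intros H. apply (continuous_comp_2 (fun t => t) (fun _ => y) K x).
  - apply continuous_id.
  - apply continuous_const.
  - exact H.
Qed.

Lemma continuous_slice_2 {U : UniformSpace} (K : R -> R -> U) (x y : R) :
  continuous (fun p : R * R => K (fst p) (snd p)) (x, y) ->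
  continuous (fun t => K x t) y.
Proof.
  intros H. apply (continuous_comp_2 (fun _ => x) (fun t => t) K y).
  - apply continuous_const.
  - apply continuous_id.
  - exact H.
Qed.

(** The integrand is uniformly continuous near the compact segment above [y0]. *)
Lemma continuous_RInt_param (K : R -> R -> R) (a b y0 : R) :
  a <= b ->
  (forall x, a <= x <= b -> continuous (fun p : R * R => K (fst p) (snd p)) (x, y0)) ->
  locally y0 (fun y => forall x, a <= x <= b -> continuous (fun t => K t y) x) ->
  continuous (fun y => RInt (fun x => K x y) a b) y0.
Proof.
  intros Hab HK Hloc P [eps HP].
  assert (He : 0 < eps / (b - a + 1)) by (apply Rdiv_lt_0_compat; [apply cond_pos | lra]).
  destruct (uniform_continuity_2d_1d K a b y0) with (eps := mkposreal _ He) as [d Hd].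
  { intros x Hx. apply continuous_2d. auto. }
  simpl in Hd. unfold filtermap.
  generalize (filter_and _ _ Hloc (locally_ball y0 d)). apply filter_imp.
  intros y [Hy1 Hy2]. apply HP.
  change (Rabs (y - y0) < d) in Hy2. apply Rabs_def2 in Hy2.
  change (Rabs (RInt (fun x => K x y) a b - RInt (fun x => K x y0) a b) < eps).
  assert (C1 : forall x, a <= x <= b -> continuous (fun t => K t y0) x).
  { intros x Hx. apply continuous_slice_1; auto. }
  rewrite <- RInt_minus_cont; auto.
  eapply Rle_lt_trans.
  { apply RInt_abs_le_const with (m := eps / (b - a + 1)); [exact Hab| |].
    - intros t Ht. cont; auto.
    - intros t Ht. left. assert (Pd := cond_pos d). apply Hd; try lra.
      rewrite Rminus_diag, Rabs_R0. apply cond_pos. }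
  assert (Pe := cond_pos eps).
  apply Rlt_le_trans with (eps / (b - a + 1) * (b - a + 1)).
  - apply Rmult_lt_compat_l; lra.
  - right. field. lra.
Qed.

Lemma continuous_swap {U : UniformSpace} (K : R -> R -> U) (x y : R) :
  continuous (fun p : R * R => K (fst p) (snd p)) (x, y) ->
  continuous (fun p : R * R => K (snd p) (fst p)) (y, x).
Proof.
  intros H. apply (continuous_comp_2 (fun p : R * R => snd p) (fun p : R * R => fst p) K).
  - apply continuous_snd.
  - apply continuous_fst.
  - exact H.
Qed.

Lemma continuous_RInt_param_snd (K : R -> R -> R) (a b x0 : R) :
  a <= b ->
  (forall y, a <= y <= b -> continuous (fun p : R * R => K (fst p) (snd p)) (x0, y)) ->
  locally x0 (fun x => forall y, a <= y <= b -> continuous (fun t => K x t) y) ->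
  continuous (fun x => RInt (fun y => K x y) a b) x0.
Proof.
  intros Hab HK Hloc. apply (continuous_RInt_param (fun y x => K x y)); [exact Hab| |exact Hloc].
  intros y Hy. apply continuous_swap, HK, Hy.
Qed.

Definition clamp (a b x : R) : R := Rmax a (Rmin b x).

Lemma clamp_in (a b x : R) : a <= b -> a <= clamp a b x <= b.
Proof.
  intros Hab. unfold clamp. split; [apply Rmax_l|].
  apply Rmax_lub; [exact Hab | apply Rmin_l].
Qed.

Lemma clamp_id (a b x : R) : a <= x <= b -> clamp a b x = x.
Proof. intros H. unfold clamp. rewrite Rmin_right, Rmax_right; lra. Qed.

Lemma continuous_clamp (a b x : R) : continuous (clamp a b) x.
Proof.
  assert (Lip : forall u v, Rabs (clamp a b u - clamp a b v) <= Rabs (u - v)).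
  { intros u v. unfold clamp, Rmax, Rmin, Rabs.
    repeat (destruct Rle_dec || destruct Rcase_abs); lra. }
  intros P [eps HP]. exists eps. intros y Hy. apply HP.
  change (Rabs (clamp a b y - clamp a b x) < eps).
  eapply Rle_lt_trans; [apply Lip | exact Hy].
Qed.

Lemma is_derive_RInt_upper (f : R -> R) (a X : R) :
  (forall x, continuous f x) -> is_derive (fun X => RInt f a X) X (f X).
Proof.
  intros Hf. apply (is_derive_RInt (V := R_NormedModule) f (fun X => RInt f a X) a X).
  - apply filter_forall. intros u. apply (RInt_correct (V := R_CompleteNormedModule)).
    apply (ex_RInt_continuous (V := R_CompleteNormedModule)). intros; apply Hf.
  - apply Hf.
Qed.

(** Both iterated integrals vanish at [b = a] and have the same derivative in [b]. *)
Lemma RInt_swap_everywhere (K : R -> R -> R) (a b c d : R) :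
  a <= b -> c <= d ->
  (forall p : R * R, continuous (fun p : R * R => K (fst p) (snd p)) p) ->
  RInt (fun x => RInt (fun y => K x y) c d) a b =
  RInt (fun y => RInt (fun x => K x y) a b) c d.
Proof.
  intros Hab Hcd HK.
  assert (HKx : forall x y, continuous (fun t => K t y) x).
  { intros x y. apply continuous_slice_1, HK. }
  assert (HKy : forall x y, continuous (fun t => K x t) y).
  { intros x y. apply continuous_slice_2, HK. }
  assert (HexX : forall u v y, ex_RInt (fun x => K x y) u v).
  { intros. apply (ex_RInt_continuous (V := R_CompleteNormedModule)). intros; apply HKx. }
  assert (HI1 : forall x, continuous (fun x => RInt (fun y => K x y) c d) x).
  { intros x. apply continuous_RInt_param_snd; [exact Hcd| |].
    - intros y _. apply HK.
    - apply filter_forall. intros; apply HKy. }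
  assert (HI2 : forall X y, a <= X -> continuous (fun y => RInt (fun x => K x y) a X) y).
  { intros X y HX. apply continuous_RInt_param; [exact HX| |].
    - intros; apply HK.
    - apply filter_forall. intros; apply HKx. }
  assert (Dx : forall X y, is_derive (fun X => RInt (fun x => K x y) a X) X (K X y)).
  { intros X y. apply (is_derive_RInt_upper (fun x => K x y)). intros; apply HKx. }
  assert (HI2' : forall X y, continuous (fun y => RInt (fun x => K x y) a X) y).
  { intros X y. destruct (Rle_dec a X) as [H|H]; [apply HI2; exact H|].
    apply (continuous_ext (fun y => - RInt (fun x => K x y) X a)).
    { intros u. apply (opp_RInt_swap (V := R_CompleteNormedModule)). apply HexX. }
    apply continuous_R_opp. apply continuous_RInt_param; [lra| |].
    - intros; apply HK.
    - apply filter_forall. intros; apply HKx. }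
  set (Phi := fun X => RInt (fun x => RInt (fun y => K x y) c d) a X
                       - RInt (fun y => RInt (fun x => K x y) a X) c d).
  assert (HD : forall X, is_derive Phi X 0).
  { intros X. unfold Phi.
    replace 0 with (RInt (fun y => K X y) c d
      - RInt (fun y => Derive (fun u => RInt (fun x => K x y) a u) X) c d).
    2: { rewrite (RInt_ext (fun y => Derive (fun u => RInt (fun x => K x y) a u) X) (K X)).
         - apply Rminus_diag.
         - intros y _. apply is_derive_unique, Dx. }
    apply (is_derive_minus (V := R_NormedModule)
       (fun X => RInt (fun x => RInt (fun y => K x y) c d) a X)).
    - apply (is_derive_RInt_upper (fun x => RInt (fun y => K x y) c d) a X), HI1.
    - apply (is_derive_RInt_param (fun X y => RInt (fun x => K x y) a X)).
      + apply filter_forall. intros u t _. eexists. apply Dx.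
      + intros t _. apply (continuity_2d_pt_ext K).
        { intros u v. symmetry. apply is_derive_unique, Dx. }
        apply continuous_2d. apply HK.
      + apply filter_forall. intros u.
        apply (ex_RInt_continuous (V := R_CompleteNormedModule)). intros; apply HI2'. }
  assert (E : Phi b = Phi a).
  { destruct (Req_dec a b) as [->|Hne]; [reflexivity|].
    destruct (MVT_gen Phi a b (fun _ => 0)) as [u [_ Hu]].
    - intros; apply HD.
    - intros t _. apply continuity_pt_filterlim.
      apply (@ex_derive_continuous R_AbsRing R_NormedModule). eexists; apply HD.
    - lra. }
  assert (Z : RInt (fun x => RInt (fun y => K x y) c d) a a = 0)
    by exact (RInt_point (V := R_CompleteNormedModule) a _).
  unfold Phi in E. rewrite Z in E.
  rewrite (RInt_ext (fun y => RInt (fun x => K x y) a a) (fun _ => 0)) in E.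
  2: { intros y _. exact (RInt_point (V := R_CompleteNormedModule) a (fun x => K x y)). }
  rewrite RInt_const_R in E. lra.
Qed.

(** Fubini's theorem for continuous integrands.  Clamping the variables makes
    the integrand continuous on the whole plane, where one may differentiate
    in the upper bound without meeting the boundary of the rectangle. *)
Lemma RInt_swap (K : R -> R -> R) (a b c d : R) :
  a <= b -> c <= d ->
  (forall x y, a <= x <= b -> c <= y <= d ->
     continuous (fun p : R * R => K (fst p) (snd p)) (x, y)) ->
  RInt (fun x => RInt (fun y => K x y) c d) a b =
  RInt (fun y => RInt (fun x => K x y) a b) c d.
Proof.
  intros Hab Hcd HK.
  set (k := fun x y => K (clamp a b x) (clamp c d y)).
  transitivity (RInt (fun x => RInt (fun y => k x y) c d) a b).
  { apply RInt_ext_le; auto. intros x Hx. apply RInt_ext_le; auto. intros y Hy.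
    unfold k. rewrite !clamp_id; auto. }
  rewrite RInt_swap_everywhere; auto.
  - apply RInt_ext_le; auto. intros y Hy. apply RInt_ext_le; auto. intros x Hx.
    unfold k. rewrite !clamp_id; auto.
  - intros [x y]. unfold k.
    apply (continuous_comp_2 (fun p : R * R => clamp a b (fst p))
             (fun p : R * R => clamp c d (snd p)) K).
    + apply (continuous_comp (fun p : R * R => fst p) (clamp a b)); [apply continuous_fst|].
      apply continuous_clamp.
    + apply (continuous_comp (fun p : R * R => snd p) (clamp c d)); [apply continuous_snd|].
      apply continuous_clamp.
    + apply HK; apply clamp_in; assumption.
Qed.


(** * Goursat's theorem on a parametrized rectangle *)

Lemma nested_intervals (x : nat -> R) (W : R) :
  0 <= W -> (forall n, x n <= x (S n) <= x n + W / 2 ^ S n) ->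
  exists p, forall n, x n <= p <= x n + W / 2 ^ n.
Proof.
  intros HW Hx.
  assert (Hm : forall n k, x n <= x (n + k)%nat <= x n + W / 2 ^ n - W / 2 ^ (n + k)).
  { intros n k. induction k as [|k IH].
    - rewrite Nat.add_0_r. lra.
    - rewrite Nat.add_succ_r. destruct (Hx (n + k)%nat) as [H1 H2].
      assert (E : W / 2 ^ (n + k) = 2 * (W / 2 ^ S (n + k))).
      { simpl. field. apply pow_nonzero. lra. }
      lra. }
  assert (Hpos : forall n, 0 <= W / 2 ^ n).
  { intros n. apply Rdiv_le_0_compat; [exact HW|]. apply pow_lt. lra. }
  assert (Hb : forall n m, x m <= x n + W / 2 ^ n).
  { intros n m. destruct (Nat.le_ge_cases n m) as [H|H].
    - replace m with (n + (m - n))%nat by lia.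
      generalize (Hm n (m - n)%nat) (Hpos (n + (m - n))%nat). lra.
    - replace n with (m + (n - m))%nat by lia.
      generalize (Hm m (n - m)%nat) (Hpos (m + (n - m))%nat). lra. }
  destruct (completeness (fun r => exists n, r = x n)) as [p [Hp1 Hp2]].
  - exists (x 0%nat + W / 2 ^ 0). intros r [n ->]. apply Hb.
  - exists (x 0%nat), 0%nat. reflexivity.
  - exists p. intros n. split.
    + apply Hp1. exists n. reflexivity.
    + apply Hp2. intros r [m ->]. apply Hb.
Qed.

(** The selection principle behind a bisection proof: a property that always passes
    to one of the four quarters holds on rectangles shrinking to a point. *)
Lemma nested_quarters (P : nat -> R -> R -> Prop) (x0 y0 W H : R) :
  0 <= W -> 0 <= H -> P 0%nat x0 y0 ->
  (forall n x y, P n x y ->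
     exists x' y', P (S n) x' y' /\
       (x' = x \/ x' = x + W / 2 ^ S n) /\ (y' = y \/ y' = y + H / 2 ^ S n)) ->
  exists p q, forall n, exists x y, P n x y /\
    x <= p <= x + W / 2 ^ n /\ y <= q <= y + H / 2 ^ n.
Proof.
  intros HW HH H0 Hstep.
  assert (Hch : forall (n : nat) (u : R * R), exists v : R * R, P n (fst u) (snd u) ->
    P (S n) (fst v) (snd v) /\ (fst v = fst u \/ fst v = fst u + W / 2 ^ S n) /\
    (snd v = snd u \/ snd v = snd u + H / 2 ^ S n)).
  { intros n u. destruct (classic (P n (fst u) (snd u))) as [Hu|Hu].
    - destruct (Hstep n _ _ Hu) as [x' [y' Hxy]]. exists (x', y'). intros _. exact Hxy.
    - exists u. intros Hu'. contradiction. }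
  set (next := fun n u => proj1_sig (constructive_indefinite_description _ (Hch n u))).
  set (s := fix s (n : nat) : R * R :=
    match n with O => (x0, y0) | S m => next m (s m) end).
  assert (Hs : forall n, P n (fst (s n)) (snd (s n))).
  { induction n as [|n IH]; [exact H0|].
    simpl. unfold next. apply (proj2_sig (constructive_indefinite_description _ (Hch n (s n)))).
    exact IH. }
  assert (Hn : forall n, (fst (s (S n)) = fst (s n) \/ fst (s (S n)) = fst (s n) + W / 2 ^ S n) /\
    (snd (s (S n)) = snd (s n) \/ snd (s (S n)) = snd (s n) + H / 2 ^ S n)).
  { intros n.
    apply (proj2_sig (constructive_indefinite_description _ (Hch n (s n)))). apply Hs. }
  assert (Hpos : forall n Z, 0 <= Z -> 0 <= Z / 2 ^ n).
  { intros n Z HZ. apply Rdiv_le_0_compat; [exact HZ|]. apply pow_lt. lra. }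
  destruct (nested_intervals (fun n => fst (s n)) W HW) as [p Hp].
  { intros n. destruct (Hn n) as [[->| ->] _]; generalize (Hpos (S n) W HW); lra. }
  destruct (nested_intervals (fun n => snd (s n)) H HH) as [q Hq].
  { intros n. destruct (Hn n) as [_ [->| ->]]; generalize (Hpos (S n) H HH); lra. }
  exists p, q. intros n. exists (fst (s n)), (snd (s n)). repeat split;
  first [apply Hs | apply Hp | apply Hq].
Qed.

Section Goursat.
Context (G Gx Gy : R -> R -> C) (a b c d L : R).
Context (Hab : a <= b) (Hcd : c <= d).

Let rect (x y : R) : Prop := a <= x <= b /\ c <= y <= d.

Context (HGx : forall x y, rect x y -> rder (fun t => G t y) x (Gx x y)).
Context (HGy : forall x y, rect x y -> rder (fun t => G x t) y (Gy x y)).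
Context (CGx : forall x y, rect x y -> continuous (fun t => Gx t y) x).
Context (CGy : forall x y, rect x y -> continuous (fun t => Gy x t) y).
Context (BGx : forall x y, rect x y -> Cmod (Gx x y) <= L).
Context (BGy : forall x y, rect x y -> Cmod (Gy x y) <= L).

Let hor (k : C -> C) (y x1 x2 : R) : C := CI (fun x => (k (G x y) * Gx x y)%C) x1 x2.
Let ver (k : C -> C) (x y1 y2 : R) : C := CI (fun y => (k (G x y) * Gy x y)%C) y1 y2.
Let bdry (k : C -> C) (x1 x2 y1 y2 : R) : C :=
  (hor k y1 x1 x2 + ver k x2 y1 y2 - hor k y2 x1 x2 - ver k x1 y1 y2)%C.
Let along (k : C -> C) : Prop := forall x y, rect x y -> continuous k (G x y).

Lemma continuous_hor (k : C -> C) (x y : R) :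
  along k -> rect x y -> continuous (fun t => (k (G t y) * Gx t y)%C) x.
Proof.
  intros Hk Hr. apply continuous_Cmult; [|apply CGx; exact Hr].
  apply (continuous_comp (fun t => G t y) k); [|apply Hk; exact Hr].
  exact (rder_continuous _ _ _ (HGx x y Hr)).
Qed.

Lemma continuous_ver (k : C -> C) (x y : R) :
  along k -> rect x y -> continuous (fun t => (k (G x t) * Gy x t)%C) y.
Proof.
  intros Hk Hr. apply continuous_Cmult; [|apply CGy; exact Hr].
  apply (continuous_comp (fun t => G x t) k); [|apply Hk; exact Hr].
  exact (rder_continuous _ _ _ (HGy x y Hr)).
Qed.

Lemma bdry_quarters (k : C -> C) (x1 xm x2 y1 ym y2 : R) :
  along k -> a <= x1 <= xm -> xm <= x2 <= b -> c <= y1 <= ym -> ym <= y2 <= d ->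
  bdry k x1 x2 y1 y2 =
  (bdry k x1 xm y1 ym + bdry k xm x2 y1 ym + bdry k x1 xm ym y2 + bdry k xm x2 ym y2)%C.
Proof.
  intros Hk H1 H2 H3 H4. unfold bdry, hor, ver.
  assert (EH : forall y, c <= y <= d ->
    CI (fun x => (k (G x y) * Gx x y)%C) x1 x2 =
    (CI (fun x => (k (G x y) * Gx x y)%C) x1 xm + CI (fun x => (k (G x y) * Gx x y)%C) xm x2)%C).
  { intros y Hy. apply CI_Chasles; try lra. intros t Ht. apply continuous_hor; auto.
    split; lra. }
  assert (EV : forall x, a <= x <= b ->
    CI (fun y => (k (G x y) * Gy x y)%C) y1 y2 =
    (CI (fun y => (k (G x y) * Gy x y)%C) y1 ym + CI (fun y => (k (G x y) * Gy x y)%C) ym y2)%C).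
  { intros x Hx. apply CI_Chasles; try lra. intros t Ht. apply continuous_ver; auto.
    split; lra. }
  rewrite (EH y1), (EH y2), (EV x1), (EV x2) by lra. ring.
Qed.

Lemma bdry_minus (k p : C -> C) (x1 x2 y1 y2 : R) :
  along k -> along p -> a <= x1 <= x2 -> x2 <= b -> c <= y1 <= y2 -> y2 <= d ->
  bdry (fun s => (k s - p s)%C) x1 x2 y1 y2 = (bdry k x1 x2 y1 y2 - bdry p x1 x2 y1 y2)%C.
Proof.
  intros Hk Hp H1 H2 H3 H4. unfold bdry, hor, ver.
  assert (EH : forall y, c <= y <= d ->
    CI (fun x => ((k (G x y) - p (G x y)) * Gx x y)%C) x1 x2 =
    (CI (fun x => (k (G x y) * Gx x y)%C) x1 x2 - CI (fun x => (p (G x y) * Gx x y)%C) x1 x2)%C).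
  { intros y Hy. rewrite <- CI_minus; [|lra| |].
    - apply CI_ext; [lra|]. intros; ring.
    - intros t Ht. apply continuous_hor; auto. split; lra.
    - intros t Ht. apply continuous_hor; auto. split; lra. }
  assert (EV : forall x, a <= x <= b ->
    CI (fun y => ((k (G x y) - p (G x y)) * Gy x y)%C) y1 y2 =
    (CI (fun y => (k (G x y) * Gy x y)%C) y1 y2 - CI (fun y => (p (G x y) * Gy x y)%C) y1 y2)%C).
  { intros x Hx. rewrite <- CI_minus; [|lra| |].
    - apply CI_ext; [lra|]. intros; ring.
    - intros t Ht. apply continuous_ver; auto. split; lra.
    - intros t Ht. apply continuous_ver; auto. split; lra. }
  rewrite (EH y1), (EH y2), (EV x1), (EV x2) by lra. ring.
Qed.

(** An affine integrand has a primitive, so its four edge integrals telescope. *)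
Lemma bdry_affine (A B s0 : C) (x1 x2 y1 y2 : R) :
  a <= x1 <= x2 -> x2 <= b -> c <= y1 <= y2 -> y2 <= d ->
  bdry (fun s => (A + B * (s - s0))%C) x1 x2 y1 y2 = 0.
Proof.
  intros H1 H2 H3 H4.
  set (P := fun s : C => (A * s + B / 2 * ((s - s0) * (s - s0)))%C).
  assert (HP : forall s, cder P s (A + B * (s - s0))).
  { intros s. unfold P.
    assert (Hs : cder (fun s => (s - s0)%C) s 1).
    { replace (RtoC 1) with (1 + 0)%C by ring.
      apply (cder_plus (fun s => s) (fun _ => (- s0)%C)); [apply cder_id | apply cder_const]. }
    replace (A + B * (s - s0))%C with
      ((0 * s + A * 1) +
       (0 * ((s - s0) * (s - s0)) + B / 2 * (1 * (s - s0) + (s - s0) * 1)))%C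
      by (field; intros E; injection E; lra).
    apply (cder_plus (fun s => (A * s)%C) (fun s => (B / 2 * ((s - s0) * (s - s0)))%C)).
    - apply (cder_mult (fun _ => A) (fun s => s) s 0 1); [apply cder_const | apply cder_id].
    - apply (cder_mult (fun _ => (B / 2)%C) (fun s => ((s - s0) * (s - s0))%C)); [apply cder_const|].
      apply (cder_mult (fun s => (s - s0)%C) (fun s => (s - s0)%C)); exact Hs. }
  assert (Hal : along (fun s => (A + B * (s - s0))%C)).
  { intros x y _. apply continuous_Cplus; [apply continuous_const|].
    apply continuous_Cmult; [apply continuous_const|].
    apply continuous_Cminus; [apply continuous_id | apply continuous_const]. }
  assert (EH : forall y, c <= y <= d ->
    CI (fun x => ((A + B * (G x y - s0)) * Gx x y)%C) x1 x2 = (P (G x2 y) - P (G x1 y))%C).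
  { intros y Hy. apply (CI_FTC x1 x2 ltac:(lra) (fun x => P (G x y))).
    - intros t Ht. apply rder_comp; [apply HP | apply HGx; split; lra].
    - intros t Ht. apply (continuous_hor (fun s => (A + B * (s - s0))%C)); auto. split; lra. }
  assert (EV : forall x, a <= x <= b ->
    CI (fun y => ((A + B * (G x y - s0)) * Gy x y)%C) y1 y2 = (P (G x y2) - P (G x y1))%C).
  { intros x Hx. apply (CI_FTC y1 y2 ltac:(lra) (fun y => P (G x y))).
    - intros t Ht. apply rder_comp; [apply HP | apply HGy; split; lra].
    - intros t Ht. apply (continuous_ver (fun s => (A + B * (s - s0))%C)); auto. split; lra. }
  unfold bdry, hor, ver.
  rewrite (EH y1), (EH y2), (EV x1), (EV x2) by lra. ring.
Qed.

Lemma bdry_norm (k : C -> C) (m x1 x2 y1 y2 : R) :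
  along k -> a <= x1 <= x2 -> x2 <= b -> c <= y1 <= y2 -> y2 <= d -> 0 <= m ->
  (forall x y, x1 <= x <= x2 -> y1 <= y <= y2 -> Cmod (k (G x y)) <= m) ->
  Cmod (bdry k x1 x2 y1 y2) <= 2 * m * L * ((x2 - x1) + (y2 - y1)).
Proof.
  intros Hk H1 H2 H3 H4 Hm0 Hm.
  assert (EH : forall y, y1 <= y <= y2 -> Cmod (hor k y x1 x2) <= m * L * (x2 - x1)).
  { intros y Hy. apply CI_norm_const; [lra| |].
    - intros t Ht. apply continuous_hor; auto. split; lra.
    - intros t Ht. rewrite Cmod_mult. apply Rmult_le_compat; try apply Cmod_ge_0.
      + apply Hm; lra.
      + apply BGx. split; lra. }
  assert (EV : forall x, x1 <= x <= x2 -> Cmod (ver k x y1 y2) <= m * L * (y2 - y1)).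
  { intros x Hx. apply CI_norm_const; [lra| |].
    - intros t Ht. apply continuous_ver; auto. split; lra.
    - intros t Ht. rewrite Cmod_mult. apply Rmult_le_compat; try apply Cmod_ge_0.
      + apply Hm; lra.
      + apply BGy. split; lra. }
  unfold bdry.
  eapply Rle_trans; [apply Cmod_triangle_sub|].
  eapply Rle_trans; [apply Rplus_le_compat_r, Cmod_triangle_sub|].
  eapply Rle_trans; [apply Rplus_le_compat_r, Rplus_le_compat_r, Cmod_triangle|].
  assert (A1 := EH y1 ltac:(lra)). assert (A2 := EH y2 ltac:(lra)).
  assert (A3 := EV x1 ltac:(lra)). assert (A4 := EV x2 ltac:(lra)). lra.
Qed.

Lemma parametrization_lipschitz (x y x' y' : R) :
  rect x y -> rect x' y' -> Cmod (G x y - G x' y') <= L * (Rabs (x - x') + Rabs (y - y')).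
Proof.
  assert (HX : forall u v y, u <= v -> rect u y -> rect v y ->
    Cmod (G v y - G u y) <= L * (v - u)).
  { intros u v z Huv [Hu Hz] [Hv _].
    replace (G v z - G u z)%C with (G v z - G u z - 0 * RtoC (v - u))%C by ring.
    apply (path_mean_value (fun t => G t z) (fun t => Gx t z) u v L 0 Huv).
    - intros t Ht. apply HGx. split; lra.
    - intros t Ht. replace (Gx t z - 0)%C with (Gx t z) by ring. apply BGx. split; lra. }
  assert (HY : forall u v x, u <= v -> rect x u -> rect x v ->
    Cmod (G x v - G x u) <= L * (v - u)).
  { intros u v z Huv [Hz Hu] [_ Hv].
    replace (G z v - G z u)%C with (G z v - G z u - 0 * RtoC (v - u))%C by ring.
    apply (path_mean_value (fun t => G z t) (fun t => Gy z t) u v L 0 Huv).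
    - intros t Ht. apply HGy. split; lra.
    - intros t Ht. replace (Gy z t - 0)%C with (Gy z t) by ring. apply BGy. split; lra. }
  intros [Hx Hy] [Hx' Hy'].
  replace (G x y - G x' y')%C with ((G x y - G x' y) + (G x' y - G x' y'))%C by ring.
  eapply Rle_trans; [apply Cmod_triangle|]. rewrite Rmult_plus_distr_l.
  apply Rplus_le_compat.
  - destruct (Rle_dec x x') as [H|H].
    + rewrite Cmod_sub_comm, Rabs_left1 by lra.
      replace (- (x - x')) with (x' - x) by ring. apply HX; auto; split; lra.
    + rewrite Rabs_right by lra. apply HX; try split; lra.
  - destruct (Rle_dec y y') as [H|H].
    + rewrite Cmod_sub_comm, Rabs_left1 by lra.
      replace (- (y - y')) with (y' - y) by ring. apply HY; auto; split; lra.
    + rewrite Rabs_right by lra. apply HY; try split; lra.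
Qed.

(** Subtracting the first-order Taylor polynomial leaves an integrand that is
    small compared with the diameter of the rectangle. *)
Lemma bdry_local (h : C -> C) (p q eps : R) :
  (forall x y, rect x y -> cdiff h (G x y)) -> rect p q -> 0 < eps ->
  exists del, 0 < del /\ forall x1 x2 y1 y2,
    a <= x1 <= p -> p <= x2 <= b -> c <= y1 <= q -> q <= y2 <= d ->
    (x2 - x1) + (y2 - y1) < del ->
    Cmod (bdry h x1 x2 y1 y2) <= 2 * eps * L * L * ((x2 - x1) + (y2 - y1)) ^ 2.
Proof.
  intros Hh Hpq He.
  assert (HL : 0 <= L) by (eapply Rle_trans; [apply Cmod_ge_0 | apply (BGx p q Hpq)]).
  destruct (Hh p q Hpq) as [l Hl]. destruct (Hl eps He) as [del [Hdel0 Hdel]].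
  exists (del / (L + 1)). split; [apply Rdiv_lt_0_compat; lra|].
  intros x1 x2 y1 y2 H1 H2 H3 H4 Hd. destruct Hpq as [Hp Hq].
  set (s0 := G p q) in *. set (D := (x2 - x1) + (y2 - y1)) in *.
  assert (HD : L * D < del).
  { apply Rmult_lt_compat_l with (r := L + 1) in Hd; [|lra].
    replace ((L + 1) * (del / (L + 1))) with del in Hd by (field; lra).
    assert (0 <= D) by (unfold D; lra). nra. }
  assert (Hal : along h) by (intros x y Hr; apply cdiff_continuous; auto).
  assert (Hala : along (fun s => (h s0 + l * (s - s0))%C)).
  { intros x y _. apply continuous_Cplus; [apply continuous_const|].
    apply continuous_Cmult; [apply continuous_const|].
    apply continuous_Cminus; [apply continuous_id | apply continuous_const]. }
  assert (E : bdry h x1 x2 y1 y2 =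
    bdry (fun s => (h s - (h s0 + l * (s - s0)))%C) x1 x2 y1 y2).
  { rewrite bdry_minus, bdry_affine; auto; try lra. ring. }
  rewrite E.
  replace (2 * eps * L * L * D ^ 2) with (2 * (eps * (L * D)) * L * D) by ring.
  apply bdry_norm; try lra.
  - intros x y Hr. apply continuous_Cminus; [apply Hal | apply Hala]; exact Hr.
  - apply Rmult_le_pos; [lra|]. apply Rmult_le_pos; [exact HL|]. unfold D. lra.
  - intros x y Hx Hy.
    assert (HG : Cmod (G x y - s0) <= L * D).
    { eapply Rle_trans; [apply parametrization_lipschitz; split; lra|].
      apply Rmult_le_compat_l; [exact HL|]. unfold D.
      apply Rplus_le_compat; apply Rabs_le; lra. }
    replace (h (G x y) - (h s0 + l * (G x y - s0)))%C
      with (h (G x y) - h s0 - l * (G x y - s0))%C by ring.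
    eapply Rle_trans; [apply Hdel; lra|]. apply Rmult_le_compat_l; lra.
Qed.

(** If the boundary integral were [M > 0] in modulus, some quarter of a quarter and so
    on would keep modulus [M / 4^n], while [bdry_local] at the limit point makes it
    [o(4^-n)]. *)
Lemma goursat_section (h : C -> C) :
  (forall x y, rect x y -> cdiff h (G x y)) -> bdry h a b c d = 0.
Proof.
  intros Hh.
  assert (HL : 0 <= L) by (eapply Rle_trans; [apply Cmod_ge_0 | apply (BGx a c); split; lra]).
  assert (Hal : along h) by (intros x y Hr; apply cdiff_continuous; auto).
  destruct (Req_dec (Cmod (bdry h a b c d)) 0) as [E|E]; [apply Cmod_eq_0; exact E|].
  exfalso. set (M := Cmod (bdry h a b c d)) in *.
  assert (HM : 0 < M) by (generalize (Cmod_ge_0 (bdry h a b c d)); fold M; lra).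
  set (W := b - a). set (H := d - c).
  assert (HW : 0 <= W) by (unfold W; lra). assert (HH : 0 <= H) by (unfold H; lra).
  set (P := fun n x y => a <= x /\ x + W / 2 ^ n <= b /\ c <= y /\ y + H / 2 ^ n <= d /\
    M / 4 ^ n <= Cmod (bdry h x (x + W / 2 ^ n) y (y + H / 2 ^ n))).
  destruct (nested_quarters P a c W H HW HH) as [p [q Hpq]].
  - unfold P. simpl. replace (a + W / 1) with b by (unfold W; field).
    replace (c + H / 1) with d by (unfold H; field). fold M. repeat split; lra.
  - intros n x y (Hx1 & Hx2 & Hy1 & Hy2 & HB).
    set (w := W / 2 ^ S n). set (k := H / 2 ^ S n).
    assert (Ew : W / 2 ^ n = w + w) by (unfold w; simpl; field; apply pow_nonzero; lra).
    assert (Ek : H / 2 ^ n = k + k) by (unfold k; simpl; field; apply pow_nonzero; lra).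
    assert (EM : M / 4 ^ n = 4 * (M / 4 ^ S n)) by (simpl; field; apply pow_nonzero; lra).
    assert (Hw : 0 <= w) by (apply Rdiv_le_0_compat; [lra | apply pow_lt; lra]).
    assert (Hk : 0 <= k) by (apply Rdiv_le_0_compat; [lra | apply pow_lt; lra]).
    rewrite Ew in Hx2, HB. rewrite Ek in Hy2, HB. rewrite EM in HB.
    rewrite (bdry_quarters h x (x + w) (x + (w + w)) y (y + k) (y + (k + k))) in HB; auto; try lra.
    rewrite <- !Rplus_assoc in HB.
    unfold P. fold w k.
    set (m := M / 4 ^ S n) in *.
    set (B1 := bdry h x (x + w) y (y + k)) in *.
    set (B2 := bdry h (x + w) (x + w + w) y (y + k)) in *.
    set (B3 := bdry h x (x + w) (y + k) (y + k + k)) in *.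
    set (B4 := bdry h (x + w) (x + w + w) (y + k) (y + k + k)) in *.
    assert (T1 := Cmod_triangle (B1 + B2 + B3) B4).
    assert (T2 := Cmod_triangle (B1 + B2) B3).
    assert (T3 := Cmod_triangle B1 B2).
    destruct (Rle_dec m (Cmod B1)) as [Q1|Q1];
      [exists x, y; repeat split; try lra; auto|].
    destruct (Rle_dec m (Cmod B2)) as [Q2|Q2];
      [exists (x + w), y; repeat split; try lra; auto|].
    destruct (Rle_dec m (Cmod B3)) as [Q3|Q3];
      [exists x, (y + k); repeat split; try lra; auto|].
    exists (x + w), (y + k); repeat split; try lra; auto.
    change (m <= Cmod B4). lra.
  - assert (Hr : rect p q).
    { destruct (Hpq 0%nat) as [x [y [(Hx1 & Hx2 & Hy1 & Hy2 & _) [Hx Hy]]]]. split; lra. }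
    set (S2 := (W + H) ^ 2). assert (HS2 : 0 <= S2) by apply pow2_ge_0.
    (* small enough for [bdry_local] to give less than [M / 4^n] on a quarter of order [n] *)
    set (eps := M / (4 * (L * L * S2 + 1))).
    assert (HK : 0 <= L * L * S2) by (apply Rmult_le_pos; [apply Rmult_le_pos|]; assumption).
    assert (He : 0 < eps) by (apply Rdiv_lt_0_compat; lra).
    destruct (bdry_local h p q eps Hh Hr He) as [del [Hdel0 Hdel]].
    assert (Hn : exists n, (W + H) / 2 ^ n < del).
    { destruct (pow_lt_1_zero (/ 2)) with (y := del / (W + H + 1)) as [n Hn].
      - rewrite Rabs_right; lra.
      - apply Rdiv_lt_0_compat; lra.
      - exists n. specialize (Hn n (le_n n)). rewrite pow_inv in Hn.
        rewrite Rabs_right in Hn.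
        + assert (0 < / 2 ^ n) by (apply Rinv_0_lt_compat, pow_lt; lra).
          apply Rmult_lt_compat_l with (r := W + H + 1) in Hn; [|lra].
          replace ((W + H + 1) * (del / (W + H + 1))) with del in Hn by (field; lra).
          unfold Rdiv. nra.
        + left. apply Rinv_0_lt_compat, pow_lt; lra. }
    destruct Hn as [n Hn].
    destruct (Hpq n) as [x [y [(Hx1 & Hx2 & Hy1 & Hy2 & HB) [Hx Hy]]]].
    specialize (Hdel x (x + W / 2 ^ n) y (y + H / 2 ^ n)).
    assert (ED : (x + W / 2 ^ n - x) + (y + H / 2 ^ n - y) = (W + H) / 2 ^ n)
      by (field; apply pow_nonzero; lra).
    rewrite ED in Hdel.
    assert (Hfin := Rle_trans _ _ _ HB (Hdel ltac:(lra) ltac:(lra) ltac:(lra) ltac:(lra) Hn)).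
    replace (((W + H) / 2 ^ n) ^ 2) with (S2 / 4 ^ n) in Hfin.
    2: { unfold S2. replace 4 with (2 * 2) by ring. rewrite Rpow_mult_distr.
         field. apply pow_nonzero; lra. }
    assert (H4 : 0 < 4 ^ n) by (apply pow_lt; lra).
    apply Rmult_le_compat_r with (r := 4 ^ n) in Hfin; [|lra].
    replace (M / 4 ^ n * 4 ^ n) with M in Hfin by (field; lra).
    replace (2 * eps * L * L * (S2 / 4 ^ n) * 4 ^ n) with (2 * eps * (L * L * S2)) in Hfin
      by (field; lra).
    assert (E2 : 4 * eps * (L * L * S2) + 4 * eps = M) by (unfold eps; field; lra).
    lra.
Qed.

End Goursat.

(** Goursat's theorem for the image of a rectangle.  The parametrization need not be
    injective: in the homotopies used below an edge degenerates to a point or two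
    edges coincide. *)
Theorem goursat (h : C -> C) (G Gx Gy : R -> R -> C) (a b c d L : R) :
  a <= b -> c <= d ->
  (forall x y, a <= x <= b -> c <= y <= d ->
     cdiff h (G x y) /\ rder (fun t => G t y) x (Gx x y) /\ rder (fun t => G x t) y (Gy x y)) ->
  (forall x y, a <= x <= b -> c <= y <= d ->
     continuous (fun t => Gx t y) x /\ continuous (fun t => Gy x t) y) ->
  (forall x y, a <= x <= b -> c <= y <= d -> Cmod (Gx x y) <= L /\ Cmod (Gy x y) <= L) ->
  (CI (fun x => h (G x c) * Gx x c) a b + CI (fun y => h (G b y) * Gy b y) c d
   - CI (fun x => h (G x d) * Gx x d) a b - CI (fun y => h (G a y) * Gy a y) c d)%C = 0.
Proof.
  intros Hab Hcd H1 H2 H3.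
  apply (goursat_section G Gx Gy a b c d L Hab Hcd);
  intros x y [Hx Hy]; first [apply H1 | apply H2 | apply H3]; assumption.
Qed.


(** * The Poisson formula on the unit circle *)

Lemma circle_polar (r th : R) : circle r th = (RtoC r * circle 1 th)%C.
Proof. unfold circle, Cmult, RtoC. simpl. f_equal; ring. Qed.

Lemma Cmod_circle (r th : R) : 0 <= r -> Cmod (circle r th) = r.
Proof.
  intros Hr. unfold circle, Cmod. simpl.
  replace (r * cos th * (r * cos th * 1) + r * sin th * (r * sin th * 1))
    with (r * r * (Rsqr (sin th) + Rsqr (cos th))) by (unfold Rsqr; ring).
  rewrite sin2_cos2, Rmult_1_r. apply sqrt_square. exact Hr.
Qed.

Lemma circle_2PI (r : R) : circle r (2 * PI) = circle r 0.
Proof. unfold circle. rewrite cos_2PI, sin_2PI, cos_0, sin_0. reflexivity. Qed.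

Lemma continuous_on_circle {U : UniformSpace} (F : C -> U) (r th : R) :
  continuous F (circle r th) -> continuous (fun t => F (circle r t)) th.
Proof.
  intros H. apply (continuous_comp (circle r) F); [apply continuous_circle_angle | exact H].
Qed.

Lemma circle_sub_neq_0 (w : C) (th : R) : Cmod w < 1 -> (circle 1 th - w)%C <> 0.
Proof.
  intros Hw E. apply Ceq_minus in E. rewrite <- E, Cmod_circle in Hw; lra.
Qed.

Lemma Cconj_mult_self (z : C) : (Cconj z * z)%C = RtoC (Cmod z * Cmod z).
Proof. rewrite Cmod_sqr. unfold Cconj, Cmult, RtoC. simpl. f_equal; ring. Qed.

Lemma Cmod_conj (z : C) : Cmod (Cconj z) = Cmod z.
Proof. unfold Cmod, Cconj. simpl. f_equal. ring. Qed.

Lemma Cconj_minus (x y : C) : Cconj (x - y) = (Cconj x - Cconj y)%C.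
Proof. unfold Cconj, Cminus, Cplus, Copp. simpl. f_equal. ring. Qed.

Lemma Cconj_mult (x y : C) : Cconj (x * y) = (Cconj x * Cconj y)%C.
Proof. unfold Cconj, Cmult. simpl. f_equal; ring. Qed.

Lemma Cconj_inv (x : C) : x <> 0 -> Cconj (/ x) = (/ Cconj x)%C.
Proof.
  intros Hx. assert (H := C_norm_sqr_neq_0 x Hx).
  unfold Cconj, Cinv. simpl. simpl in H. f_equal; field;
  repeat split; intros E; apply H; rewrite <- E; ring.
Qed.

Lemma Cconj_RtoC (x : R) : Cconj (RtoC x) = RtoC x.
Proof. unfold Cconj, RtoC. simpl. f_equal. ring. Qed.

Section CauchyFormula.
Context (F : C -> C) (w : C).
Context (HF : forall s, Cmod s <= 1 -> cdiff F s) (Hw : Cmod w < 1).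

(* the image of the unit circle under the homothety of centre [w] and ratio [l] *)
Let shrink (l th : R) : C := (w + RtoC l * (circle 1 th - w))%C.
Let J (l : R) : C := CI (fun th => F (shrink l th) * (circle 1 th / (circle 1 th - w)))%C 0 (2 * PI).

Lemma shrink_in_disk (l th : R) : 0 <= l <= 1 -> Cmod (shrink l th) <= 1.
Proof.
  intros Hl. unfold shrink.
  replace (w + RtoC l * (circle 1 th - w))%C
    with (RtoC (1 - l) * w + RtoC l * circle 1 th)%C by (rewrite RtoC_minus; ring).
  eapply Rle_trans; [apply Cmod_triangle|].
  rewrite !Cmod_mult, !Cmod_R, Cmod_circle, !Rabs_pos_eq by lra. nra.
Qed.

Lemma rder_shrink_angle (l th : R) : rder (shrink l) th (RtoC l * (Ci * circle 1 th)).
Proof. unfold rder, shrink, circle; simpl. split; auto_derive; auto; ring. Qed.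

Lemma rder_shrink_ratio (l th : R) : rder (fun l => shrink l th) l (circle 1 th - w).
Proof. unfold rder, shrink, circle; simpl. split; auto_derive; auto; ring. Qed.

Lemma continuous_cauchy_integrand (l th : R) : 0 <= l <= 1 ->
  continuous (fun th => F (shrink l th) * (circle 1 th / (circle 1 th - w)))%C th.
Proof.
  intros Hl. assert (Hc := continuous_circle_angle 1 th).
  apply continuous_Cmult.
  - apply (continuous_comp (shrink l) F).
    + exact (rder_continuous _ _ _ (rder_shrink_angle l th)).
    + apply cdiff_continuous, HF, shrink_in_disk, Hl.
  - cont. apply circle_sub_neq_0, Hw.
Qed.

(** The contours [shrink l] are closed, so the two radial edges of the
    parametrized rectangle cancel. *)
Lemma cauchy_shrink (l : R) : 0 < l <= 1 -> J 1 = J l.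
Proof.
  intros Hl. assert (HP := PI_RGT_0).
  assert (H := goursat (fun s => (F s / (s - w))%C) shrink
    (fun l th => (circle 1 th - w)%C) (fun l th => (RtoC l * (Ci * circle 1 th))%C)
    l 1 0 (2 * PI) 2).
  assert (E : forall x, 0 < x <= 1 ->
    CI (fun y => (F (shrink x y) / (shrink x y - w) * (RtoC x * (Ci * circle 1 y)))%C) 0 (2 * PI)
    = (Ci * J x)%C).
  { intros x Hx. unfold J. rewrite <- CI_scal; [|lra|].
    - apply CI_ext; [lra|]. intros th _. unfold shrink. field. split.
      + apply circle_sub_neq_0, Hw.
      + replace (w + x * (circle 1 th - w) - w)%C with (RtoC x * (circle 1 th - w))%C by ring.
        apply Cmult_neq_0; [|apply circle_sub_neq_0, Hw].
        intros E. apply RtoC_inj in E. lra.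
    - intros th _. apply continuous_cauchy_integrand. lra. }
  cbv beta in H. rewrite (E 1), (E l) in H by lra.
  assert (EH : CI (fun x => (F (shrink x (2 * PI)) / (shrink x (2 * PI) - w) *
      (circle 1 (2 * PI) - w))%C) l 1 =
    CI (fun x => (F (shrink x 0) / (shrink x 0 - w) * (circle 1 0 - w))%C) l 1).
  { apply CI_ext; [lra|]. intros x _. unfold shrink. rewrite circle_2PI. reflexivity. }
  rewrite EH in H.
  assert (H' : (Ci * J 1 = Ci * J l)%C).
  { apply Ceq_minus. rewrite <- H; try lra.
    - ring.
    - intros x y Hx Hy. split; [|split].
      + apply cdiff_div.
        * apply HF, shrink_in_disk. lra.
        * apply cdiff_minus; [apply cdiff_id | apply cdiff_const].
        * unfold shrink.
          replace (w + x * (circle 1 y - w) - w)%C with (RtoC x * (circle 1 y - w))%C by ring.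
          apply Cmult_neq_0; [|apply circle_sub_neq_0, Hw].
          intros E'. apply RtoC_inj in E'. lra.
      + apply rder_shrink_ratio.
      + apply rder_shrink_angle.
    - intros x y Hx Hy. split; cbv beta; cont.
    - intros x y Hx Hy. split.
      + eapply Rle_trans; [apply Cmod_triangle_sub|]. rewrite Cmod_circle; lra.
      + rewrite !Cmod_mult, Cmod_R, Cmod_Ci, Cmod_circle, Rabs_pos_eq by lra. lra. }
  transitivity (/ Ci * (Ci * J 1))%C; [|rewrite H'];
  rewrite Cmult_assoc, Cinv_l, Cmult_1_l by exact Ci_nz; reflexivity.
Qed.

(** On the shrinking contours [F] tends uniformly to [F w], while the kernel does not
    change; its integral is computed in [cauchy_kernel_integral]. *)
Lemma cauchy_up_to_kernel :
  CI (fun th => F (circle 1 th) * (circle 1 th / (circle 1 th - w)))%C 0 (2 * PI) =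
  (F w * CI (fun th => circle 1 th / (circle 1 th - w))%C 0 (2 * PI))%C.
Proof.
  assert (HP := PI_RGT_0).
  assert (Ck : forall th, continuous (fun th => (circle 1 th / (circle 1 th - w))%C) th).
  { intros th. cont. apply circle_sub_neq_0, Hw. }
  transitivity (J 1).
  { apply CI_ext; [lra|]. intros th _. unfold shrink. do 2 f_equal. ring. }
  apply Cmod_eq_0_sub. rewrite <- CI_scal by (auto; lra).
  apply Rle_antisym; [|apply Cmod_ge_0].
  apply le_epsilon. intros e He. rewrite Rplus_0_l.
  set (e' := e * (1 - Cmod w) / (2 * PI)).
  assert (He' : 0 < e') by (apply Rdiv_lt_0_compat; nra).
  assert (Hc : continuous F w) by (apply cdiff_continuous, HF; lra).
  destruct (proj1 (continuous_C_ball F w) Hc e' He') as [d [Hd0 Hd]].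
  (* [shrink l] moves within [2 * l] of [w], inside the ball of radius [d] *)
  set (l := Rmin 1 (d / 3)).
  assert (Hl : 0 < l <= 1 /\ 3 * l <= d).
  { unfold l. split; [split; [apply Rmin_glb_lt; lra | apply Rmin_l]|].
    generalize (Rmin_r 1 (d / 3)). lra. }
  rewrite (cauchy_shrink l) by lra. unfold J.
  rewrite <- CI_minus; [|lra| |].
  - replace e with (e' / (1 - Cmod w) * (2 * PI - 0)) by (unfold e'; field; lra).
    apply CI_norm_const; [lra| |].
    + intros th _. apply continuous_Cminus.
      * apply continuous_cauchy_integrand. lra.
      * apply continuous_Cmult; [apply continuous_const | apply Ck].
    + intros th _.
      replace (F (shrink l th) * (circle 1 th / (circle 1 th - w)) -
        F w * (circle 1 th / (circle 1 th - w)))%C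
        with ((F (shrink l th) - F w) * (circle 1 th / (circle 1 th - w)))%C by ring.
      rewrite Cmod_mult, Cmod_div, Cmod_circle by (lra || apply circle_sub_neq_0, Hw).
      apply Rmult_le_compat.
      * apply Cmod_ge_0.
      * apply Rdiv_le_0_compat; [lra|]. apply Cmod_gt_0, circle_sub_neq_0, Hw.
      * left. apply Hd. unfold shrink.
        replace (w + l * (circle 1 th - w) - w)%C with (RtoC l * (circle 1 th - w))%C by ring.
        rewrite Cmod_mult, Cmod_R, Rabs_pos_eq by lra.
        assert (T := Cmod_triangle_sub (circle 1 th) w). rewrite Cmod_circle in T by lra.
        nra.
      * unfold Rdiv. rewrite Rmult_1_l. apply Rinv_le_contravar; [lra|].
        assert (T := Cmod_triangle_rev (circle 1 th) w). rewrite Cmod_circle in T by lra.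
        exact T.
  - intros th _. apply continuous_cauchy_integrand. lra.
  - intros th _. apply continuous_Cmult; [apply continuous_const | apply Ck].
Qed.

End CauchyFormula.

Lemma mean_value_property (F : C -> C) :
  (forall s, Cmod s <= 1 -> cdiff F s) ->
  CI (fun th => F (circle 1 th)) 0 (2 * PI) = (RtoC (2 * PI) * F 0)%C.
Proof.
  intros HF. assert (HP := PI_RGT_0).
  assert (H0 : Cmod 0 < 1) by (rewrite Cmod_0; lra).
  assert (E : forall th, (circle 1 th / (circle 1 th - 0))%C = 1).
  { intros th. assert (N := circle_sub_neq_0 0 th H0). field. intros E. apply N.
    rewrite E. ring. }
  assert (H := cauchy_up_to_kernel F 0 HF H0).
  rewrite (CI_ext 0 (2 * PI) ltac:(lra) (fun th => circle 1 th / (circle 1 th - 0))%C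
    (fun _ => RtoC 1)), CI_const in H by (intros; apply E).
  rewrite (CI_ext 0 (2 * PI) ltac:(lra) _ (fun th => F (circle 1 th))) in H.
  - rewrite H, Rminus_0_r. ring.
  - intros th _. rewrite E. ring.
Qed.

(** The constant in Cauchy's formula is the conjugate of the mean value of
    the holomorphic function [1 / (1 - Cconj w * z)]. *)
Lemma cauchy_kernel_integral (w : C) : Cmod w < 1 ->
  CI (fun th => circle 1 th / (circle 1 th - w))%C 0 (2 * PI) = RtoC (2 * PI).
Proof.
  intros Hw. assert (HP := PI_RGT_0).
  assert (Hne : forall s, Cmod s <= 1 -> (1 - Cconj w * s)%C <> 0).
  { intros s Hs E. apply Ceq_minus in E.
    assert (M : Cmod (Cconj w * s) = 1) by (rewrite <- E; apply Cmod_1).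
    rewrite Cmod_mult, Cmod_conj in M.
    generalize (Cmod_ge_0 w) (Cmod_ge_0 s). nra. }
  assert (H := mean_value_property (fun s => (/ (1 - Cconj w * s))%C)).
  cbv beta in H.
  replace (RtoC (2 * PI)) with (Cconj (RtoC (2 * PI) * / (1 - Cconj w * 0))).
  2: { rewrite Cmult_0_r. replace (1 - 0)%C with (RtoC 1) by ring.
       rewrite Cconj_mult, Cconj_inv, !Cconj_RtoC by exact C1_nz. field. }
  rewrite <- H, <- CI_conj.
  - apply CI_ext; [lra|]. intros th _.
    assert (Hc : Cmod (circle 1 th) = 1) by (apply Cmod_circle; lra).
    assert (N := Hne (circle 1 th) ltac:(lra)).
    assert (N2 := circle_sub_neq_0 w th Hw).
    rewrite Cconj_inv by exact N.
    rewrite Cconj_minus, Cconj_mult, Cconj_RtoC.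
    replace (Cconj (Cconj w)) with w by (destruct w; unfold Cconj; simpl; f_equal; ring).
    assert (U := Cconj_mult_self (circle 1 th)). rewrite Hc, Rmult_1_r in U.
    assert (N3 : circle 1 th <> 0) by (intros E; rewrite E, Cmod_0 in Hc; lra).
    replace (Cconj (circle 1 th)) with (/ circle 1 th)%C.
    + field. repeat split; auto.
    + rewrite <- (Cmult_1_l (/ circle 1 th)), <- U. field. exact N3.
  - lra.
  - intros th _. apply continuous_Cinv; [|apply Hne; rewrite Cmod_circle; lra].
    cont.
  - intros s Hs. apply cdiff_inv; [|apply Hne, Hs].
    apply cdiff_minus; [apply cdiff_const|].
    apply cdiff_mult; [apply cdiff_const | apply cdiff_id].
Qed.

(** The hypothesis includes the boundary of the disk; functions on the open disk are
    dilated before the formula is applied to them. *)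
Theorem cauchy_formula (F : C -> C) (w : C) :
  (forall s, Cmod s <= 1 -> cdiff F s) -> Cmod w < 1 ->
  CI (fun th => F (circle 1 th) * (circle 1 th / (circle 1 th - w)))%C 0 (2 * PI) =
  (RtoC (2 * PI) * F w)%C.
Proof.
  intros HF Hw. rewrite cauchy_up_to_kernel, cauchy_kernel_integral by assumption. ring.
Qed.

Definition average (k : R -> R) : R := / (2 * PI) * RInt k 0 (2 * PI).

Definition poisson (w s : C) : R := (1 - Cmod w * Cmod w) / (Cmod (s - w) * Cmod (s - w)).

Lemma average_le (k1 k2 : R -> R) :
  (forall t, continuous k1 t) -> (forall t, continuous k2 t) ->
  (forall t, k1 t <= k2 t) -> average k1 <= average k2.
Proof.
  intros H1 H2 H. assert (HP := PI_RGT_0). apply Rmult_le_compat_l.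
  - left. apply Rinv_0_lt_compat. lra.
  - apply RInt_le_cont; auto. lra.
Qed.

Lemma average_const (m : R) : average (fun _ => m) = m.
Proof. assert (HP := PI_RGT_0). unfold average. rewrite RInt_const_R. field. lra. Qed.

Lemma average_scal (m : R) (k : R -> R) :
  (forall t, continuous k t) -> average (fun t => m * k t) = m * average k.
Proof.
  intros H. assert (HP := PI_RGT_0).
  unfold average. rewrite RInt_scal_cont by (auto; lra). ring.
Qed.

Lemma average_plus (k1 k2 : R -> R) :
  (forall t, continuous k1 t) -> (forall t, continuous k2 t) ->
  average (fun t => k1 t + k2 t) = average k1 + average k2.
Proof.
  intros H1 H2. assert (HP := PI_RGT_0).
  unfold average. rewrite RInt_plus_cont by (auto; lra). ring.
Qed.

Lemma average_ext (k1 k2 : R -> R) : (forall t, k1 t = k2 t) -> average k1 = average k2.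
Proof.
  intros H. unfold average. f_equal. apply RInt_ext. intros; apply H.
Qed.

Lemma average_nonneg (k : R -> R) :
  (forall t, continuous k t) -> (forall t, 0 <= k t) -> 0 <= average k.
Proof.
  intros H1 H. rewrite <- (average_const 0).
  apply average_le; auto. intros; apply continuous_const.
Qed.

Lemma average_swap (K : R -> R -> R) :
  (forall p : R * R, continuous (fun p : R * R => K (fst p) (snd p)) p) ->
  average (fun x => average (fun y => K x y)) = average (fun y => average (fun x => K x y)).
Proof.
  intros HK. assert (HP := PI_RGT_0). unfold average at 1 3.
  f_equal.
  transitivity (/ (2 * PI) * RInt (fun x => RInt (fun y => K x y) 0 (2 * PI)) 0 (2 * PI)).
  - unfold average. rewrite RInt_scal_cont; auto; try lra.
    intros t _. apply continuous_RInt_param_snd; [lra| |].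
    + intros x _. apply HK.
    + apply filter_forall. intros. apply continuous_slice_2. apply HK.
  - rewrite RInt_swap by (auto; lra). unfold average. rewrite RInt_scal_cont; auto; try lra.
    intros t _. apply continuous_RInt_param; [lra| |].
    + intros x _. apply HK.
    + apply filter_forall. intros. apply continuous_slice_1. apply HK.
Qed.

Lemma poisson_pos (w s : C) : Cmod w < 1 -> s <> w -> 0 < poisson w s.
Proof.
  intros Hw Hs. assert (H0 := Cmod_ge_0 w).
  assert (H1 : 0 < Cmod (s - w)).
  { apply Cmod_gt_0. intros E. apply Hs. apply Ceq_minus. exact E. }
  apply Rdiv_lt_0_compat; nra.
Qed.

Lemma poisson_circle_nonneg (w : C) (th : R) : Cmod w < 1 -> 0 <= poisson w (circle 1 th).
Proof.
  intros Hw. left. apply poisson_pos; [exact Hw|].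
  intros E. apply (circle_sub_neq_0 w th Hw). rewrite E. ring.
Qed.

Lemma continuous_poisson {T : UniformSpace} (u v : T -> C) (x : T) :
  continuous u x -> continuous v x -> v x <> u x ->
  continuous (fun t => poisson (u t) (v t)) x.
Proof.
  intros Hu Hv H. unfold poisson.
  assert (H1 : 0 < Cmod (v x - u x)).
  { apply Cmod_gt_0. intros E. apply H. apply Ceq_minus. exact E. }
  cont. nra.
Qed.

(** For [|s| = 1] the product of Cauchy's kernel with [(1 - |w|^2)/(1 - Cconj w * s)]
    is the Poisson kernel, because [1 - Cconj w * s = s * Cconj (s - w)]. *)
Lemma poisson_kernel_factor (w : C) (th : R) : Cmod w < 1 ->
  ((RtoC (1 - Cmod w * Cmod w) / (1 - Cconj w * circle 1 th)) *
   (circle 1 th / (circle 1 th - w)))%C = RtoC (poisson w (circle 1 th)).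
Proof.
  intros Hw. set (s := circle 1 th).
  assert (Hs : Cmod s = 1) by (apply Cmod_circle; lra).
  assert (N : (s - w)%C <> 0) by (apply circle_sub_neq_0, Hw).
  assert (Ns : s <> 0) by (intros E; rewrite E, Cmod_0 in Hs; lra).
  assert (Nc : Cconj (s - w) <> 0).
  { intros E. apply N. apply Cmod_eq_0. rewrite <- Cmod_conj, E. apply Cmod_0. }
  assert (E1 : (1 - Cconj w * s)%C = (s * Cconj (s - w))%C).
  { rewrite Cconj_minus. assert (U := Cconj_mult_self s). rewrite Hs, Rmult_1_r in U.
    rewrite <- U. ring. }
  assert (P : Cmod (s - w) * Cmod (s - w) <> 0).
  { assert (0 < Cmod (s - w)) by (apply Cmod_gt_0, N). nra. }
  unfold poisson. rewrite E1, RtoC_div by exact P.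
  rewrite <- Cconj_mult_self. field. auto.
Qed.

Section PoissonFormula.
Context (F : C -> C) (w : C).
Context (HF : forall s, Cmod s <= 1 -> cdiff F s) (Hw : Cmod w < 1).

Let F2 (s : C) : C := (F s * (RtoC (1 - Cmod w * Cmod w) / (1 - Cconj w * s)))%C.

Lemma cdiff_poisson_modified (s : C) : Cmod s <= 1 -> cdiff F2 s.
Proof.
  intros Hs. apply cdiff_mult; [apply HF, Hs|]. apply cdiff_div.
  - apply cdiff_const.
  - apply cdiff_minus; [apply cdiff_const|].
    apply cdiff_mult; [apply cdiff_const | apply cdiff_id].
  - intros E. apply Ceq_minus in E.
    assert (M : Cmod (Cconj w * s) = 1) by (rewrite <- E; apply Cmod_1).
    rewrite Cmod_mult, Cmod_conj in M.
    generalize (Cmod_ge_0 w) (Cmod_ge_0 s). nra.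
Qed.

Lemma poisson_modified_at : F2 w = F w.
Proof.
  unfold F2. rewrite Cconj_mult_self, RtoC_minus.
  field. intros E. apply (f_equal fst) in E. simpl in E.
  generalize (Cmod_ge_0 w). nra.
Qed.

Lemma continuous_F_circle (th : R) : continuous (fun t => F (circle 1 t)) th.
Proof.
  apply continuous_on_circle, cdiff_continuous, HF. rewrite Cmod_circle; lra.
Qed.

Lemma continuous_poisson_circle (th : R) : continuous (fun t => poisson w (circle 1 t)) th.
Proof.
  apply continuous_poisson; [apply continuous_const | apply continuous_circle_angle|].
  intros E. apply (circle_sub_neq_0 w th Hw). rewrite E. ring.
Qed.

Lemma poisson_formula :
  CI (fun th => F (circle 1 th) * RtoC (poisson w (circle 1 th)))%C 0 (2 * PI) =
  (RtoC (2 * PI) * F w)%C.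
Proof.
  rewrite <- poisson_modified_at.
  rewrite <- (cauchy_formula F2 w cdiff_poisson_modified Hw).
  apply CI_ext; [generalize PI_RGT_0; lra|].
  intros th _. rewrite <- poisson_kernel_factor by exact Hw. unfold F2. ring.
Qed.

Lemma poisson_bound :
  Cmod (F w) <= average (fun th => Cmod (F (circle 1 th)) * poisson w (circle 1 th)).
Proof.
  assert (HP := PI_RGT_0).
  assert (H := CI_norm 0 (2 * PI) ltac:(lra)
    (fun th => F (circle 1 th) * RtoC (poisson w (circle 1 th)))%C).
  rewrite poisson_formula, Cmod_mult, Cmod_R, Rabs_pos_eq in H by lra.
  unfold average. apply Rmult_le_reg_l with (2 * PI); [lra|].
  rewrite <- Rmult_assoc, Rinv_r, Rmult_1_l by lra.
  eapply Rle_trans; [apply H|].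
  - intros th _. assert (C1 := continuous_F_circle th).
    assert (C2 := continuous_poisson_circle th). cont.
  - right. apply RInt_ext. intros th _.
    rewrite Cmod_mult, Cmod_R, Rabs_pos_eq; [reflexivity|].
    apply poisson_circle_nonneg, Hw.
Qed.

(** A zero at the origin gains the factor [|w|], as in Schwarz's lemma:
    subtract the mean value [0] of the modified function from Cauchy's formula. *)
Lemma poisson_schwarz_bound : F 0 = 0 ->
  Cmod (F w) <= Cmod w * average (fun th => Cmod (F (circle 1 th)) * poisson w (circle 1 th)).
Proof.
  intros H0. assert (HP := PI_RGT_0).
  assert (CF2 : forall th, continuous (fun t => F2 (circle 1 t)) th).
  { intros th. apply continuous_on_circle, cdiff_continuous, cdiff_poisson_modified.
    rewrite Cmod_circle; lra. }
  assert (Cs := fun th => continuous_circle_angle 1 th).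
  assert (Ns := fun th => circle_sub_neq_0 w th Hw).
  assert (A : CI (fun th => F2 (circle 1 th)) 0 (2 * PI) = 0).
  { rewrite (mean_value_property F2 cdiff_poisson_modified). unfold F2. rewrite H0. ring. }
  assert (B := cauchy_formula F2 w cdiff_poisson_modified Hw).
  rewrite poisson_modified_at in B.
  assert (Cq : forall th, continuous (fun th => (F2 (circle 1 th) / (circle 1 th - w))%C) th).
  { intros th. specialize (CF2 th). specialize (Cs th). cont. apply Ns. }
  assert (D : (w * CI (fun th => F2 (circle 1 th) / (circle 1 th - w))%C 0 (2 * PI))%C
    = (RtoC (2 * PI) * F w)%C).
  { rewrite <- CI_scal by (auto; lra).
    replace (RtoC (2 * PI) * F w)%C with (RtoC (2 * PI) * F w - 0)%C by ring.
    rewrite <- B, <- A, <- CI_minus; [|lra| |auto].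
    - apply CI_ext; [lra|]. intros th _. field. apply Ns.
    - intros th _. specialize (CF2 th). specialize (Cs th). cont. apply Ns. }
  assert (H := CI_norm 0 (2 * PI) ltac:(lra) _ (fun th _ => Cq th)).
  apply (f_equal Cmod) in D. rewrite !Cmod_mult, Cmod_R, Rabs_pos_eq in D by lra.
  apply Rmult_le_reg_l with (2 * PI); [lra|]. rewrite <- D.
  unfold average.
  replace (2 * PI * (Cmod w * (/ (2 * PI) *
    RInt (fun th => Cmod (F (circle 1 th)) * poisson w (circle 1 th)) 0 (2 * PI))))
    with (Cmod w * RInt (fun th => Cmod (F (circle 1 th)) * poisson w (circle 1 th)) 0 (2 * PI))
    by (field; lra).
  apply Rmult_le_compat_l; [apply Cmod_ge_0|].
  eapply Rle_trans; [exact H|]. right. apply RInt_ext. intros th _.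
  assert (E := f_equal Cmod (poisson_kernel_factor w th Hw)).
  rewrite Cmod_R, Rabs_pos_eq in E by apply poisson_circle_nonneg, Hw.
  rewrite <- E. unfold F2. rewrite Cmod_mult, (Cmod_div (circle 1 th)) by apply Ns.
  rewrite Cmod_div, Cmod_mult, Cmod_circle by (apply Ns || lra).
  R_equation. field.
  apply Rgt_not_eq, Cmod_gt_0, Ns.
Qed.

End PoissonFormula.

Lemma poisson_average (w : C) : Cmod w < 1 -> average (fun th => poisson w (circle 1 th)) = 1.
Proof.
  intros Hw. assert (HP := PI_RGT_0).
  assert (H := poisson_formula (fun _ => RtoC 1) w (fun s _ => cdiff_const 1 s) Hw).
  rewrite (CI_ext 0 (2 * PI) ltac:(lra) _ (fun th => RtoC (poisson w (circle 1 th)))) in H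
    by (intros; ring).
  rewrite CI_RtoC, <- RtoC_mult in H. apply RtoC_inj in H.
  unfold average. rewrite H. field. lra.
Qed.

(** * A linear Fejer-Riesz inequality *)

(** Cauchy's theorem on a half disk bounds the integral over the diameter by the
    integral over either half of the circle; on the real diameter only the sign
    of the real part is used. *)
Lemma diameter_integral_bound (F : C -> C) (r : R) :
  0 < r -> (forall s, Cmod s <= r -> cdiff F s) ->
  (forall x, - r <= x <= r -> 0 <= fst (F (RtoC x))) ->
  RInt (fun l => fst (F (RtoC (l * r)))) 0 1 <= PI * average (fun th => Cmod (F (circle r th))).
Proof.
  intros Hr HF Hpos. assert (HP := PI_RGT_0).
  set (R1 := CI (fun l => F (RtoC (l * r))) 0 1).
  set (R2 := CI (fun l => F (RtoC (- (l * r)))) 0 1).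
  assert (Cray : forall k l, Rabs k = r -> 0 <= l <= 1 -> continuous (fun l => F (RtoC (l * k))) l).
  { intros k l Hk Hl. apply (continuous_comp (fun l => RtoC (l * k)) F).
    - cont.
    - apply cdiff_continuous, HF. rewrite Cmod_R, Rabs_mult, Hk, Rabs_pos_eq by lra. nra. }
  assert (C1 : forall l, 0 <= l <= 1 -> continuous (fun l => F (RtoC (l * r))) l).
  { intros l Hl. apply Cray; [apply Rabs_pos_eq; lra | exact Hl]. }
  assert (C2 : forall l, 0 <= l <= 1 -> continuous (fun l => F (RtoC (- (l * r)))) l).
  { intros l Hl. apply (continuous_ext (fun l => F (RtoC (l * - r)))).
    - intros u. do 2 f_equal. ring.
    - apply Cray; [rewrite Rabs_Ropp; apply Rabs_pos_eq; lra | exact Hl]. }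
  assert (Cc : forall th, continuous (fun t => F (circle r t)) th).
  { intros th. apply continuous_on_circle, cdiff_continuous, HF. rewrite Cmod_circle; lra. }
  assert (Hgo : forall al,
    (CI (fun l => F (circle (l * r) al) * circle r al) 0 1
     + CI (fun th => F (circle r th) * (Ci * circle r th)) al (al + PI)
     - CI (fun l => F (circle (l * r) (al + PI)) * circle r (al + PI)) 0 1)%C = 0).
  { intros al.
    assert (H := goursat F (fun l th => circle (l * r) th) (fun l th => circle r th)
      (fun l th => (Ci * circle (l * r) th)%C) 0 1 al (al + PI) r).
    rewrite <- H; clear H; try lra.
    - rewrite (CI_ext al (al + PI) ltac:(lra)
        (fun y => F (circle (0 * r) y) * (Ci * circle (0 * r) y))%C (fun _ => RtoC 0)).
      + rewrite CI_const, Rmult_1_l. ring.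
      + intros th _. rewrite Rmult_0_l, (circle_polar 0). ring.
    - intros x y Hx Hy. split; [|split].
      + apply HF. rewrite Cmod_circle; nra.
      + unfold rder, circle; simpl. split; auto_derive; auto; ring.
      + apply rder_circle.
    - intros x y Hx Hy. split; cbv beta; cont.
    - intros x y Hx Hy. split.
      + rewrite Cmod_circle; lra.
      + rewrite Cmod_mult, Cmod_Ci, Cmod_circle; nra. }
  assert (Arc : forall al,
    Cmod (CI (fun th => F (circle r th) * (Ci * circle r th))%C al (al + PI)) <=
    r * RInt (fun th => Cmod (F (circle r th))) al (al + PI)).
  { intros al. rewrite <- RInt_scal_cont; [|lra|intros; cont; auto].
    eapply Rle_trans; [apply CI_norm; [lra|]|].
    - intros t _. specialize (Cc t). cont.
    - right. apply RInt_ext. intros t _. rewrite !Cmod_mult, Cmod_Ci, Cmod_circle by lra.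
      R_equation. ring. }
  assert (Ec0 : forall l, circle (l * r) 0 = RtoC (l * r)).
  { intros l. unfold circle, RtoC. rewrite cos_0, sin_0. f_equal; ring. }
  assert (EcP : forall l, circle (l * r) PI = RtoC (- (l * r))).
  { intros l. unfold circle, RtoC. rewrite cos_PI, sin_PI. f_equal; ring. }
  assert (Er0 : circle r 0 = RtoC r) by (rewrite <- (Rmult_1_l r); apply Ec0).
  assert (ErP : circle r PI = (- RtoC r)%C)
    by (rewrite <- RtoC_opp, <- (Rmult_1_l r); apply EcP).
  assert (X1 : CI (fun l => (F (circle (l * r) 0) * circle r 0)%C) 0 1 = (RtoC r * R1)%C).
  { unfold R1. rewrite <- CI_scal; [|lra|auto]. apply CI_ext; [lra|]. intros l _.
    rewrite Ec0, Er0. ring. }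
  assert (X2 : CI (fun l => (F (circle (l * r) PI) * circle r PI)%C) 0 1 = (- RtoC r * R2)%C).
  { unfold R2. rewrite <- CI_scal; [|lra|auto]. apply CI_ext; [lra|]. intros l _.
    rewrite EcP, ErP. ring. }
  assert (G1 := Hgo 0). assert (G2 := Hgo PI). assert (A1 := Arc 0). assert (A2 := Arc PI).
  replace (0 + PI) with PI in * by ring. replace (PI + PI) with (2 * PI) in * by ring.
  rewrite X1, X2 in G1. rewrite X2 in G2.
  rewrite (CI_ext 0 1 ltac:(lra) (fun l => (F (circle (l * r) (2 * PI)) * circle r (2 * PI))%C)
    (fun l => (F (circle (l * r) 0) * circle r 0)%C)), X1 in G2
    by (intros; rewrite !circle_2PI; reflexivity).
  set (Arc1 := CI (fun th => (F (circle r th) * (Ci * circle r th))%C) 0 PI) in *.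
  set (Arc2 := CI (fun th => (F (circle r th) * (Ci * circle r th))%C) PI (2 * PI)) in *.
  assert (M1 : r * Cmod (R1 + R2) = Cmod Arc1).
  { rewrite <- (Rabs_pos_eq r) at 1 by lra. rewrite <- Cmod_R, <- Cmod_mult, <- (Cmod_opp Arc1).
    f_equal. apply Ceq_minus. rewrite <- G1. ring. }
  assert (M2 : r * Cmod (R1 + R2) = Cmod Arc2).
  { rewrite <- (Rabs_pos_eq r) at 1 by lra. rewrite <- Cmod_R, <- Cmod_mult.
    f_equal. apply Ceq_minus. replace (RtoC 0) with (- 0)%C by ring. rewrite <- G2. ring. }
  rewrite <- M1 in A1. rewrite <- M2 in A2.
  unfold average.
  rewrite (RInt_Chasles_cont _ 0 PI (2 * PI)) by (try lra; intros; cont; auto).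
  set (I1 := RInt (fun th => Cmod (F (circle r th))) 0 PI) in *.
  set (I2 := RInt (fun th => Cmod (F (circle r th))) PI (2 * PI)) in *.
  apply Rmult_le_reg_l in A1; [|exact Hr]. apply Rmult_le_reg_l in A2; [|exact Hr].
  replace (PI * (/ (2 * PI) * (I1 + I2))) with ((I1 + I2) / 2) by (field; lra).
  apply Rle_trans with (fst (R1 + R2)%C).
  - assert (P2 : 0 <= RInt (fun l => fst (F (RtoC (- (l * r))))) 0 1).
    { apply RInt_nonneg_cont; [lra| |].
      - intros t Ht. apply continuous_C_fst. auto.
      - intros t Ht. apply Hpos. nra. }
    change (RInt (fun l => fst (F (RtoC (l * r)))) 0 1 <=
      RInt (fun l => fst (F (RtoC (l * r)))) 0 1 + RInt (fun l => fst (F (RtoC (- (l * r))))) 0 1).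
    lra.
  - generalize (Rabs_fst_le_Cmod (R1 + R2)) (Rle_abs (fst (R1 + R2)%C)). lra.
Qed.


(** * Means over circles *)

Lemma Cmod_sqr_circle_sub (a b x y : R) :
  Cmod (circle a x - circle b y) * Cmod (circle a x - circle b y) =
  a * a + b * b - 2 * a * b * cos (x - y).
Proof.
  rewrite Cmod_sqr, cos_minus. unfold circle; simpl.
  assert (H1 := sin2_cos2 x). assert (H2 := sin2_cos2 y). unfold Rsqr in *.
  replace (a * a) with (a * a * (sin x * sin x + cos x * cos x)) by (rewrite H1; ring).
  replace (b * b) with (b * b * (sin y * sin y + cos y * cos y)) by (rewrite H2; ring).
  ring.
Qed.

Lemma circle_10 : circle 1 0 = 1.
Proof. unfold circle, RtoC. rewrite cos_0, sin_0. f_equal; ring. Qed.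

Lemma Cmod_sqr_one_sub_circle (th : R) :
  Cmod (1 - circle 1 th) * Cmod (1 - circle 1 th) = 2 * (1 - cos th).
Proof.
  rewrite <- circle_10, Cmod_sqr_circle_sub.
  replace (0 - th) with (- th) by ring. rewrite cos_neg. ring.
Qed.

(** The Poisson bound holds at each point of the smaller circle, and the Poisson kernel is
    symmetric in the two angles, so that its mean over the smaller circle is [1] too. *)
Lemma mean_monotone (G : C -> C) (r : R) :
  0 <= r < 1 -> (forall s, Cmod s <= 1 -> cdiff G s) ->
  average (fun th => Cmod (G (circle r th))) <= average (fun th => Cmod (G (circle 1 th))).
Proof.
  intros Hr HG.
  assert (CG : forall u th, 0 <= u <= 1 -> continuous (fun t => G (circle u t)) th).
  { intros u th Hu. apply continuous_on_circle, cdiff_continuous, HG. rewrite Cmod_circle; lra. }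
  assert (Hne : forall x y, circle 1 y <> circle r x).
  { intros x y E. assert (M := f_equal Cmod E). rewrite !Cmod_circle in M; lra. }
  set (K := fun x y => Cmod (G (circle 1 y)) * poisson (circle r x) (circle 1 y)).
  assert (CK : forall p : R * R, continuous (fun p : R * R => K (fst p) (snd p)) p).
  { intros [x y]. unfold K. apply continuous_R_mult.
    - apply (continuous_comp (fun p : R * R => snd p) (fun y => Cmod (G (circle 1 y)))).
      + apply continuous_snd.
      + apply continuous_Cmod, CG. lra.
    - apply continuous_poisson; [cont | cont | apply Hne]. }
  apply Rle_trans with (average (fun x => average (fun y => K x y))).
  - apply average_le.
    + intros t. apply continuous_Cmod, CG. lra.
    + intros t. unfold average. apply continuous_R_mult; [apply continuous_const|].
      apply continuous_RInt_param_snd; [generalize PI_RGT_0; lra| |].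
      * intros y _. apply CK.
      * apply filter_forall. intros. apply continuous_slice_2. apply CK.
    + intros t. apply (poisson_bound G (circle r t) HG). rewrite Cmod_circle; lra.
  - rewrite average_swap by exact CK. right. apply average_ext. intros y.
    unfold K. rewrite average_scal.
    + rewrite (average_ext _ (fun x => poisson (circle r y) (circle 1 x))).
      * rewrite poisson_average; [ring | rewrite Cmod_circle; lra].
      * intros x. unfold poisson. rewrite !Cmod_circle, !Cmod_sqr_circle_sub by lra.
        rewrite <- (cos_neg (y - x)), Ropp_minus_distr. reflexivity.
    + intros x. apply continuous_poisson; [cont | cont | apply Hne].
Qed.

(** Removing a neighbourhood of [0] and [2 * PI] from the range of integration. *)
Lemma RInt_le_of_inner (g : R -> R) (B : R) :
  (forall t, continuous g t) ->
  (forall e, 0 < e < PI -> RInt g e (2 * PI - e) <= B) -> RInt g 0 (2 * PI) <= B.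
Proof.
  intros Hg HB. assert (HP := PI_RGT_0).
  destruct (continuity_ab_maj g 0 (2 * PI)) as [m [Hm _]]; [lra| |].
  { intros c _. apply continuity_pt_filterlim, Hg. }
  apply le_epsilon. intros e He.
  set (M := Rmax 1 (g m)). assert (HM : 1 <= M) by apply Rmax_l.
  assert (HgM : forall t, 0 <= t <= 2 * PI -> g t <= M).
  { intros t Ht. eapply Rle_trans; [apply Hm, Ht | apply Rmax_r]. }
  (* the two discarded arcs contribute at most [2 * M * u <= e] *)
  set (u := Rmin (PI / 2) (e / (2 * M))).
  assert (Hu : 0 < u < PI /\ 2 * M * u <= e).
  { assert (0 < e / (2 * M)) by (apply Rdiv_lt_0_compat; lra).
    unfold u. split; [split|].
    - apply Rmin_glb_lt; lra.
    - eapply Rle_lt_trans; [apply Rmin_l | lra].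
    - replace e with (2 * M * (e / (2 * M))) at 2 by (field; lra).
      apply Rmult_le_compat_l; [lra | apply Rmin_r]. }
  rewrite (RInt_Chasles_cont g 0 u (2 * PI)), (RInt_Chasles_cont g u (2 * PI - u) (2 * PI))
    by (auto; lra).
  assert (A1 : RInt g 0 u <= M * (u - 0)).
  { rewrite <- RInt_const_R. apply RInt_le_cont; auto; try lra.
    - intros; apply continuous_const.
    - intros t Ht. apply HgM. lra. }
  assert (A2 : RInt g (2 * PI - u) (2 * PI) <= M * (2 * PI - (2 * PI - u))).
  { rewrite <- RInt_const_R. apply RInt_le_cont; auto; try lra.
    - intros; apply continuous_const.
    - intros t Ht. apply HgM. lra. }
  assert (A3 := HB u ltac:(lra)). lra.
Qed.

(** * The contraction property of the maps [t / (1 - (1 - t) z)] *)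

(** For fixed [z] a path from [0] to [1] in [t]; for fixed [t], [0 < t < 1], a linear
    fractional map of the disk onto a smaller disk, tangent to the unit circle at the
    fixed point [1]. *)
Definition phi (t : R) (z : C) : C := (RtoC t / (1 - RtoC (1 - t) * z))%C.

Lemma one_sub_lower (k : R) (z : C) : 0 <= k -> 1 - k * Cmod z <= Cmod (1 - RtoC k * z).
Proof.
  intros Hk. assert (H := Cmod_triangle_rev 1 (RtoC k * z)).
  rewrite Cmod_1, Cmod_mult, Cmod_R, Rabs_pos_eq in H by exact Hk. exact H.
Qed.

Lemma one_sub_neq_0 (k : R) (z : C) : 0 <= k -> k * Cmod z < 1 -> (1 - RtoC k * z)%C <> 0.
Proof.
  intros Hk H E. assert (L := one_sub_lower k z Hk). rewrite E, Cmod_0 in L. lra.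
Qed.

Lemma phi_modulus (t r : R) (z : C) :
  0 <= t <= 1 -> Cmod z <= r -> (1 - t) * r < 1 -> Cmod (phi t z) <= t / (1 - (1 - t) * r).
Proof.
  intros Ht Hz Hr. assert (H0 := Cmod_ge_0 z).
  assert (L := one_sub_lower (1 - t) z ltac:(lra)).
  assert (M : (1 - t) * Cmod z <= (1 - t) * r) by (apply Rmult_le_compat_l; lra).
  unfold phi. rewrite Cmod_div, Cmod_R, Rabs_pos_eq by (lra || (apply one_sub_neq_0; lra)).
  apply Rmult_le_compat_l; [lra|]. apply Rinv_le_contravar; lra.
Qed.

Lemma phi_modulus_lt_1 (t r : R) (z : C) :
  0 <= t < 1 -> 0 <= r < 1 -> Cmod z <= r ->
  (1 - t) * (1 - r) <= 1 - Cmod (phi t z).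
Proof.
  intros Ht Hr Hz.
  assert (H1 : 0 < 1 - (1 - t) * r <= 1) by nra.
  assert (H := phi_modulus t r z ltac:(lra) Hz ltac:(lra)).
  assert (E : 1 - t / (1 - (1 - t) * r) = (1 - t) * (1 - r) / (1 - (1 - t) * r)) by (field; lra).
  assert (P : 0 <= (1 - t) * (1 - r)) by nra.
  assert ((1 - t) * (1 - r) <= (1 - t) * (1 - r) / (1 - (1 - t) * r)).
  { apply le_div_of_mul_le; [lra|]. rewrite <- (Rmult_1_r ((1 - t) * (1 - r))) at 2.
    apply Rmult_le_compat_l; lra. }
  lra.
Qed.

Section Contraction.
Context (F : C -> C) (t : R).
Context (HF : forall s, Cmod s <= 1 -> cdiff F s) (HF0 : F 0 = 0) (Ht : 0 < t < 1).

Let G (z : C) : C := (F (phi t z) / (1 - RtoC (1 - t) * z))%C.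

(* [|1 - t * Cconj s - (1 - t) * z|^2] for [z], [s] on the unit circle at the angles
   [x], [y]; it is [|s - phi t z|^2] up to the factor [|1 - (1 - t) * z|^2] *)
Let D (x y : R) : R :=
  Cmod (1 - RtoC t * circle 1 (- y) - RtoC (1 - t) * circle 1 x) ^ 2.

(* the factor [2 * (1 - cos y)] is [|1 - s|^2] *)
Let kernel (x y : R) : R := 2 * (1 - cos y) * (t / (1 - t) / D x y).

Lemma phi_closed_disk (z : C) : Cmod z <= 1 -> Cmod (phi t z) <= 1.
Proof.
  intros Hz. eapply Rle_trans; [apply (phi_modulus t 1); lra|]. right. field. lra.
Qed.

Lemma cdiff_weighted_composition (z : C) : Cmod z <= 1 -> cdiff G z.
Proof.
  intros Hz. assert (N : (1 - RtoC (1 - t) * z)%C <> 0) by (apply one_sub_neq_0; nra).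
  assert (Cd : cdiff (fun z => (1 - RtoC (1 - t) * z)%C) z).
  { apply cdiff_minus; [apply cdiff_const|].
    apply cdiff_mult; [apply cdiff_const | apply cdiff_id]. }
  apply cdiff_div; auto. apply (cdiff_comp F (phi t)).
  - apply HF, phi_closed_disk, Hz.
  - apply cdiff_div; auto. apply cdiff_const.
Qed.

Lemma continuous_D (x y : R) : continuous (fun p : R * R => D (fst p) (snd p)) (x, y).
Proof. unfold D. cont. Qed.

Lemma D_pos (x y : R) : cos x < 1 -> 0 < D x y.
Proof.
  intros Hx. apply pow_lt.
  eapply Rlt_le_trans; [|apply Rabs_fst_le_Cmod].
  eapply Rlt_le_trans; [|apply Rle_abs].
  unfold circle; simpl. rewrite cos_neg. assert (H := COS_bound y). nra.
Qed.

Lemma continuous_kernel (x y : R) : cos x < 1 ->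
  continuous (fun p : R * R => kernel (fst p) (snd p)) (x, y).
Proof.
  intros Hx. assert (H := D_pos x y Hx). assert (C1 := continuous_D x y).
  unfold kernel. cont. apply Rgt_not_eq, H.
Qed.

(** The Schwarz-Poisson estimate of [F s * (1 - s)^2] at [s = phi t z], [|z| = 1].
    The factor [(1 - s)^2] makes the powers of [|1 - z|] cancel: both
    [1 - |phi t z|^2] and [|1 - phi t z|^2] are proportional to [|1 - z|^2]. *)
Lemma boundary_estimate (x : R) : cos x < 1 ->
  Cmod (G (circle 1 x)) <= average (fun y => Cmod (F (circle 1 y)) * kernel x y).
Proof.
  intros Hx. set (z := circle 1 x). set (c := 1 - t).
  assert (Hz : Cmod z = 1) by (apply Cmod_circle; lra).
  assert (N : (1 - RtoC c * z)%C <> 0) by (apply one_sub_neq_0; unfold c; nra).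
  set (q := Cmod (1 - RtoC c * z)).
  assert (Hq : 0 < q) by (apply Cmod_gt_0, N).
  set (m := Cmod (1 - z)).
  assert (Em : m * m = 2 * (1 - cos x)) by apply Cmod_sqr_one_sub_circle.
  assert (Hm : 0 < m) by (assert (0 <= m) by apply Cmod_ge_0; nra).
  assert (Eq : q * q = t * t + c * (m * m)).
  { rewrite Em. unfold q. rewrite Cmod_sqr. unfold z, circle; simpl.
    assert (H := sin2_cos2 x). unfold Rsqr in H.
    assert (S2 : sin x * sin x = 1 - cos x * cos x) by lra.
    transitivity (1 - 2 * c * cos x + c * c * (cos x * cos x) + c * c * (sin x * sin x)); [ring|].
    rewrite S2. unfold c. ring. }
  set (w := phi t z).
  assert (Ew : Cmod w = t / q).
  { unfold w, phi. fold c. rewrite Cmod_div, Cmod_R, Rabs_pos_eq by (auto; lra). reflexivity. }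
  assert (Hw : Cmod w < 1).
  { rewrite Ew. apply div_lt_of_lt_mul; [exact Hq|]. rewrite Rmult_1_l.
    assert (0 < c * (m * m)) by (unfold c; apply Rmult_lt_0_compat; nra). nra. }
  assert (E1w : Cmod (1 - w) = c * m / q).
  { replace (1 - w)%C with (RtoC c * (1 - z) / (1 - RtoC c * z))%C.
    - rewrite Cmod_div, Cmod_mult, Cmod_R, Rabs_pos_eq by (auto; unfold c; lra). reflexivity.
    - unfold w, phi. fold c. replace t with (1 - c) by (unfold c; ring).
      rewrite RtoC_minus. field. exact N. }
  set (F3 := fun s : C => (F s * ((1 - s) * (1 - s)))%C).
  assert (HF3 : forall s, Cmod s <= 1 -> cdiff F3 s).
  { intros s Hs. assert (cdiff (fun s => (1 - s)%C) s)
      by (apply cdiff_minus; [apply cdiff_const | apply cdiff_id]).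
    apply cdiff_mult; [apply HF, Hs|]. apply cdiff_mult; assumption. }
  assert (H := poisson_schwarz_bound F3 w HF3 Hw).
  assert (H30 : F3 0 = 0) by (unfold F3; rewrite HF0; ring).
  specialize (H H30). unfold F3 at 1 in H. rewrite !Cmod_mult, E1w, Ew in H.
  assert (CF : forall y, continuous (fun y => F (circle 1 y)) y).
  { intros y. apply continuous_on_circle, cdiff_continuous, HF. rewrite Cmod_circle; lra. }
  assert (EG : Cmod (G z) = Cmod (F w) / q)
    by (unfold G; fold w c; apply Cmod_div, N).
  rewrite EG.
  apply Rmult_le_reg_l with (c * m * (c * m) / q).
  { apply Rdiv_lt_0_compat; [|exact Hq].
    assert (0 < c * m) by (apply Rmult_lt_0_compat; unfold c; lra).
    apply Rmult_lt_0_compat; assumption. }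
  rewrite <- average_scal.
  2: { intros y. specialize (CF y).
       assert (C1 := continuous_slice_2 kernel x y (continuous_kernel x y Hx)). cont. }
  replace (c * m * (c * m) / q * (Cmod (F w) / q)) with
    (Cmod (F w) * (c * m / q * (c * m / q))) by (field; lra).
  eapply Rle_trans; [exact H|].
  rewrite <- average_scal.
  2: { intros y. specialize (CF y). unfold F3.
       assert (C1 : continuous (fun y => poisson w (circle 1 y)) y).
       { apply continuous_poisson; [cont | cont |].
         intros E. apply (circle_sub_neq_0 w y Hw). rewrite E. ring. }
       cont. }
  right. apply average_ext. intros y. set (s := circle 1 y).
  unfold F3. rewrite !Cmod_mult. unfold s at 2 3. rewrite Cmod_sqr_one_sub_circle.
  assert (ED : Cmod (s - w) = Cmod (1 - RtoC t * circle 1 (- y) - RtoC c * z) / q).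
  { replace (s - w)%C with
      (s * (1 - RtoC t * circle 1 (- y) - RtoC c * z) / (1 - RtoC c * z))%C.
    - rewrite Cmod_div, Cmod_mult by exact N. unfold s at 1. rewrite Cmod_circle by lra.
      rewrite Rmult_1_l. reflexivity.
    - assert (U : (s * circle 1 (- y))%C = 1).
      { unfold s, circle, Cmult, RtoC; simpl. rewrite cos_neg, sin_neg.
        assert (H2 := sin2_cos2 y). unfold Rsqr in H2. f_equal; [|ring].
        transitivity (sin y * sin y + cos y * cos y); [ring | exact H2]. }
      unfold w, phi. fold c.
      transitivity ((s - RtoC t * (s * circle 1 (- y)) - s * (RtoC c * z)) / (1 - RtoC c * z))%C;
        [field; exact N|].
      rewrite U. field. exact N. }
  assert (Hd := D_pos x y Hx).
  unfold kernel, poisson. rewrite ED, Ew. unfold D in *. fold c z in Hd |- *.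
  set (d := Cmod (1 - t * circle 1 (- y) - c * z)) in *.
  assert (Hd' : d <> 0) by (intros E; rewrite E in Hd; simpl in Hd; lra).
  assert (Hc : c <> 0) by (unfold c; lra).
  replace (1 - t / q * (t / q)) with (c * (m * m) / (q * q)).
  2: { replace (c * (m * m)) with (q * q - t * t) by lra. field. lra. }
  field. repeat split; auto; lra.
Qed.

(** In the first variable the kernel is a Poisson kernel with pole
    [(1 - t) / (1 - t * s)], [|s| = 1]; the factor [|1 - s|^2] cancels the one which that
    pole contributes, and vanishes when the pole reaches the circle at [s = 1]. *)
Lemma kernel_integral (y e : R) : 0 < e < PI ->
  RInt (fun x => kernel x y) e (2 * PI - e) <= 2 * PI / (1 - t).
Proof.
  intros He. assert (HP := PI_RGT_0). set (c := 1 - t). assert (Hc : 0 < c) by (unfold c; lra).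
  assert (Hy := COS_bound y).
  destruct (Req_dec (cos y) 1) as [E|E].
  - rewrite (RInt_ext_le _ (fun _ => 0)).
    + rewrite RInt_const_R. apply Rle_trans with 0; [right; ring|].
      apply Rdiv_le_0_compat; lra.
    + lra.
    + intros x _. unfold kernel. rewrite E. ring.
  - set (A := (1 - RtoC t * circle 1 y)%C).
    set (a := Cmod A).
    assert (Ea : a * a = c * c + t * (2 * (1 - cos y))).
    { unfold a. rewrite Cmod_sqr. unfold A, circle; simpl.
      assert (H := sin2_cos2 y). unfold Rsqr in H.
      assert (S2 : sin y * sin y = 1 - cos y * cos y) by lra.
      transitivity (1 - 2 * t * cos y + t * t * (cos y * cos y) + t * t * (sin y * sin y)); [ring|].
      rewrite S2. unfold c. ring. }
    assert (Hty : 0 < t * (2 * (1 - cos y))) by (apply Rmult_lt_0_compat; lra).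
    assert (Ha0 : 0 <= a) by apply Cmod_ge_0.
    assert (Ha : c < a) by nra.
    assert (NA : A <> 0) by (apply Cmod_gt_0; fold a; lra).
    set (w := (RtoC c / A)%C).
    assert (Ew : Cmod w = c / a)
      by (unfold w; rewrite Cmod_div, Cmod_R, Rabs_pos_eq by (auto; lra); reflexivity).
    assert (Hw : Cmod w < 1) by (rewrite Ew; apply div_lt_of_lt_mul; lra).
    assert (EK : forall x, kernel x y = / c * poisson w (circle 1 x)).
    { intros x. set (z := circle 1 x).
      assert (ED : Cmod (z - w) = Cmod (1 - RtoC t * circle 1 (- y) - RtoC c * z) / a).
      { assert (Ec : forall v, circle 1 (- v) = Cconj (circle 1 v)).
        { intros v. unfold circle, Cconj; simpl. rewrite cos_neg, sin_neg. f_equal. ring. }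
        rewrite <- (Cmod_conj (1 - RtoC t * circle 1 (- y) - RtoC c * z)).
        rewrite !Cconj_minus, !Cconj_mult, !Cconj_RtoC, Ec.
        replace (Cconj (Cconj (circle 1 y))) with (circle 1 y)
          by (unfold Cconj, circle; simpl; f_equal; ring).
        fold A.
        replace (z - w)%C with (z * (A - RtoC c * Cconj z) / A)%C.
        - rewrite Cmod_div, Cmod_mult by exact NA. unfold z at 1.
          rewrite Cmod_circle, Rmult_1_l by lra. reflexivity.
        - assert (U := Cconj_mult_self z). unfold z in U at 3 4.
          rewrite Cmod_circle, Rmult_1_r in U by lra.
          transitivity ((z * A - RtoC c * (Cconj z * z)) / A)%C; [field; exact NA|].
          rewrite U. unfold w. field. exact NA. }
      assert (Hd : Cmod (1 - RtoC t * circle 1 (- y) - RtoC c * z) <> 0).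
      { intros Ed. apply (circle_sub_neq_0 w x Hw). apply Cmod_eq_0. fold z.
        rewrite ED, Ed. unfold Rdiv. ring. }
      unfold kernel, poisson, D. fold c z. rewrite ED, Ew.
      set (d := Cmod (1 - t * circle 1 (- y) - c * z)) in *.
      replace (1 - c / a * (c / a)) with (t * (2 * (1 - cos y)) / (a * a)).
      2: { replace (t * (2 * (1 - cos y))) with (a * a - c * c) by lra. field. lra. }
      field. repeat split; auto; lra. }
    assert (Cp : forall x, continuous (fun x => poisson w (circle 1 x)) x).
    { intros x. apply continuous_poisson; [cont | cont |].
      intros E'. apply (circle_sub_neq_0 w x Hw). rewrite E'. ring. }
    rewrite (RInt_ext_le _ (fun x => / c * poisson w (circle 1 x))) by (auto; lra).
    rewrite RInt_scal_cont by (auto; lra).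
    assert (Hav := poisson_average w Hw). unfold average in Hav.
    assert (HI : RInt (fun x => poisson w (circle 1 x)) 0 (2 * PI) = 2 * PI).
    { apply Rmult_eq_reg_l with (/ (2 * PI)); [|apply Rinv_neq_0_compat; lra].
      rewrite Hav. field. lra. }
    unfold Rdiv. rewrite Rmult_comm. apply Rmult_le_compat_r.
    { left. apply Rinv_0_lt_compat, Hc. }
    apply Rle_trans with (RInt (fun x => poisson w (circle 1 x)) 0 (2 * PI)); [|right; exact HI].
    rewrite (RInt_Chasles_cont _ 0 e (2 * PI)), (RInt_Chasles_cont _ e (2 * PI - e) (2 * PI))
      by (auto; lra).
    assert (A1 : 0 <= RInt (fun x => poisson w (circle 1 x)) 0 e).
    { apply RInt_nonneg_cont; auto; try lra. intros; apply poisson_circle_nonneg, Hw. }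
    assert (A2 : 0 <= RInt (fun x => poisson w (circle 1 x)) (2 * PI - e) (2 * PI)).
    { apply RInt_nonneg_cont; auto; try lra. intros; apply poisson_circle_nonneg, Hw. }
    lra.
Qed.

Lemma cos_lt_1 (x : R) : 0 < x < 2 * PI -> cos x < 1.
Proof.
  intros Hx. assert (HP := PI_RGT_0).
  replace x with (2 * (x / 2)) by field. rewrite cos_2a_sin.
  assert (0 < sin (x / 2)) by (apply sin_gt_0; lra). nra.
Qed.

(** Integrate [boundary_estimate] over the circle and exchange the integrals.  The kernel
    is discontinuous at [z = s = 1] only, so [z] first stays away from [1]. *)
Lemma contraction_closed_disk (r : R) : 0 <= r < 1 ->
  average (fun x => Cmod (G (circle r x))) <=
  average (fun x => Cmod (F (circle 1 x))) / (1 - t).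
Proof.
  intros Hr. assert (HP := PI_RGT_0).
  eapply Rle_trans; [apply (mean_monotone G r Hr cdiff_weighted_composition)|].
  assert (CG : forall x, continuous (fun x => Cmod (G (circle 1 x))) x).
  { intros x. apply continuous_Cmod, continuous_on_circle, cdiff_continuous,
      cdiff_weighted_composition. rewrite Cmod_circle; lra. }
  assert (CF : forall x, continuous (fun x => Cmod (F (circle 1 x))) x).
  { intros x. apply continuous_Cmod, continuous_on_circle, cdiff_continuous, HF.
    rewrite Cmod_circle; lra. }
  unfold average at 1.
  apply Rmult_le_reg_l with (2 * PI); [lra|].
  rewrite <- Rmult_assoc, Rinv_r, Rmult_1_l by lra.
  apply RInt_le_of_inner; [exact CG|]. intros e He.
  assert (Cos : forall x, e <= x <= 2 * PI - e -> cos x < 1)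
    by (intros; apply cos_lt_1; lra).
  set (K := fun x y => Cmod (F (circle 1 y)) * kernel x y).
  assert (CK : forall x y, e <= x <= 2 * PI - e ->
    continuous (fun p : R * R => K (fst p) (snd p)) (x, y)).
  { intros x y Hx. unfold K. apply continuous_R_mult.
    - apply (continuous_comp (fun p : R * R => snd p) (fun y => Cmod (F (circle 1 y)))).
      + apply continuous_snd.
      + apply CF.
    - apply continuous_kernel. auto. }
  assert (CK2 : forall x, e <= x <= 2 * PI - e ->
    continuous (fun x => RInt (fun y => K x y) 0 (2 * PI)) x).
  { intros x Hx. apply continuous_RInt_param_snd; [lra| |].
    - intros y _. apply CK, Hx.
    - assert (Hc1 : locally x (fun u => cos u < 1)).
      { apply (continuous_cos x (fun v => v < 1)). apply open_lt. auto. }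
      revert Hc1. apply filter_imp. intros u Hu y _. unfold K.
      apply continuous_R_mult; [apply CF|]. apply continuous_slice_2, continuous_kernel, Hu. }
  apply Rle_trans with
    (/ (2 * PI) * RInt (fun x => RInt (fun y => K x y) 0 (2 * PI)) e (2 * PI - e)).
  - rewrite <- RInt_scal_cont by (auto; lra). apply RInt_le_cont; auto; try lra.
    + intros x Hx. apply continuous_R_mult; [apply continuous_const | auto].
    + intros x Hx. apply boundary_estimate. auto.
  - rewrite (RInt_swap K e (2 * PI - e) 0 (2 * PI)) by (auto; lra).
    unfold average.
    apply Rle_trans with
      (/ (2 * PI) * (2 * PI / (1 - t) * RInt (fun y => Cmod (F (circle 1 y))) 0 (2 * PI))).
    + apply Rmult_le_compat_l; [left; apply Rinv_0_lt_compat; lra|].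
      rewrite <- RInt_scal_cont by (auto; lra). apply RInt_le_cont; auto; try lra.
      * intros y _. apply continuous_RInt_param; [lra| |].
        -- intros; apply CK; lra.
        -- apply filter_forall. intros. apply continuous_slice_1. apply CK; lra.
      * intros y _. apply continuous_R_mult; [apply continuous_const | apply CF].
      * intros y _. unfold K. rewrite RInt_scal_cont; [|lra|].
        -- rewrite Rmult_comm. apply Rmult_le_compat_r; [apply Cmod_ge_0|].
           apply kernel_integral, He.
        -- intros x Hx. apply continuous_slice_1, continuous_kernel. auto.
    + right. field. lra.
Qed.

End Contraction.

(** * Functions with bounded means *)

Definition bounded_means (f : C -> C) (N : R) : Prop :=
  forall r, 0 <= r < 1 -> average (fun th => Cmod (f (circle r th))) <= N.

Lemma cdiff_dilation (f : C -> C) (p : R) :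
  (forall s, Cmod s < 1 -> cdiff f s) -> 0 <= p < 1 ->
  forall s, Cmod s <= 1 -> cdiff (fun s => f (RtoC p * s)%C) s.
Proof.
  intros Hf Hp s Hs. apply (cdiff_comp f (fun s => (RtoC p * s)%C)).
  - apply Hf. rewrite Cmod_mult, Cmod_R, Rabs_pos_eq by lra.
    generalize (Cmod_ge_0 s). nra.
  - apply cdiff_mult; [apply cdiff_const | apply cdiff_id].
Qed.

Lemma dilation_mean (f : C -> C) (p N : R) :
  bounded_means f N -> 0 <= p < 1 ->
  average (fun th => Cmod (f (RtoC p * circle 1 th)%C)) <= N.
Proof.
  intros HN Hp. eapply Rle_trans; [|apply (HN p Hp)]. right.
  apply average_ext. intros th. rewrite <- circle_polar. reflexivity.
Qed.

Lemma limit_bound_at_1 (k : R -> R) (B : R) :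
  continuous k 1 -> (forall p, 0 < p < 1 -> k p <= B) -> k 1 <= B.
Proof.
  intros Hk HB. apply Rnot_lt_le. intros H.
  assert (He : 0 < k 1 - B) by lra.
  destruct (Hk _ (locally_ball (k 1) (mkposreal _ He))) as [d Hd].
  assert (Pd := cond_pos d).
  set (p := Rmax (1 / 2) (1 - d / 2)).
  assert (Hp : 1 / 2 <= p < 1 /\ 1 - d / 2 <= p).
  { unfold p. split; [split|]; [apply Rmax_l | apply Rmax_lub_lt; lra | apply Rmax_r]. }
  assert (Hb := Hd p). change (Rabs (p - 1) < d -> Rabs (k p - k 1) < k 1 - B) in Hb.
  assert (H1 : Rabs (p - 1) < d) by (apply Rabs_def1; lra).
  apply Hb in H1. apply Rabs_def2 in H1.
  assert (H2 := HB p ltac:(lra)). lra.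
Qed.

(** The dilations [f (p * s)] are holomorphic on the closed disk; let [p] tend to [1]. *)
Theorem contraction (f : C -> C) (N t r : R) :
  (forall s, Cmod s < 1 -> cdiff f s) -> f 0 = 0 -> bounded_means f N ->
  0 < t < 1 -> 0 <= r < 1 ->
  average (fun x => Cmod (f (phi t (circle r x)) / (1 - RtoC (1 - t) * circle r x)))
    <= N / (1 - t).
Proof.
  intros Hf Hf0 HN Ht Hr. assert (HP := PI_RGT_0).
  set (K := fun x p => Cmod (f (RtoC p * phi t (circle r x))%C
                             / (1 - RtoC (1 - t) * circle r x))).
  assert (Nz : forall x, (1 - RtoC (1 - t) * circle r x)%C <> 0).
  { intros x. apply one_sub_neq_0; [lra|]. rewrite Cmod_circle; nra. }
  set (q := t / (1 - (1 - t) * r)).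
  assert (Hden : 0 < 1 - (1 - t) * r) by nra.
  assert (Hq : 0 < q < 1).
  { split; [apply Rdiv_lt_0_compat; lra|]. apply div_lt_of_lt_mul; nra. }
  assert (Hphi : forall x, Cmod (phi t (circle r x)) <= q).
  { intros x. apply phi_modulus; try lra. rewrite Cmod_circle; lra. }
  assert (CK : forall x p, 0 <= p < / q ->
    continuous (fun u : R * R => K (fst u) (snd u)) (x, p)).
  { intros x p Hp. unfold K. apply continuous_Cmod.
    apply continuous_Cdiv; [|cont|apply Nz].
    apply (continuous_comp (fun u : R * R => (RtoC (snd u) * phi t (circle r (fst u)))%C) f).
    - unfold phi. cont. apply Nz.
    - apply cdiff_continuous, Hf. simpl. rewrite Cmod_mult, Cmod_R, Rabs_pos_eq by lra.
      apply Rle_lt_trans with (p * q).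
      + apply Rmult_le_compat_l; [lra | apply Hphi].
      + apply Rmult_lt_reg_r with (/ q); [apply Rinv_0_lt_compat; lra|].
        rewrite Rmult_assoc, Rinv_r by lra. lra. }
  assert (Hiq : 1 < / q) by (rewrite <- Rinv_1; apply Rinv_lt_contravar; lra).
  replace (average (fun x => Cmod (f (phi t (circle r x)) / (1 - RtoC (1 - t) * circle r x))))
    with (average (fun x => K x 1)).
  2: { apply average_ext. intros x. unfold K. rewrite Cmult_1_l. reflexivity. }
  apply (limit_bound_at_1 (fun p => average (fun x => K x p))).
  - unfold average. apply continuous_R_mult; [apply continuous_const|].
    apply continuous_RInt_param; [lra| |].
    + intros; apply CK; lra.
    + assert (Hloc : locally 1 (fun p => 0 < p < / q)).
      { apply filter_and; [apply open_gt; lra | apply open_lt; lra]. }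
      revert Hloc. apply filter_imp. intros p Hp x _. apply continuous_slice_1, CK. lra.
  - intros p Hp.
    eapply Rle_trans.
    + apply (contraction_closed_disk (fun s => f (RtoC p * s)%C) t); try assumption.
      * apply cdiff_dilation; [assumption | lra].
      * rewrite Cmult_0_r. exact Hf0.
    + apply Rmult_le_compat_r; [left; apply Rinv_0_lt_compat; lra|].
      apply dilation_mean; [assumption | lra].
Qed.

(** The Poisson kernel at [w] is at most [2 / (1 - |w|)] on the unit circle. *)
Lemma pointwise_bound (f : C -> C) (N : R) (s : C) :
  (forall s, Cmod s < 1 -> cdiff f s) -> bounded_means f N -> Cmod s < 1 ->
  Cmod (f s) <= 4 * N / (1 - Cmod s).
Proof.
  intros Hf HN Hs. assert (H0 := Cmod_ge_0 s). set (a := Cmod s) in *.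
  (* the circle of radius [p] lies halfway between [s] and the unit circle *)
  set (p := (1 + a) / 2). assert (Hp : 1 / 2 <= p < 1) by (unfold p; lra).
  set (F := fun s => f (RtoC p * s)%C).
  assert (HF : forall s, Cmod s <= 1 -> cdiff F s) by (apply cdiff_dilation; [assumption | lra]).
  assert (Np : RtoC p <> 0) by (intros E; apply RtoC_inj in E; lra).
  set (w := (s / RtoC p)%C).
  assert (Ew : Cmod w = a / p).
  { unfold w. rewrite Cmod_div, Cmod_R, Rabs_pos_eq by (auto; lra). reflexivity. }
  assert (E1w : 1 - Cmod w = (1 - a) / (1 + a)) by (rewrite Ew; unfold p; field; lra).
  assert (Hw1 : 0 < 1 - Cmod w) by (rewrite E1w; apply Rdiv_lt_0_compat; lra).
  assert (Hw0 := Cmod_ge_0 w).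
  assert (Efs : f s = F w).
  { unfold F, w. f_equal. field. exact Np. }
  assert (CF : forall y, continuous (fun y => Cmod (F (circle 1 y))) y).
  { intros y. apply continuous_Cmod, continuous_on_circle, cdiff_continuous, HF.
    rewrite Cmod_circle; lra. }
  rewrite Efs. eapply Rle_trans; [apply (poisson_bound F w HF); lra|].
  set (M := 2 / (1 - Cmod w)).
  assert (HM : 0 <= M <= 4 / (1 - a)).
  { unfold M. split; [apply Rdiv_le_0_compat; lra|]. rewrite E1w.
    apply div_le_of_le_mul; [apply Rdiv_lt_0_compat; lra|].
    replace (4 / (1 - a) * ((1 - a) / (1 + a))) with (4 / (1 + a)) by (field; lra).
    apply le_div_of_mul_le; lra. }
  apply Rle_trans with (average (fun y => M * Cmod (F (circle 1 y)))).
  - apply average_le.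
    + intros y. apply continuous_R_mult; [apply CF|].
      apply continuous_poisson; [cont | cont |].
      intros E. apply (circle_sub_neq_0 w y ltac:(lra)). rewrite E. ring.
    + intros y. apply continuous_R_mult; [apply continuous_const | apply CF].
    + intros y. rewrite (Rmult_comm M). apply Rmult_le_compat_l; [apply Cmod_ge_0|].
      assert (T := Cmod_triangle_rev (circle 1 y) w). rewrite Cmod_circle in T by lra.
      unfold poisson, M. set (d := Cmod (circle 1 y - w)) in *.
      apply div_le_of_le_mul; [nra|]. 
      apply Rle_trans with (2 / (1 - Cmod w) * ((1 - Cmod w) * (1 - Cmod w))).
      * replace (2 / (1 - Cmod w) * ((1 - Cmod w) * (1 - Cmod w))) with (2 * (1 - Cmod w))
          by (field; lra). nra.
      * apply Rmult_le_compat_l; [apply HM|]. nra.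
  - rewrite average_scal by exact CF.
    assert (HA : average (fun y => Cmod (F (circle 1 y))) <= N)
      by (apply dilation_mean; [assumption | lra]).
    assert (HA0 : 0 <= average (fun y => Cmod (F (circle 1 y))))
      by (apply average_nonneg; [exact CF | intros; apply Cmod_ge_0]).
    apply Rle_trans with (4 / (1 - a) * N).
    + apply Rmult_le_compat; lra.
    + right. field. lra.
Qed.


(** * The principal power on the right half-plane *)

Lemma Rpower_pos (x a : R) : 0 < Rpower x a.
Proof. apply exp_pos. Qed.

Lemma Cmod_Cpower (w : C) (a : R) : Cmod (Cpower w a) = Rpower (Cmod w) a.
Proof.
  unfold Cpower. set (x := a * atan (Im w / Re w)).
  rewrite Cmod_mult, Cmod_R, Rabs_pos_eq by (left; apply Rpower_pos).
  replace (cos x, sin x) with (circle 1 x) by (unfold circle; f_equal; ring).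
  rewrite Cmod_circle by lra. ring.
Qed.

Lemma Cpower_neq_0 (w : C) (a : R) : Cpower w a <> 0.
Proof. apply Cmod_gt_0. rewrite Cmod_Cpower. apply Rpower_pos. Qed.

Lemma Cmod_pos_of_Re (w : C) : 0 < fst w -> 0 < Cmod w.
Proof.
  intros H. eapply Rlt_le_trans; [exact H|].
  eapply Rle_trans; [apply Rle_abs | apply Rabs_fst_le_Cmod].
Qed.

Lemma C_polar_form (w : C) : 0 < fst w ->
  w = (RtoC (Cmod w) * (cos (atan (Im w / Re w)), sin (atan (Im w / Re w))))%C.
Proof.
  intros Hw. destruct w as [u v]. unfold Re, Im; simpl in *.
  assert (Hm := Cmod_pos_of_Re (u, v) Hw).
  assert (Hs := Cmod_sqr (u, v)). simpl in Hs. set (m := Cmod (u, v)) in *.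
  assert (Hq : sqrt (1 + (v / u)²) = m / u).
  { apply sqrt_lem_1.
    - generalize (Rle_0_sqr (v / u)). lra.
    - apply Rdiv_le_0_compat; lra.
    - unfold Rsqr. replace (m / u * (m / u)) with ((m * m) / (u * u)) by (field; lra).
      rewrite Hs. field. lra. }
  unfold Cmult, RtoC; simpl. rewrite cos_atan, sin_atan, Hq.
  f_equal; field; repeat split; lra.
Qed.

Lemma Cpower_plus (w : C) (a a' : R) : Cpower w (a + a') = (Cpower w a * Cpower w a')%C.
Proof.
  unfold Cpower. set (x := atan (Im w / Re w)).
  rewrite Rpower_plus, !Rmult_plus_distr_r, cos_plus, sin_plus.
  unfold Cmult, RtoC; simpl. f_equal; ring.
Qed.

Lemma Cpower_0 (w : C) : 0 < Cmod w -> Cpower w 0 = 1.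
Proof.
  intros Hw. unfold Cpower. rewrite Rmult_0_l, cos_0, sin_0, Rpower_O by exact Hw.
  unfold Cmult, RtoC; simpl. f_equal; ring.
Qed.

Lemma Cpower_1 (w : C) : 0 < fst w -> Cpower w 1 = w.
Proof.
  intros Hw. rewrite (C_polar_form w Hw) at 2. unfold Cpower.
  rewrite Rmult_1_l, Rpower_1; [reflexivity|]. apply Cmod_pos_of_Re, Hw.
Qed.

Lemma Cpower_Ropp (w : C) (a : R) : 0 < Cmod w -> Cpower w (- a) = (/ Cpower w a)%C.
Proof.
  intros Hw. assert (H := Cpower_plus w a (- a)).
  rewrite Rplus_opp_r, Cpower_0 in H by exact Hw.
  transitivity (/ Cpower w a * (Cpower w a * Cpower w (- a)))%C.
  - field. apply Cpower_neq_0.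
  - rewrite <- H. ring.
Qed.

Lemma Cpower_scal (c : R) (w : C) (a : R) : 0 < c -> 0 < Cmod w ->
  Cpower (RtoC c * w) a = (RtoC (Rpower c a) * Cpower w a)%C.
Proof.
  intros Hc Hw. unfold Cpower.
  rewrite Cmod_mult, Cmod_R, Rabs_pos_eq, <- Rpower_mult_distr, RtoC_mult by lra.
  assert (E : Im (RtoC c * w) / Re (RtoC c * w) = Im w / Re w).
  { destruct w as [u v]. unfold Im, Re, Cmult, RtoC; simpl.
    replace (c * v + 0 * u) with (c * v) by ring.
    replace (c * u - 0 * v) with (c * u) by ring.
    destruct (Req_dec u 0) as [->|Hu].
    - rewrite Rmult_0_r. unfold Rdiv. rewrite Rinv_0. ring.
    - field. lra. }
  rewrite E. ring.
Qed.

Lemma Cpower_RtoC (x a : R) : 0 < x -> Cpower (RtoC x) a = RtoC (Rpower x a).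
Proof.
  intros Hx. unfold Cpower, Im, Re, RtoC; simpl. fold (RtoC x).
  rewrite Cmod_R, Rabs_pos_eq by lra.
  unfold Rdiv. rewrite Rmult_0_l, atan_0, Rmult_0_r, cos_0, sin_0.
  unfold Cmult; simpl. f_equal; ring.
Qed.

Lemma ln_sqrt (x : R) : 0 < x -> ln (sqrt x) = ln x / 2.
Proof.
  intros Hx. assert (Hs := sqrt_lt_R0 x Hx).
  rewrite <- (sqrt_sqrt x) at 2 by lra. rewrite ln_mult by assumption. field.
Qed.

(** In polar form the power is [exp (a L) * (cos (a A), sin (a A))] with
    [L = ln |g|], [A = atan (Im g / Re g)], and [(L', A')] is the logarithmic derivative
    [m / g]. *)
Lemma rder_Cpower (g : R -> C) (t : R) (m : C) (a : R) :
  rder g t m -> 0 < fst (g t) ->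
  rder (fun s => Cpower (g s) a) t (RtoC a * Cpower (g t) a / g t * m).
Proof.
  intros [Hu Hv] Hpos.
  set (u := fun s => fst (g s)) in *. set (v := fun s => snd (g s)) in *.
  set (n := fun s => u s * u s + v s * v s).
  assert (Hn : 0 < n t) by (unfold n; assert (0 < u t) by exact Hpos; nra).
  set (L := fun s => ln (n s) / 2). set (A := fun s => atan (v s / u s)).
  assert (Hu0 : 0 < u t) by exact Hpos.
  assert (Eu : Derive u t = fst m) by (apply is_derive_unique; exact Hu).
  assert (Ev : Derive v t = snd m) by (apply is_derive_unique; exact Hv).
  assert (DL : is_derive L t ((u t * fst m + v t * snd m) / n t)).
  { unfold L, n. unfold n in Hn. auto_derive.
    - repeat split; try (eexists; eassumption). exact Hn.
    - rewrite <- Eu, <- Ev.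
      change (Derive (fun x => u x) t) with (Derive u t).
      change (Derive (fun x => v x) t) with (Derive v t). field. lra. }
  assert (DA : is_derive A t ((u t * snd m - v t * fst m) / n t)).
  { unfold A, n. unfold n in Hn. auto_derive.
    - repeat split; try (eexists; eassumption). lra.
    - rewrite <- Eu, <- Ev.
      change (Derive (fun x => u x) t) with (Derive u t).
      change (Derive (fun x => v x) t) with (Derive v t). field. split; [nra|lra]. }
  assert (EL : Derive L t = (u t * fst m + v t * snd m) / n t)
    by (apply is_derive_unique; exact DL).
  assert (EA : Derive A t = (u t * snd m - v t * fst m) / n t)
    by (apply is_derive_unique; exact DA).
  assert (EC : forall s, 0 < u s -> Cpower (g s) a =
    (exp (a * L s) * cos (a * A s), exp (a * L s) * sin (a * A s))).
  { intros s Hs. unfold Cpower, Rpower.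
    assert (Em : ln (Cmod (g s)) = L s).
    { unfold L, n, u, v, Cmod. rewrite <- ln_sqrt.
      - do 2 f_equal. ring.
      - unfold u in Hs. nra. }
    rewrite Em. change (Im (g s) / Re (g s)) with (v s / u s). fold (A s).
    unfold Cmult, RtoC; simpl. f_equal; ring. }
  assert (Hloc : locally t (fun s => 0 < u s)).
  { assert (Cu : continuous u t)
      by (apply (@ex_derive_continuous R_AbsRing R_NormedModule); eexists; exact Hu).
    apply (Cu (fun x => 0 < x)). apply open_gt. exact Hpos. }
  assert (Eg : (m / g t)%C = ((u t * fst m + v t * snd m) / n t, (u t * snd m - v t * fst m) / n t)).
  { unfold Cdiv, Cinv, Cmult. simpl. fold (u t) (v t). unfold n in *.
    f_equal; field; nra. }
  replace (RtoC a * Cpower (g t) a / g t * m)%C with (RtoC a * Cpower (g t) a * (m / g t))%C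
    by (unfold Cdiv; ring).
  rewrite Eg, EC by exact Hpos.
  split.
  - apply (is_derive_ext_loc (fun s => exp (a * L s) * cos (a * A s))).
    { revert Hloc. apply filter_imp. intros s Hs. rewrite EC by exact Hs. reflexivity. }
    auto_derive.
    + repeat split; eexists; eassumption.
    + change (Derive (fun x => L x) t) with (Derive L t).
      change (Derive (fun x => A x) t) with (Derive A t). rewrite EL, EA. simpl. ring.
  - apply (is_derive_ext_loc (fun s => exp (a * L s) * sin (a * A s))).
    { revert Hloc. apply filter_imp. intros s Hs. rewrite EC by exact Hs. reflexivity. }
    auto_derive.
    + repeat split; eexists; eassumption.
    + change (Derive (fun x => L x) t) with (Derive L t).
      change (Derive (fun x => A x) t) with (Derive A t). rewrite EL, EA. simpl. ring.
Qed.

Lemma continuous_Cpower {T : UniformSpace} (g : T -> C) (a : R) (x : T) :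
  continuous g x -> 0 < fst (g x) -> continuous (fun y => Cpower (g y) a) x.
Proof.
  intros Hg Hpos. assert (Hm := Cmod_pos_of_Re _ Hpos).
  assert (C1 := continuous_C_fst _ _ Hg). assert (C2 := continuous_C_snd _ _ Hg).
  assert (CA : continuous (fun y => a * atan (snd (g y) / fst (g y))) x).
  { apply continuous_R_mult; [apply continuous_const|].
    apply (continuous_comp (fun y => snd (g y) / fst (g y)) atan).
    - cont. lra.
    - apply (@ex_derive_continuous R_AbsRing R_NormedModule).
      auto_derive. exact I. }
  unfold Cpower, Re, Im. apply continuous_Cmult.
  - cont.
  - apply continuous_pair_C; cont.
Qed.

(** A function with a continuous candidate derivative along segments is
    complex-differentiable, by the mean value inequality. *)
Lemma cder_Cpower (w : C) (a : R) : 0 < fst w ->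
  cder (fun s => Cpower s a) w (RtoC a * Cpower w a / w).
Proof.
  intros Hw eps He. set (k := fun s : C => (RtoC a * Cpower s a / s)%C).
  assert (Ck : continuous k w).
  { unfold k. apply continuous_Cdiv.
    - apply continuous_Cmult; [apply continuous_const|].
      apply continuous_Cpower; [apply continuous_id | exact Hw].
    - apply continuous_id.
    - apply Cmod_gt_0, Cmod_pos_of_Re, Hw. }
  destruct (proj1 (continuous_C_ball k w) Ck eps He) as [d [Hd0 Hd]].
  exists (Rmin d (fst w)). split; [apply Rmin_glb_lt; assumption|]. intros s Hs.
  assert (H1 : Cmod (s - w) < d) by (eapply Rlt_le_trans; [exact Hs | apply Rmin_l]).
  assert (H2 : Cmod (s - w) < fst w) by (eapply Rlt_le_trans; [exact Hs | apply Rmin_r]).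
  set (g := fun t : R => (w + RtoC t * (s - w))%C).
  assert (Hg : forall t, 0 <= t <= 1 -> Cmod (g t - w) <= Cmod (s - w)).
  { intros t Ht. unfold g.
    replace (w + t * (s - w) - w)%C with (RtoC t * (s - w))%C by ring.
    rewrite Cmod_mult, Cmod_R, Rabs_pos_eq by lra. generalize (Cmod_ge_0 (s - w)). nra. }
  assert (Hre : forall t, 0 <= t <= 1 -> 0 < fst (g t)).
  { intros t Ht. assert (B := Rabs_fst_le_Cmod (g t - w)). assert (B2 := Hg t Ht).
    change (fst (g t - w)%C) with (fst (g t) - fst w) in B.
    assert (B3 := Rabs_maj2 (fst (g t) - fst w)). lra. }
  assert (M := path_mean_value (fun t => Cpower (g t) a) (fun t => k (g t) * (s - w))%C
    0 1 (eps * Cmod (s - w)) (k w * (s - w)) ltac:(lra)).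
  assert (E1 : g 1 = s) by (unfold g; ring).
  assert (E0 : g 0 = w) by (unfold g; ring).
  cbv beta in M. rewrite E1, E0 in M.
  replace (1 - 0) with 1 in M by ring. rewrite Rmult_1_r, Cmult_1_r in M.
  apply M.
  - intros t Ht. apply rder_Cpower; [|apply Hre, Ht].
    unfold rder, g; simpl. split; auto_derive; auto; ring.
  - intros t Ht. replace (k (g t) * (s - w) - k w * (s - w))%C
      with ((k (g t) - k w) * (s - w))%C by ring.
    rewrite Cmod_mult. apply Rmult_le_compat_r; [apply Cmod_ge_0|].
    left. apply Hd. eapply Rle_lt_trans; [apply Hg, Ht | exact H1].
Qed.

Lemma cdiff_Cpower (g : C -> C) (z : C) (a : R) :
  cdiff g z -> 0 < fst (g z) -> cdiff (fun s => Cpower (g s) a) z.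
Proof.
  intros Hg Hpos. apply (cdiff_comp (fun s => Cpower s a) g); [|exact Hg].
  eexists. apply cder_Cpower, Hpos.
Qed.

Lemma Re_one_sub_pos (s : C) : Cmod s < 1 -> 0 < fst (1 - s)%C.
Proof.
  intros Hs. assert (H := Rabs_fst_le_Cmod s). assert (H2 := Rle_abs (fst s)).
  simpl. lra.
Qed.

Lemma Cmod_mult_lt_1 (s z : C) : Cmod s <= 1 -> Cmod z < 1 -> Cmod (s * z) < 1.
Proof.
  intros Hs Hz. rewrite Cmod_mult. generalize (Cmod_ge_0 s) (Cmod_ge_0 z). nra.
Qed.

(** * Improper integrals dominated by a power of [1 - t] *)

Lemma Rpower_small (b e : R) : 0 < b -> 0 < e ->
  exists d, 0 < d <= 1 /\ forall x, 0 < x <= d -> Rpower x b <= e.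
Proof.
  intros Hb He. exists (Rmin 1 (Rpower e (/ b))). split.
  - split; [apply Rmin_glb_lt; [lra | apply Rpower_pos] | apply Rmin_l].
  - intros x [Hx1 Hx2].
    apply Rle_trans with (Rpower (Rpower e (/ b)) b).
    + apply Rle_Rpower_l; [lra|]. split; [exact Hx1|].
      eapply Rle_trans; [exact Hx2 | apply Rmin_r].
    + rewrite Rpower_mult, Rinv_l, Rpower_1 by lra. lra.
Qed.

(** Passage to the limit [T -> 1] in estimates whose error comes from truncating an
    improper integral at [T]. *)
Lemma le_of_power_tail (b E X Y : R) : 0 < b ->
  (forall T, 0 <= T < 1 -> X <= Y + E * Rpower (1 - T) b) -> X <= Y.
Proof.
  intros Hb H. apply le_epsilon. intros e He.
  destruct (Rpower_small b (e / (1 + Rabs E)) Hb) as [d [Hd Hd2]].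
  { apply Rdiv_lt_0_compat; [exact He|]. generalize (Rabs_pos E). lra. }
  assert (H1 := H (1 - d) ltac:(lra)).
  replace (1 - (1 - d)) with d in H1 by ring.
  specialize (Hd2 d ltac:(lra)).
  assert (PE := Rabs_pos E). assert (PR := Rpower_pos d b).
  assert (H2 : E * Rpower d b <= Rabs E * Rpower d b)
    by (apply Rmult_le_compat_r; [lra | apply Rle_abs]).
  assert (H3 : Rabs E * Rpower d b <= (1 + Rabs E) * (e / (1 + Rabs E)))
    by (apply Rmult_le_compat; lra).
  replace ((1 + Rabs E) * (e / (1 + Rabs E))) with e in H3 by (field; lra). lra.
Qed.

Lemma is_derive_one_sub_power (b t : R) : b <> 0 -> t < 1 ->
  is_derive (fun t => - / b * Rpower (1 - t) b) t (Rpower (1 - t) (b - 1)).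
Proof.
  intros Hb Ht.
  assert (E : Rpower (1 - t) (b - 1) = Rpower (1 - t) b * / (1 - t)).
  { unfold Rminus at 2. rewrite Rpower_plus, Rpower_Ropp, Rpower_1 by lra. reflexivity. }
  rewrite E. unfold Rpower. auto_derive; [lra|]. change (1 + - t) with (1 - t). field. split; lra.
Qed.

Lemma power_integral (b S T : R) : b <> 0 -> S <= T -> T < 1 ->
  RInt (fun t => Rpower (1 - t) (b - 1)) S T = / b * (Rpower (1 - S) b - Rpower (1 - T) b).
Proof.
  intros Hb HST HT.
  rewrite (RInt_FTC (fun t => - / b * Rpower (1 - t) b)); [R_equation; ring | exact HST | |].
  - intros t Ht. apply is_derive_one_sub_power; [exact Hb | lra].
  - intros t Ht. cont; lra.
Qed.

Section Improper.
Context (b K : R) (k : R -> C).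
Context (Hb : 0 < b) (Ck : forall t, 0 <= t < 1 -> continuous k t).
Context (Bk : forall t, 0 <= t < 1 -> Cmod (k t) <= K * Rpower (1 - t) (b - 1)).

Lemma improper_K_nonneg : 0 <= K.
Proof.
  assert (H := Bk 0 ltac:(lra)). assert (H0 := Cmod_ge_0 (k 0)).
  assert (P := Rpower_pos (1 - 0) (b - 1)).
  apply Rnot_lt_le. intros HK. nra.
Qed.

Lemma improper_tail (S T : R) : 0 <= S <= T -> T < 1 ->
  Cmod (CI k 0 T - CI k 0 S) <= K / b * Rpower (1 - S) b.
Proof.
  intros HST HT. assert (HK := improper_K_nonneg).
  rewrite (CI_Chasles k 0 S T) by (try lra; intros; apply Ck; lra).
  replace (CI k 0 S + CI k S T - CI k 0 S)%C with (CI k S T) by ring.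
  eapply Rle_trans; [apply CI_norm; [lra|]|].
  { intros; apply Ck; lra. }
  apply Rle_trans with (RInt (fun t => K * Rpower (1 - t) (b - 1)) S T).
  - apply RInt_le_cont; try lra.
    + intros t Ht. apply continuous_Cmod, Ck. lra.
    + intros t Ht. cont; lra.
    + intros t Ht. apply Bk. lra.
  - rewrite RInt_scal_cont, power_integral; try lra.
    + assert (P := Rpower_pos (1 - T) b).
      assert (0 <= K / b) by (apply Rdiv_le_0_compat; lra).
      replace (K * (/ b * (Rpower (1 - S) b - Rpower (1 - T) b)))
        with (K / b * (Rpower (1 - S) b - Rpower (1 - T) b)) by (unfold Rdiv; ring).
      apply Rmult_le_compat_l; lra.
    + intros t Ht. cont; lra.
Qed.

(** The domination is by an integrable power, hence the truncated integrals are Cauchy at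
    [1]; the explicit tail makes all later limits uniform. *)
Lemma improper_integral : exists l : C,
  @is_RInt_gen C_R_NormedModule k (at_point 0) (at_left 1) l /\
  forall T, 0 <= T < 1 -> Cmod (l - CI k 0 T) <= K / b * Rpower (1 - T) b.
Proof.
  assert (HK := improper_K_nonneg).
  assert (HKb : 0 <= K / b) by (apply Rdiv_le_0_compat; lra).
  assert (Hleft : forall d, 0 < d -> at_left 1 (fun T => 1 - d < T < 1)).
  { intros d Hd. exists (mkposreal d Hd). intros T HT HT1.
    change (Rabs (T - 1) < d) in HT. apply Rabs_def2 in HT. lra. }
  destruct (proj1 (filterlim_locally_cauchy (U := C_R_CompleteNormedModule) (F := at_left 1)
    (fun T => CI k 0 T))) as [l Hl].
  { intros eps. destruct (Rpower_small b (eps / (2 * (K / b + 1))) Hb) as [d [Hd Hd2]].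
    { apply Rdiv_lt_0_compat; [apply cond_pos | lra]. }
    exists (fun T => 1 - d < T < 1). split; [apply Hleft; lra|].
    assert (Main : forall u v, u <= v -> 1 - d < u < 1 -> 1 - d < v < 1 ->
      Cmod (CI k 0 v - CI k 0 u) < eps).
    { intros u v Huv Hu Hv. eapply Rle_lt_trans; [apply improper_tail; lra|].
      specialize (Hd2 (1 - u) ltac:(lra)). assert (Pe := cond_pos eps).
      assert (A := Rmult_le_compat_l (K / b) _ _ HKb Hd2).
      assert (E : (K / b + 1) * (eps / (2 * (K / b + 1))) = eps / 2) by (field; lra).
      assert (0 < eps / (2 * (K / b + 1))) by (apply Rdiv_lt_0_compat; lra). nra. }
    intros u v Hu Hv. apply C_NormedModule_mixin_compat1.
    change (Cmod (CI k 0 v - CI k 0 u) < eps).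
    destruct (Rle_dec u v); [apply Main; assumption|].
    rewrite Cmod_sub_comm. apply Main; auto; lra. }
  exists l. split.
  - intros P HP. specialize (Hl P HP). unfold filtermap in Hl.
    unfold filtermapi.
    apply (Filter_prod _ _ _ (fun x => x = 0)
      (fun T => P (CI k 0 T) /\ 0 < T < 1)); [reflexivity| |].
    + apply filter_and; [exact Hl|].
      generalize (Hleft 1 Rlt_0_1). apply filter_imp. intros T HT. lra.
    + intros x T -> [HPT HT]. exists (CI k 0 T). split; [|exact HPT].
      apply CI_is_RInt; simpl; [lra|]. intros t Ht. apply Ck. lra.
  - intros T HT. apply le_epsilon. intros e He.
    assert (Hl' := Hl _ (locally_ball l (mkposreal (e / 2) ltac:(lra)))).
    unfold filtermap in Hl'.
    assert (Hboth := filter_and _ _ Hl' (Hleft (1 - T) ltac:(lra))).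
    destruct (filter_ex _ Hboth) as [S [HS1 HS2]].
    destruct HS1 as [B1 B2].
    change (Rabs (fst (CI k 0 S) - fst l) < e / 2) in B1.
    change (Rabs (snd (CI k 0 S) - snd l) < e / 2) in B2.
    assert (B3 : Cmod (CI k 0 S - l) < e).
    { eapply Rle_lt_trans; [apply Cmod_le_abs_sum|].
      change (Rabs (fst (CI k 0 S) - fst l) + Rabs (snd (CI k 0 S) - snd l) < e). lra. }
    replace (l - CI k 0 T)%C with (- (CI k 0 S - l) + (CI k 0 S - CI k 0 T))%C by ring.
    eapply Rle_trans; [apply Cmod_triangle|]. rewrite Cmod_opp.
    assert (B4 := improper_tail T S ltac:(lra) ltac:(lra)). lra.
Qed.

Lemma improper_value (T : R) : 0 <= T < 1 ->
  Cmod (@RInt_gen C_R_CompleteNormedModule k (at_point 0) (at_left 1) - CI k 0 T)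
    <= K / b * Rpower (1 - T) b.
Proof.
  destruct improper_integral as [l [Hl Hb']].
  rewrite (is_RInt_gen_unique (V := C_R_CompleteNormedModule) k l Hl). apply Hb'.
Qed.

Lemma improper_converges :
  @ex_RInt_gen C_R_NormedModule k (at_point 0) (at_left 1).
Proof. destruct improper_integral as [l [Hl _]]. exists l. exact Hl. Qed.

End Improper.


(** * The integral kernel and its Taylor remainder *)

Definition power_kernel (a t : R) (z : C) : C := Cpower (1 - RtoC t * z) (- a).

Lemma Re_one_sub_mult_pos (t : R) (z : C) :
  0 <= t <= 1 -> Cmod z < 1 -> 0 < fst (1 - RtoC t * z)%C.
Proof.
  intros Ht Hz. apply Re_one_sub_pos, Cmod_mult_lt_1; [|exact Hz].
  rewrite Cmod_R, Rabs_pos_eq; lra.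
Qed.

Lemma power_kernel_bound (a t r : R) (z : C) :
  0 <= a -> 0 <= t <= 1 -> r < 1 -> Cmod z <= r ->
  Cmod (power_kernel a t z) <= Rpower (1 - r) (- a).
Proof.
  intros Ha Ht Hr Hz. unfold power_kernel. rewrite Cmod_Cpower, !Rpower_Ropp.
  apply Rinv_le_contravar; [apply Rpower_pos|].
  apply Rle_Rpower_l; [exact Ha|]. split; [lra|].
  assert (L := one_sub_lower t z ltac:(lra)). generalize (Cmod_ge_0 z). nra.
Qed.

Lemma rder_power_kernel (a t : R) (z d : C) (tau : R) :
  0 <= t <= 1 -> Cmod (z + RtoC tau * d) < 1 ->
  rder (fun s => power_kernel a t (z + RtoC s * d)) tau
    (RtoC (a * t) * power_kernel (a + 1) t (z + RtoC tau * d) * d).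
Proof.
  intros Ht Hz. unfold power_kernel.
  set (g := fun s : R => (1 - RtoC t * (z + RtoC s * d))%C).
  assert (Hpos : 0 < fst (g tau)) by (apply Re_one_sub_mult_pos; assumption).
  assert (Hg : rder g tau (- RtoC t * d)).
  { unfold rder, g; simpl. split; auto_derive; auto; ring. }
  assert (H := rder_Cpower g tau (- RtoC t * d) (- a) Hg Hpos).
  change (1 - t * (z + tau * d))%C with (g tau).
  replace (- (a + 1)) with (- a + - (1)) by ring.
  rewrite Cpower_plus, (Cpower_Ropp _ 1), Cpower_1
    by first [exact Hpos | apply Cmod_pos_of_Re, Hpos].
  replace (RtoC (a * t) * (Cpower (g tau) (- a) * / g tau) * d)%C
    with (RtoC (- a) * Cpower (g tau) (- a) / g tau * (- RtoC t * d))%C; [exact H|].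
  rewrite RtoC_mult, RtoC_opp. field. apply Cmod_gt_0, Cmod_pos_of_Re, Hpos.
Qed.

Lemma Cmod_segment (z d : C) (tau r : R) :
  0 <= tau <= 1 -> Cmod z <= r -> Cmod (z + d) <= r -> Cmod (z + RtoC tau * d) <= r.
Proof.
  intros Ht H1 H2.
  replace (z + tau * d)%C with (RtoC (1 - tau) * z + RtoC tau * (z + d))%C
    by (rewrite RtoC_minus; ring).
  eapply Rle_trans; [apply Cmod_triangle|].
  rewrite !Cmod_mult, !Cmod_R, !Rabs_pos_eq by lra. nra.
Qed.

Lemma power_kernel_lipschitz (a t r : R) (z d : C) :
  0 <= a -> 0 <= t <= 1 -> r < 1 -> Cmod z <= r -> Cmod (z + d) <= r ->
  Cmod (power_kernel a t (z + d) - power_kernel a t z)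
    <= a * Rpower (1 - r) (- (a + 1)) * Cmod d.
Proof.
  intros Ha Ht Hr H1 H2.
  assert (M := path_mean_value (fun s => power_kernel a t (z + RtoC s * d))
    (fun s => (RtoC (a * t) * power_kernel (a + 1) t (z + RtoC s * d) * d)%C)
    0 1 (a * Rpower (1 - r) (- (a + 1)) * Cmod d) 0 ltac:(lra)).
  cbv beta in M. rewrite Cmult_1_l, Cmult_0_l, Cplus_0_r in M.
  replace (power_kernel a t (z + d) - power_kernel a t z - 0 * (1 - 0)%R)%C
    with (power_kernel a t (z + d) - power_kernel a t z)%C in M by ring.
  rewrite Rminus_0_r, Rmult_1_r in M. apply M.
  - intros s Hs. apply rder_power_kernel; [exact Ht|].
    eapply Rle_lt_trans; [apply (Cmod_segment z d s r); assumption | exact Hr].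
  - intros s Hs.
    replace (RtoC (a * t) * power_kernel (a + 1) t (z + s * d) * d - 0)%C
      with (RtoC (a * t) * power_kernel (a + 1) t (z + s * d) * d)%C by ring.
    rewrite !Cmod_mult, Cmod_R, Rabs_pos_eq by nra.
    apply Rmult_le_compat_r; [apply Cmod_ge_0|].
    apply Rmult_le_compat; [nra | apply Cmod_ge_0 | nra |].
    apply power_kernel_bound; try lra. apply Cmod_segment; assumption.
Qed.

(** The mean value inequality along the segment from [z] to [z + d], applied to the
    kernel minus its linear part; uniform in [t]. *)
Lemma power_kernel_taylor (a t r : R) (z d : C) :
  0 <= a -> 0 <= t <= 1 -> r < 1 -> Cmod z <= r -> Cmod (z + d) <= r ->
  Cmod (power_kernel a t (z + d) - power_kernel a t z
        - RtoC (a * t) * power_kernel (a + 1) t z * d)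
    <= a * (a + 1) * Rpower (1 - r) (- (a + 2)) * Cmod d ^ 2.
Proof.
  intros Ha Ht Hr H1 H2. assert (Hd := Cmod_ge_0 d).
  assert (HR := Rpower_pos (1 - r) (- (a + 2))).
  assert (M := path_mean_value (fun s => power_kernel a t (z + RtoC s * d))
    (fun s => (RtoC (a * t) * power_kernel (a + 1) t (z + RtoC s * d) * d)%C)
    0 1 (a * (a + 1) * Rpower (1 - r) (- (a + 2)) * Cmod d ^ 2)
    (RtoC (a * t) * power_kernel (a + 1) t z * d) ltac:(lra)).
  cbv beta in M. rewrite Cmult_1_l, Cmult_0_l, Cplus_0_r, Rminus_0_r, Rmult_1_r, Cmult_1_r in M.
  apply M.
  - intros s Hs. apply rder_power_kernel; [exact Ht|].
    eapply Rle_lt_trans; [apply (Cmod_segment z d s r); assumption | exact Hr].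
  - intros s Hs.
    replace (RtoC (a * t) * power_kernel (a + 1) t (z + s * d) * d
             - RtoC (a * t) * power_kernel (a + 1) t z * d)%C
      with (RtoC (a * t) * (power_kernel (a + 1) t (z + s * d) - power_kernel (a + 1) t z) * d)%C
      by ring.
    rewrite !Cmod_mult, Cmod_R, Rabs_pos_eq by nra.
    assert (L := power_kernel_lipschitz (a + 1) t r z (RtoC s * d) ltac:(lra) Ht Hr H1
      (Cmod_segment z d s r Hs H1 H2)).
    replace (a + 1 + 1) with (a + 2) in L by ring.
    rewrite Cmod_mult, Cmod_R, Rabs_pos_eq in L by lra.
    set (R2 := Rpower (1 - r) (- (a + 2))) in *.
    set (X := Cmod (power_kernel (a + 1) t (z + s * d) - power_kernel (a + 1) t z)) in *.
    assert (L2 : X <= (a + 1) * R2 * Cmod d).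
    { eapply Rle_trans; [exact L|].
      apply Rmult_le_compat_l; [apply Rmult_le_pos; lra|]. nra. }
    replace (a * (a + 1) * R2 * Cmod d ^ 2) with (a * ((a + 1) * R2 * Cmod d) * Cmod d) by ring.
    apply Rmult_le_compat_r; [exact Hd|].
    apply Rmult_le_compat; [nra | apply Cmod_ge_0 | nra | exact L2].
Qed.

(** * The operator on functions with bounded means *)

Lemma Rpower_minus_1 (x b : R) : 0 < x -> Rpower x (b - 1) = Rpower x b / x.
Proof.
  intros Hx. unfold Rminus. rewrite Rpower_plus, Rpower_Ropp, Rpower_1 by exact Hx. reflexivity.
Qed.

Lemma Rpower_1_base (b : R) : Rpower 1 b = 1.
Proof. unfold Rpower. rewrite ln_1, Rmult_0_r, exp_0. reflexivity. Qed.

Section Operator.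
Context (b N : R) (f : C -> C) (Hb0 : 0 < b).
Context (Hf : forall s, Cmod s < 1 -> cdiff f s) (HN : bounded_means f N).

Lemma bounded_means_nonneg : 0 <= N.
Proof.
  assert (H := HN 0 ltac:(lra)). eapply Rle_trans; [|exact H].
  apply average_nonneg.
  - intros t. apply continuous_Cmod, continuous_on_circle, cdiff_continuous, Hf.
    rewrite Cmod_circle; lra.
  - intros; apply Cmod_ge_0.
Qed.

Lemma integrand_eq_kernel (z : C) (t : R) : 0 <= t < 1 -> Cmod z < 1 ->
  Hb_integrand b f z t = (f (RtoC t) * RtoC (Rpower (1 - t) b) * power_kernel (b + 1) t z)%C.
Proof.
  intros Ht Hz. unfold Hb_integrand, power_kernel.
  rewrite Cpower_Ropp by (apply Cmod_pos_of_Re, Re_one_sub_mult_pos; lra).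
  unfold Cdiv. ring.
Qed.

Lemma real_point_in_disk (t : R) : 0 <= t < 1 -> Cmod (RtoC t) < 1.
Proof. intros Ht. rewrite Cmod_R, Rabs_pos_eq; lra. Qed.

Lemma weight_bound (t : R) : 0 <= t < 1 ->
  Cmod (f (RtoC t) * RtoC (Rpower (1 - t) b)) <= 4 * N * Rpower (1 - t) (b - 1).
Proof.
  intros Ht. rewrite Cmod_mult, Cmod_R, Rabs_pos_eq by (left; apply Rpower_pos).
  assert (P := pointwise_bound f N (RtoC t) Hf HN (real_point_in_disk t Ht)).
  rewrite Cmod_R, Rabs_pos_eq in P by lra.
  rewrite Rpower_minus_1 by lra.
  replace (4 * N * (Rpower (1 - t) b / (1 - t))) with (4 * N / (1 - t) * Rpower (1 - t) b)
    by (field; lra).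
  apply Rmult_le_compat_r; [left; apply Rpower_pos | exact P].
Qed.

Lemma continuous_weight (t : R) : 0 <= t < 1 ->
  continuous (fun t => (f (RtoC t) * RtoC (Rpower (1 - t) b))%C) t.
Proof.
  intros Ht. apply continuous_Cmult.
  - apply (continuous_comp RtoC f); [apply (continuous_RtoC (fun t => t)), continuous_id|].
    apply cdiff_continuous, Hf, real_point_in_disk, Ht.
  - cont. lra.
Qed.

Lemma continuous_power_kernel (a t : R) (z : C) : 0 <= t <= 1 -> Cmod z < 1 ->
  continuous (fun t => power_kernel a t z) t.
Proof.
  intros Ht Hz. apply continuous_Cpower.
  - cont.
  - apply Re_one_sub_mult_pos; assumption.
Qed.

(** Every integral considered against the weight [f t * (1 - t)^b] is dominated
    by the integrable power [(1 - t)^(b-1)]. *)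
Lemma weighted_integrand (k : R -> C) (M : R) :
  (forall t, 0 <= t < 1 -> continuous k t) -> (forall t, 0 <= t < 1 -> Cmod (k t) <= M) ->
  (forall t, 0 <= t < 1 -> continuous (fun t => (f (RtoC t) * RtoC (Rpower (1 - t) b) * k t)%C) t)
  /\ (forall t, 0 <= t < 1 -> Cmod (f (RtoC t) * RtoC (Rpower (1 - t) b) * k t)
        <= 4 * N * M * Rpower (1 - t) (b - 1)).
Proof.
  intros Hk HM. split; intros t Ht.
  - apply continuous_Cmult; [apply continuous_weight | apply Hk]; exact Ht.
  - rewrite Cmod_mult.
    replace (4 * N * M * Rpower (1 - t) (b - 1)) with (4 * N * Rpower (1 - t) (b - 1) * M) by ring.
    apply Rmult_le_compat; try apply Cmod_ge_0; [apply weight_bound | apply HM]; exact Ht.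
Qed.

Definition tail_constant (r : R) : R := 4 * N * Rpower (1 - r) (- (b + 1)).

Lemma integrand_dominated (z : C) (r : R) : r < 1 -> Cmod z <= r ->
  (forall t, 0 <= t < 1 -> continuous (Hb_integrand b f z) t) /\
  (forall t, 0 <= t < 1 ->
     Cmod (Hb_integrand b f z t) <= tail_constant r * Rpower (1 - t) (b - 1)).
Proof.
  intros Hr Hz.
  destruct (weighted_integrand (fun t => power_kernel (b + 1) t z) (Rpower (1 - r) (- (b + 1))))
    as [H1 H2].
  - intros t Ht. apply continuous_power_kernel; lra.
  - intros t Ht. apply power_kernel_bound; lra.
  - split; intros t Ht.
    + unfold Hb_integrand. apply continuous_Cmult.
      * apply (continuous_comp RtoC f); [apply (continuous_RtoC (fun t => t)), continuous_id|].
        apply cdiff_continuous, Hf, real_point_in_disk, Ht.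
      * apply continuous_Cdiv.
        -- cont. lra.
        -- apply continuous_Cpower; [cont | apply Re_one_sub_mult_pos; lra].
        -- apply Cpower_neq_0.
    + rewrite integrand_eq_kernel by lra. apply H2, Ht.
Qed.

Lemma Hb_tail (z : C) (r T : R) : r < 1 -> Cmod z <= r -> 0 <= T < 1 ->
  Cmod (Hb b f z - CI (Hb_integrand b f z) 0 T) <= tail_constant r / b * Rpower (1 - T) b.
Proof.
  intros Hr Hz HT. destruct (integrand_dominated z r Hr Hz) as [H1 H2].
  apply (improper_value b (tail_constant r)); assumption.
Qed.

Lemma Hb_converges_bounded_means : Hb_converges b f.
Proof.
  intros z Hz. unfold disk in Hz.
  destruct (integrand_dominated z (Cmod z) Hz (Rle_refl _)) as [H1 H2].
  apply (improper_converges b (tail_constant (Cmod z))); assumption.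
Qed.

(** Differentiation under the integral sign: integrating the second order Taylor
    remainder of the kernel against the weight leaves an error of order [|w - z|^2]. *)
Lemma Hb_analytic (z : C) : Cmod z < 1 -> cdiff (Hb b f) z.
Proof.
  intros Hz. assert (HN0 := bounded_means_nonneg).
  (* a radius for which the bounds on the kernel are uniform near [z] *)
  set (r := (1 + Cmod z) / 2). assert (Hr : Cmod z < r < 1) by (unfold r; lra).
  set (kd := fun t => (RtoC ((b + 1) * t) * power_kernel (b + 1 + 1) t z)%C).
  set (Md := (b + 1) * Rpower (1 - r) (- (b + 1 + 1))).
  destruct (weighted_integrand kd Md) as [Cd Bd].
  { intros t Ht. unfold kd. apply continuous_Cmult; [cont|].
    apply continuous_power_kernel; lra. }
  { intros t Ht. unfold kd, Md. rewrite Cmod_mult, Cmod_R, Rabs_pos_eq by nra.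
    apply Rmult_le_compat; [nra | apply Cmod_ge_0 | nra |].
    apply power_kernel_bound; lra. }
  set (id := fun t => (f (RtoC t) * RtoC (Rpower (1 - t) b) * kd t)%C) in *.
  set (D := @RInt_gen C_R_CompleteNormedModule id (at_point 0) (at_left 1)).
  assert (TD : forall T, 0 <= T < 1 ->
    Cmod (D - CI id 0 T) <= 4 * N * Md / b * Rpower (1 - T) b).
  { intros T HT. apply (improper_value b (4 * N * Md)); assumption. }
  set (M := (b + 1) * (b + 1 + 1) * Rpower (1 - r) (- (b + 1 + 2))).
  assert (HM : 0 < M).
  { unfold M. apply Rmult_lt_0_compat; [nra | apply Rpower_pos]. }
  assert (Main : forall w, Cmod (w - z) < r - Cmod z ->
    Cmod (Hb b f w - Hb b f z - D * (w - z)) <= 4 * N * M / b * Cmod (w - z) ^ 2).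
  { intros w Hw. set (d := (w - z)%C). assert (Ed : w = (z + d)%C) by (unfold d; ring).
    assert (Hwr : Cmod w <= r).
    { rewrite Ed. eapply Rle_trans; [apply Cmod_triangle|]. unfold d in *. lra. }
    set (krem := fun t => (power_kernel (b + 1) t w - power_kernel (b + 1) t z
      - RtoC ((b + 1) * t) * power_kernel (b + 1 + 1) t z * d)%C).
    destruct (weighted_integrand krem (M * Cmod d ^ 2)) as [Cr Br].
    { intros t Ht. unfold krem.
      assert (A1 := fun a u => continuous_power_kernel a t u ltac:(lra)).
      apply continuous_Cminus; [apply continuous_Cminus; apply A1; lra|].
      apply continuous_Cmult; [|apply continuous_const].
      apply continuous_Cmult; [cont | apply A1; lra]. }
    { intros t Ht. unfold krem, M. rewrite Ed.
      apply power_kernel_taylor; try lra. rewrite <- Ed. exact Hwr. }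
    apply (le_of_power_tail b
      (tail_constant r / b + tail_constant r / b + 4 * N * Md / b * Cmod d)); [exact Hb0|].
    intros T HT.
    assert (B1 := Hb_tail w r T ltac:(lra) Hwr HT).
    assert (B2 := Hb_tail z r T ltac:(lra) ltac:(lra) HT).
    assert (B3 := TD T HT).
    destruct (integrand_dominated w r ltac:(lra) Hwr) as [Cw _].
    destruct (integrand_dominated z r ltac:(lra) ltac:(lra)) as [Cz _].
    assert (E : (CI (Hb_integrand b f w) 0 T - CI (Hb_integrand b f z) 0 T - d * CI id 0 T)%C =
      (CI (fun t => f (RtoC t) * RtoC (Rpower (1 - t) b) * krem t) 0 T
       - CI (fun t => f (RtoC t) * RtoC (Rpower (1 - t) b) * krem t) 0 0)%C).
    { set (J := fun t => (f (RtoC t) * RtoC (Rpower (1 - t) b) * krem t)%C).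
      set (iw := Hb_integrand b f w) in *. set (iz := Hb_integrand b f z) in *.
      assert (E0 : CI J 0 0 = 0) by (unfold CI; rewrite !RInt_point; reflexivity).
      assert (C1 : forall t, 0 <= t <= T -> continuous iw t) by (intros t Ht; apply Cw; lra).
      assert (C2 : forall t, 0 <= t <= T -> continuous iz t) by (intros t Ht; apply Cz; lra).
      assert (C3 : forall t, 0 <= t <= T -> continuous id t) by (intros t Ht; apply Cd; lra).
      rewrite E0.
      transitivity (CI J 0 T); [|ring].
      rewrite <- (CI_scal 0 T ltac:(lra) d id C3).
      rewrite <- (CI_minus 0 T ltac:(lra) iw iz C1 C2).
      rewrite <- (CI_minus 0 T ltac:(lra) (fun t => (iw t - iz t)%C) (fun t => (d * id t)%C)).
      - apply CI_ext; [lra|]. intros t Ht.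
        unfold iw, iz. rewrite !integrand_eq_kernel by lra. unfold id, kd, J, krem. ring.
      - intros t Ht. apply continuous_Cminus; [apply C1 | apply C2]; exact Ht.
      - intros t Ht. apply continuous_Cmult; [apply continuous_const | apply C3, Ht]. }
    assert (B4 : Cmod (CI (Hb_integrand b f w) 0 T - CI (Hb_integrand b f z) 0 T - d * CI id 0 T)
      <= 4 * N * (M * Cmod d ^ 2) / b * Rpower (1 - 0) b).
    { rewrite E. apply (improper_tail b _ _ Hb0 Cr Br 0 T); lra. }
    rewrite Rminus_0_r, Rpower_1_base, Rmult_1_r in B4.
    replace (Hb b f w - Hb b f z - D * d)%C with
      ((CI (Hb_integrand b f w) 0 T - CI (Hb_integrand b f z) 0 T - d * CI id 0 T)
       + ((Hb b f w - CI (Hb_integrand b f w) 0 T)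
          - (Hb b f z - CI (Hb_integrand b f z) 0 T) - (D - CI id 0 T) * d))%C by ring.
    eapply Rle_trans; [apply Cmod_triangle|].
    replace (4 * N * M / b * Cmod d ^ 2) with (4 * N * (M * Cmod d ^ 2) / b) by (field; lra).
    apply Rplus_le_compat; [exact B4|].
    eapply Rle_trans; [apply Cmod_triangle_sub|].
    eapply Rle_trans; [apply Rplus_le_compat_r, Cmod_triangle_sub|].
    rewrite (Cmod_mult _ d).
    assert (B5 := Rmult_le_compat_r (Cmod d) _ _ (Cmod_ge_0 d) B3). lra. }
  exists D. intros eps He.
  set (K := 4 * N * M / b + 1).
  assert (HK : 0 < K).
  { unfold K. assert (0 <= 4 * N * M / b) by (apply Rdiv_le_0_compat; [nra | lra]). lra. }
  exists (Rmin (r - Cmod z) (eps / K)). split.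
  { apply Rmin_glb_lt; [lra | apply Rdiv_lt_0_compat; lra]. }
  intros w Hw.
  assert (H1 : Cmod (w - z) < r - Cmod z) by (eapply Rlt_le_trans; [exact Hw | apply Rmin_l]).
  assert (H2 : Cmod (w - z) < eps / K) by (eapply Rlt_le_trans; [exact Hw | apply Rmin_r]).
  eapply Rle_trans; [apply Main, H1|]. assert (H3 := Cmod_ge_0 (w - z)).
  apply Rmult_lt_compat_l with (r := K) in H2; [|exact HK].
  replace (K * (eps / K)) with eps in H2 by (field; lra).
  replace (4 * N * M / b) with (K - 1) by (unfold K; ring). nra.
Qed.

(** * Moving the path of integration *)

(** What the integrand becomes on the path [phi t z] in place of the real segment. *)
Definition shifted_integrand (z : C) (t : R) : C :=
  (RtoC (Rpower (1 - t) b) * (f (phi t z) / (1 - RtoC (1 - t) * z)))%C.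

Section Shift.
Context (r : R) (z : C) (Hr : 0 <= r < 1) (Hz : Cmod z <= r).

Let h (s : C) : C := (f s * (Cpower (1 - s) b / Cpower (1 - s * z) (b + 1)))%C.
Let dphi (t : R) : C := ((1 - z) / ((1 - RtoC (1 - t) * z) * (1 - RtoC (1 - t) * z)))%C.

Lemma denominator_lower (t : R) : 0 <= t <= 1 -> 1 - r <= Cmod (1 - RtoC (1 - t) * z).
Proof.
  intros Ht. assert (L := one_sub_lower (1 - t) z ltac:(lra)).
  generalize (Cmod_ge_0 z). nra.
Qed.

Lemma denominator_neq_0 (t : R) : 0 <= t <= 1 -> (1 - RtoC (1 - t) * z)%C <> 0.
Proof. intros Ht. apply Cmod_gt_0. generalize (denominator_lower t Ht). lra. Qed.

Lemma rder_phi (t : R) : 0 <= t <= 1 -> rder (fun t => phi t z) t (dphi t).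
Proof.
  intros Ht. assert (Nd := denominator_neq_0 t Ht).
  set (den := fun s : C => (1 - (1 - s) * z)%C).
  assert (Eden : forall t, den (RtoC t) = (1 - RtoC (1 - t) * z)%C)
    by (intros u; unfold den; rewrite RtoC_minus; reflexivity).
  assert (Dden : cder den (RtoC t) z).
  { apply (cder_ext (fun s => ((1 - z) + z * s)%C)); [intros s; unfold den; ring|].
    assert (Dl := cder_plus (fun _ => (1 - z)%C) (fun s => (z * s)%C) (RtoC t) _ _
      (cder_const _ _) (cder_mult (fun _ => z) (fun s => s) (RtoC t) _ _ (cder_const _ _) (cder_id _))).
    cbv beta in Dl. replace (0 + (0 * RtoC t + z * 1))%C with z in Dl by ring. exact Dl. }
  assert (D1 : cder (fun s => (/ den s)%C) (RtoC t) (- / (den (RtoC t) * den (RtoC t)) * z)).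
  { apply (cder_comp Cinv den); [|exact Dden]. apply cder_inv. rewrite Eden. exact Nd. }
  assert (D2 := cder_mult (fun s => s) (fun s => (/ den s)%C) (RtoC t) _ _ (cder_id _) D1).
  apply rder_real in D2. cbv beta in D2.
  replace (dphi t) with
    (1 * / den (RtoC t) + RtoC t * (- / (den (RtoC t) * den (RtoC t)) * z))%C.
  - destruct D2 as [D21 D22]. split.
    + revert D21. apply is_derive_ext. intros u. unfold phi. rewrite Eden. reflexivity.
    + revert D22. apply is_derive_ext. intros u. unfold phi. rewrite Eden. reflexivity.
  - unfold dphi. rewrite Eden. rewrite RtoC_minus in Nd |- *. field. exact Nd.
Qed.

Lemma continuous_dphi (t : R) : 0 <= t <= 1 -> continuous dphi t.
Proof.
  intros Ht. assert (Nd := denominator_neq_0 t Ht). unfold dphi. cont.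
  apply Cmult_neq_0; exact Nd.
Qed.

Lemma segment_in_disk (t l : R) : 0 <= t < 1 -> 0 <= l <= 1 ->
  (1 - t) * (1 - r) <= 1 - Cmod (RtoC t + RtoC l * (phi t z - RtoC t)).
Proof.
  intros Ht Hl. assert (H := phi_modulus_lt_1 t r z Ht Hr Hz).
  assert (S := Cmod_segment (RtoC t) (phi t z - RtoC t) l (1 - (1 - t) * (1 - r)) Hl).
  rewrite Cmod_R, Rabs_pos_eq in S by lra.
  replace (t + (phi t z - t))%C with (phi t z) in S by ring.
  assert (S' := S ltac:(nra) ltac:(lra)). lra.
Qed.

Lemma cdiff_shift_integrand (s : C) : Cmod s < 1 -> cdiff h s.
Proof.
  intros Hs. apply cdiff_mult; [apply Hf, Hs|]. apply cdiff_div.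
  - apply (cdiff_Cpower (fun s => (1 - s)%C)); [|apply Re_one_sub_pos, Hs].
    apply cdiff_minus; [apply cdiff_const | apply cdiff_id].
  - apply (cdiff_Cpower (fun s => (1 - s * z)%C)).
    + apply cdiff_minus; [apply cdiff_const|].
      apply cdiff_mult; [apply cdiff_id | apply cdiff_const].
    + apply Re_one_sub_pos, Cmod_mult_lt_1; lra.
  - apply Cpower_neq_0.
Qed.

(** On the curved path [1 - s = (1 - t) * (1 - s * z)], so the two powers
    combine into the power [(1 - t)^b] of a real number. *)
Lemma pullback_integrand (t : R) : 0 <= t < 1 ->
  (h (phi t z) * dphi t)%C = shifted_integrand z t.
Proof.
  intros Ht. assert (Nd := denominator_neq_0 t ltac:(lra)).
  assert (Hphi := phi_modulus_lt_1 t r z Ht Hr Hz).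
  assert (Hp1 : Cmod (phi t z) < 1) by (assert (0 < (1 - t) * (1 - r)) by nra; lra).
  set (u := (1 - phi t z * z)%C).
  assert (Hu : 0 < fst u) by (apply Re_one_sub_pos, Cmod_mult_lt_1; lra).
  assert (Nu : u <> 0) by (apply Cmod_gt_0, Cmod_pos_of_Re, Hu).
  assert (Eu : u = ((1 - z) / (1 - RtoC (1 - t) * z))%C).
  { unfold u, phi. rewrite RtoC_minus in Nd |- *. field. exact Nd. }
  assert (E1 : (1 - phi t z)%C = (RtoC (1 - t) * u)%C).
  { rewrite Eu. unfold phi. rewrite RtoC_minus in Nd |- *. field. exact Nd. }
  unfold h, shifted_integrand. fold u. rewrite E1.
  rewrite Cpower_scal by (lra || apply Cmod_pos_of_Re, Hu).
  rewrite Cpower_plus, Cpower_1 by exact Hu.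
  assert (Ed : dphi t = (u / (1 - RtoC (1 - t) * z))%C).
  { rewrite Eu. unfold dphi. field. exact Nd. }
  rewrite Ed. field. repeat split; auto. apply Cpower_neq_0.
Qed.

Definition shift_constant : R :=
  4 * N / (1 - r) * (Rpower (2 / (1 - r)) b * Rpower (1 - r) (- (b + 1))) * (1 / (1 - r)).

(** [f] grows at most like [1 / (1 - t)] on the segment from [t] to [phi t z], whose length
    is of order [1 - t], and [(1 - s)^b] is of order [(1 - t)^b] there. *)
Lemma closing_segment_bound (t l : R) : 0 <= t < 1 -> 0 <= l <= 1 ->
  Cmod (h (RtoC t + RtoC l * (phi t z - RtoC t)) * (phi t z - RtoC t))
    <= shift_constant * Rpower (1 - t) b.
Proof.
  intros Ht Hl. assert (HN0 := bounded_means_nonneg).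
  assert (Nd := denominator_neq_0 t ltac:(lra)).
  assert (Ld := denominator_lower t ltac:(lra)).
  assert (Hs := segment_in_disk t l Ht Hl).
  set (s := (RtoC t + RtoC l * (phi t z - RtoC t))%C) in *.
  assert (P0 : 0 < (1 - t) * (1 - r)) by nra.
  assert (Hs1 : Cmod s < 1) by lra.
  assert (Hz1 := Cmod_ge_0 z).
  set (q := Cmod (1 - RtoC (1 - t) * z)) in *.
  assert (Ediff : Cmod (phi t z - RtoC t) <= (1 - t) / (1 - r)).
  { replace (phi t z - t)%C with (RtoC (t * (1 - t)) * z / (1 - RtoC (1 - t) * z))%C.
    - rewrite Cmod_div, Cmod_mult, Cmod_R, Rabs_pos_eq by (auto; nra). fold q.
      assert (Q : 0 <= t * (1 - t) <= 1 - t) by nra.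
      apply Rmult_le_compat.
      + apply Rmult_le_pos; lra.
      + left; apply Rinv_0_lt_compat; lra.
      + rewrite <- (Rmult_1_r (1 - t)) at 2. apply Rmult_le_compat; lra.
      + apply Rinv_le_contravar; lra.
    - unfold phi. rewrite RtoC_mult. rewrite RtoC_minus in Nd |- *. field. exact Nd. }
  assert (E1 : Cmod (1 - s) <= (1 - t) * (2 / (1 - r))).
  { replace (1 - s)%C with ((1 - RtoC t) + - (RtoC l * (phi t z - RtoC t)))%C
      by (unfold s; ring).
    eapply Rle_trans; [apply Cmod_triangle|].
    rewrite Cmod_opp, Cmod_mult, <- RtoC_minus, !Cmod_R, !Rabs_pos_eq by lra.
    assert (Hd := Cmod_ge_0 (phi t z - RtoC t)).
    assert (G1 : 1 - t <= (1 - t) / (1 - r)) by (apply le_div_of_mul_le; nra).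
    replace ((1 - t) * (2 / (1 - r))) with ((1 - t) / (1 - r) + (1 - t) / (1 - r)) by (field; lra).
    apply Rplus_le_compat; [exact G1|]. nra. }
  assert (Hs0 : 0 < Cmod (1 - s)) by (apply Cmod_pos_of_Re, Re_one_sub_pos, Hs1).
  assert (F1 : Cmod (f s) <= 4 * N / ((1 - t) * (1 - r))).
  { eapply Rle_trans; [apply (pointwise_bound f N s Hf HN Hs1)|].
    apply Rmult_le_compat_l; [lra|]. apply Rinv_le_contravar; lra. }
  assert (F2 : Rpower (Cmod (1 - s)) b <= Rpower (1 - t) b * Rpower (2 / (1 - r)) b).
  { rewrite Rpower_mult_distr; [|lra|apply Rdiv_lt_0_compat; lra].
    apply Rle_Rpower_l; lra. }
  assert (F3 : / Rpower (Cmod (1 - s * z)) (b + 1) <= Rpower (1 - r) (- (b + 1))).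
  { rewrite Rpower_Ropp. apply Rinv_le_contravar; [apply Rpower_pos|].
    apply Rle_Rpower_l; [lra|]. split; [lra|].
    assert (T := Cmod_triangle_rev 1 (s * z)). rewrite Cmod_1, Cmod_mult in T.
    generalize (Cmod_ge_0 s). nra. }
  unfold h. rewrite !Cmod_mult, Cmod_div, !Cmod_Cpower by apply Cpower_neq_0.
  unfold shift_constant.
  assert (R1 := Rpower_pos (Cmod (1 - s)) b).
  assert (R2 := Rpower_pos (Cmod (1 - s * z)) (b + 1)).
  assert (R3 := Rpower_pos (1 - t) b).
  replace (4 * N / (1 - r) * (Rpower (2 / (1 - r)) b * Rpower (1 - r) (- (b + 1))) *
    (1 / (1 - r)) * Rpower (1 - t) b)
    with (4 * N / ((1 - t) * (1 - r)) *
      ((Rpower (1 - t) b * Rpower (2 / (1 - r)) b) * Rpower (1 - r) (- (b + 1))) *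
      ((1 - t) / (1 - r))) by (field; lra).
  apply Rmult_le_compat; [|apply Cmod_ge_0| |exact Ediff].
  - apply Rmult_le_pos; [apply Cmod_ge_0|]. left. apply Rdiv_lt_0_compat; assumption.
  - apply Rmult_le_compat; [apply Cmod_ge_0| |exact F1|].
    + left. apply Rdiv_lt_0_compat; assumption.
    + apply Rmult_le_compat; [lra| |exact F2|exact F3].
      left. apply Rinv_0_lt_compat, R2.
Qed.

(** Goursat's theorem on the homotopy [t + l * (phi t z - t)] from the real
    segment to the curved path: up to [t = T] the two integrals differ by the
    integral over the segment closing the contour. *)
Lemma contour_shift (T : R) : 0 <= T < 1 ->
  Cmod (CI (Hb_integrand b f z) 0 T - CI (shifted_integrand z) 0 T)
    <= shift_constant * Rpower (1 - T) b.
Proof.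
  intros HT.
  assert (Hin : forall t l, 0 <= t <= T -> 0 <= l <= 1 ->
    Cmod (RtoC t + RtoC l * (phi t z - RtoC t)) < 1).
  { intros t l Ht Hl. assert (S := segment_in_disk t l ltac:(lra) Hl).
    assert (0 < (1 - t) * (1 - r)) by nra. lra. }
  assert (Hdphi : forall t, 0 <= t <= T -> Cmod (dphi t) <= 2 / (1 - r) / (1 - r)).
  { intros t Ht. assert (Nd := denominator_neq_0 t ltac:(lra)).
    assert (Ld := denominator_lower t ltac:(lra)). unfold dphi.
    rewrite Cmod_div, Cmod_mult by (apply Cmult_neq_0; exact Nd).
    set (q := Cmod (1 - RtoC (1 - t) * z)) in *.
    replace (2 / (1 - r) / (1 - r)) with (2 * / ((1 - r) * (1 - r))) by (field; lra).
    apply Rmult_le_compat; [apply Cmod_ge_0 | left; apply Rinv_0_lt_compat; nra | |].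
    - eapply Rle_trans; [apply Cmod_triangle_sub|]. rewrite Cmod_1. lra.
    - apply Rinv_le_contravar; [|apply Rmult_le_compat]; nra. }
  assert (H0 : 0 <= 2 / (1 - r) / (1 - r)) by (repeat apply Rdiv_le_0_compat; lra).
  assert (Hph : forall t, 0 <= t <= T -> Cmod (phi t z - RtoC t) <= 2).
  { intros t Ht. assert (P := phi_modulus_lt_1 t r z ltac:(lra) Hr Hz).
    assert (0 < (1 - t) * (1 - r)) by nra.
    eapply Rle_trans; [apply Cmod_triangle_sub|]. rewrite Cmod_R, Rabs_pos_eq; lra. }
  assert (G := goursat h (fun t l => (RtoC t + RtoC l * (phi t z - RtoC t))%C)
    (fun t l => (1 + RtoC l * (dphi t - 1))%C) (fun t l => (phi t z - RtoC t)%C)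
    0 T 0 1 (2 / (1 - r) / (1 - r) + 2)).
  cbv beta in G.
  rewrite (CI_ext 0 T ltac:(lra) (fun x => h (x + 0 * (phi x z - x)) * (1 + 0 * (dphi x - 1)))%C
    (Hb_integrand b f z)) in G.
  2: { intros t Ht. replace (t + 0 * (phi t z - t))%C with (RtoC t) by ring.
       replace (1 + 0 * (dphi t - 1))%C with (RtoC 1) by ring. rewrite Cmult_1_r.
       unfold h, Hb_integrand. rewrite <- RtoC_minus, Cpower_RtoC by lra. reflexivity. }
  rewrite (CI_ext 0 T ltac:(lra) (fun x => h (x + 1 * (phi x z - x)) * (1 + 1 * (dphi x - 1)))%C
    (shifted_integrand z)) in G.
  2: { intros t Ht. rewrite <- pullback_integrand by lra.
       replace (t + 1 * (phi t z - t))%C with (phi t z) by ring.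
       replace (1 + 1 * (dphi t - 1))%C with (dphi t) by ring. reflexivity. }
  rewrite (CI_ext 0 1 ltac:(lra) (fun y => h (0 + y * (phi 0 z - 0)) * (phi 0 z - 0))%C
    (fun _ => RtoC 0)) in G.
  2: { intros l _. unfold phi, Cdiv. rewrite Cmult_0_l. ring. }
  rewrite CI_const, Cmult_0_l in G.
  set (S := CI (fun y => (h (T + y * (phi T z - T)) * (phi T z - T))%C) 0 1) in *.
  assert (E : (CI (Hb_integrand b f z) 0 T - CI (shifted_integrand z) 0 T)%C = (- S)%C).
  { apply Ceq_minus. rewrite <- G; try lra.
    - ring.
    - intros t l Ht Hl. split; [|split].
      + apply cdiff_shift_integrand, Hin; assumption.
      + destruct (rder_phi t ltac:(lra)) as [D1 D2].
        split; simpl.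
        * apply (is_derive_ext (fun u => u + l * (fst (phi u z) - u))).
          { intros u. simpl. R_equation. ring. }
          evar_last.
          { apply @is_derive_plus; [apply @is_derive_id|].
            apply is_derive_scal. apply @is_derive_minus; [exact D1 | apply @is_derive_id]. }
          unfold minus, plus, opp, one; simpl. R_equation. ring.
        * apply (is_derive_ext (fun u => l * snd (phi u z))).
          { intros u. simpl. R_equation. ring. }
          evar_last.
          { apply is_derive_scal. exact D2. }
          simpl. R_equation. ring.
      + unfold rder; simpl. split; auto_derive; auto; ring.
    - intros t l Ht Hl. split; [|apply continuous_const].
      assert (Cd := continuous_dphi t ltac:(lra)). cont.
    - intros t l Ht Hl. split.
      + eapply Rle_trans; [apply Cmod_triangle|].
        rewrite Cmod_1, Cmod_mult, Cmod_R, Rabs_pos_eq by lra.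
        assert (A := Cmod_triangle_sub (dphi t) 1). rewrite Cmod_1 in A.
        assert (A2 := Hdphi t Ht). generalize (Cmod_ge_0 (dphi t - 1)). nra.
      + assert (A := Hph t Ht). lra. }
  rewrite E, Cmod_opp.
  replace (shift_constant * Rpower (1 - T) b) with (shift_constant * Rpower (1 - T) b * (1 - 0))
    by ring.
  apply CI_norm_const; [lra| |].
  - intros l Hl. apply continuous_Cmult; [|apply continuous_const].
    apply (continuous_comp (fun l => (RtoC T + RtoC l * (phi T z - RtoC T))%C) h).
    + cont.
    + apply cdiff_continuous, cdiff_shift_integrand, Hin; lra.
  - intros l Hl. apply closing_segment_bound; lra.
Qed.

End Shift.

(** Minkowski's inequality on the curved paths: by [contraction] the mean of the shifted
    integrand is at most [N * (1 - t)^(b-1)], whose integral is [N / b]. *)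
Theorem Hb_mean_bound (r : R) : f 0 = 0 -> 0 <= r < 1 ->
  average (fun th => Cmod (Hb b f (circle r th))) <= N / b.
Proof.
  intros Hf0 Hr. assert (HP := PI_RGT_0). assert (HN0 := bounded_means_nonneg).
  assert (Hc : forall x, Cmod (circle r x) <= r) by (intros; rewrite Cmod_circle; lra).
  assert (CH : forall x, continuous (fun x => Cmod (Hb b f (circle r x))) x).
  { intros x. apply continuous_Cmod, continuous_on_circle, cdiff_continuous, Hb_analytic.
    rewrite Cmod_circle; lra. }
  apply (le_of_power_tail b (tail_constant r / b + shift_constant r)); [exact Hb0|].
  intros T HT.
  set (K := fun x t => Cmod (shifted_integrand (circle r x) t)).
  (* a neighbourhood of [0, T], since a parameter integral is continuous in the
     interior of the parameter range only *)
  assert (Cs : forall x t, - (1 - r) / 2 < t < 1 ->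
    continuous (fun p : R * R => shifted_integrand (circle r (fst p)) (snd p)) (x, t)).
  { intros x t Ht.
    assert (Hd : Rabs t < 1 - (1 - t) * r).
    { apply Rabs_def1; nra. }
    assert (Hd0 := Rabs_pos t).
    assert (Ld := one_sub_lower (1 - t) (circle r x) ltac:(lra)).
    rewrite Cmod_circle in Ld by lra.
    assert (Nd : (1 - RtoC (1 - t) * circle r x)%C <> 0) by (apply Cmod_gt_0; lra).
    unfold shifted_integrand. cont; simpl; try lra.
    apply (continuous_comp (fun p : R * R => phi (snd p) (circle r (fst p))) f).
    - unfold phi. cont.
    - apply cdiff_continuous, Hf. simpl. unfold phi.
      rewrite Cmod_div, Cmod_R by exact Nd. apply div_lt_of_lt_mul; lra. }
  assert (CK : forall x t, - (1 - r) / 2 < t < 1 ->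
    continuous (fun p : R * R => K (fst p) (snd p)) (x, t)).
  { intros x t Ht. apply continuous_Cmod, Cs, Ht. }
  assert (Hr2 : 0 < (1 - r) / 2) by lra.
  assert (CKI : forall x, continuous (fun x => RInt (fun t => K x t) 0 T) x).
  { intros x. apply continuous_RInt_param_snd; [lra| |].
    - intros t Ht. apply CK. lra.
    - apply filter_forall. intros y t Ht. apply continuous_slice_2, CK; lra. }
  set (E := (tail_constant r / b + shift_constant r) * Rpower (1 - T) b).
  apply Rle_trans with (average (fun x => RInt (fun t => K x t) 0 T + E)).
  - apply average_le; [exact CH| |].
    + intros x. apply continuous_R_plus; [apply CKI | apply continuous_const].
    + intros x. set (z := circle r x).
      assert (A1 := Hb_tail z r T ltac:(lra) (Hc x) HT).
      assert (A2 := contour_shift r z Hr (Hc x) T HT).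
      assert (A3 := CI_norm 0 T ltac:(lra) (shifted_integrand z)).
      replace (Hb b f z) with (CI (shifted_integrand z) 0 T
        + ((CI (Hb_integrand b f z) 0 T - CI (shifted_integrand z) 0 T)
           + (Hb b f z - CI (Hb_integrand b f z) 0 T)))%C by ring.
      eapply Rle_trans; [apply Cmod_triangle|]. apply Rplus_le_compat.
      * apply A3. intros t Ht. apply (continuous_slice_2 (fun x t => shifted_integrand (circle r x) t)).
        apply Cs; lra.
      * eapply Rle_trans; [apply Cmod_triangle|]. unfold E. lra.
  - rewrite average_plus, average_const by (auto; intros; apply continuous_const).
    apply Rplus_le_compat_r. unfold average.
    rewrite (RInt_swap K 0 (2 * PI) 0 T) by (try lra; intros; apply CK; lra).
    assert (CI2 : forall t, 0 <= t <= T -> continuous (fun t => RInt (fun x => K x t) 0 (2 * PI)) t).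
    { intros t Ht. apply continuous_RInt_param; [lra| |].
      - intros; apply CK; lra.
      - assert (Hloc : locally t (fun t => - (1 - r) / 2 < t < 1)).
        { apply filter_and; [apply open_gt; lra | apply open_lt; lra]. }
        revert Hloc. apply filter_imp. intros u Hu x _. apply continuous_slice_1, CK, Hu. }
    rewrite <- RInt_scal_cont by (auto; lra).
    apply Rle_trans with (RInt (fun t => N * Rpower (1 - t) (b - 1)) 0 T).
    + apply RInt_le_cont; [lra| | |].
      * intros t Ht. apply continuous_R_mult; [apply continuous_const | auto].
      * intros t Ht. cont; lra.
      * intros t Ht. change (average (fun x => K x t) <= N * Rpower (1 - t) (b - 1)).
        rewrite Rpower_minus_1 by lra.
        destruct (Req_dec t 0) as [->|Ht0].
        -- rewrite (average_ext _ (fun _ => 0)).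
           ++ rewrite average_const, Rminus_0_r, Rpower_1_base. lra.
           ++ intros x. unfold K, shifted_integrand, phi.
              replace (RtoC 0 / (1 - RtoC (1 - 0) * circle r x))%C with (RtoC 0)
                by (unfold Cdiv; ring).
              rewrite Hf0. unfold Cdiv. rewrite Cmult_0_l, Cmult_0_r. apply Cmod_0.
        -- assert (A := contraction f N t r Hf Hf0 HN ltac:(lra) Hr).
           rewrite (average_ext _ (fun x => Rpower (1 - t) b *
             Cmod (f (phi t (circle r x)) / (1 - RtoC (1 - t) * circle r x)))).
           ++ rewrite average_scal.
              ** replace (N * (Rpower (1 - t) b / (1 - t))) with (Rpower (1 - t) b * (N / (1 - t)))
                   by (field; lra).
                 apply Rmult_le_compat_l; [left; apply Rpower_pos | exact A].
              ** intros x. assert (Nd := denominator_neq_0 r (circle r x) Hr (Hc x) t ltac:(lra)).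
                 assert (Hphi := phi_modulus_lt_1 t r (circle r x) ltac:(lra) Hr (Hc x)).
                 cont.
                 apply (continuous_comp (fun x => phi t (circle r x)) f).
                 { unfold phi. cont. }
                 apply cdiff_continuous, Hf. assert (0 < (1 - t) * (1 - r)) by nra. lra.
           ++ intros x. unfold K, shifted_integrand.
              rewrite Cmod_mult, Cmod_R, Rabs_pos_eq by (left; apply Rpower_pos). reflexivity.
    + rewrite RInt_scal_cont, power_integral; try lra.
      * rewrite Rminus_0_r, Rpower_1_base. assert (P := Rpower_pos (1 - T) b).
        unfold Rdiv. apply Rmult_le_compat_l; [exact HN0|].
        rewrite <- (Rmult_1_r (/ b)) at 2.
        apply Rmult_le_compat_l; [left; apply Rinv_0_lt_compat, Hb0 | lra].
      * intros t Ht. cont; lra.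
Qed.

End Operator.


(** * Norms as bounds *)

Lemma average_le_H1_norm (f : C -> C) (r : R) : 0 <= r < 1 ->
  Rbar_le (average (fun th => Cmod (f (circle r th)))) (H1_norm f).
Proof.
  intros Hr. unfold H1_norm.
  destruct (Lub_Rbar_correct (fun y : R => exists r : R, 0 <= r < 1 /\
    y = / (2 * PI) * RInt (fun theta => Cmod (f (circle r theta))) 0 (2 * PI))) as [H _].
  apply H. exists r. split; [exact Hr | reflexivity].
Qed.

Lemma H1_norm_le (f : C -> C) (N : R) : bounded_means f N <-> Rbar_le (H1_norm f) N.
Proof.
  split.
  - intros HN. unfold H1_norm.
    destruct (Lub_Rbar_correct (fun y : R => exists r : R, 0 <= r < 1 /\
      y = / (2 * PI) * RInt (fun theta => Cmod (f (circle r theta))) 0 (2 * PI))) as [_ H].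
    apply H. intros y [r [Hr ->]]. apply HN, Hr.
  - intros HN r Hr. exact (Rbar_le_trans _ _ _ (average_le_H1_norm f r Hr) HN).
Qed.

Lemma analytic_cdiff (f : C -> C) :
  analytic_on_disk f <-> (forall s, Cmod s < 1 -> cdiff f s).
Proof.
  split; intros H s Hs; apply cdiff_ex_derive; apply H; exact Hs.
Qed.

Lemma H1_spec (f : C -> C) : H1 f ->
  (forall s, Cmod s < 1 -> cdiff f s) /\ exists N, H1_norm f = Finite N /\ bounded_means f N.
Proof.
  intros [Ha Hn]. split; [apply analytic_cdiff, Ha|].
  assert (H0 := average_le_H1_norm f 0 ltac:(lra)).
  assert (Hb := proj2 (H1_norm_le f (real (H1_norm f)))).
  destruct (H1_norm f) as [N| |]; [|destruct Hn|destruct H0].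
  exists N. split; [reflexivity|]. apply Hb. apply Rle_refl.
Qed.

Lemma H1_intro (f : C -> C) (N : R) :
  (forall s, Cmod s < 1 -> cdiff f s) -> bounded_means f N -> H1 f.
Proof.
  intros Hf HN. split; [apply analytic_cdiff, Hf|].
  apply Rbar_le_lt_trans with (Finite N); [apply H1_norm_le, HN | exact I].
Qed.

(** * Boundedness on the Hardy space *)

Lemma continuous_mean_integrand (f : C -> C) (r th : R) :
  (forall s, Cmod s < 1 -> cdiff f s) -> 0 <= r < 1 ->
  continuous (fun th => Cmod (f (circle r th))) th.
Proof.
  intros Hf Hr. apply continuous_Cmod, continuous_on_circle, cdiff_continuous, Hf.
  rewrite Cmod_circle; lra.
Qed.

Section Boundedness.
Context (b N : R) (f : C -> C) (Hb0 : 0 < b).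
Context (Hf : forall s, Cmod s < 1 -> cdiff f s) (HN : bounded_means f N).

Let g (s : C) : C := (f 0 * (1 - s))%C.
Let f0 (s : C) : C := (f s - g s)%C.

Lemma value_at_0_bound : Cmod (f 0) <= N.
Proof.
  eapply Rle_trans; [|apply (HN 0); lra]. rewrite <- (average_const (Cmod (f 0))). right.
  apply average_ext. intros th. do 2 f_equal. rewrite circle_polar. ring.
Qed.

Lemma cdiff_affine_part (s : C) : cdiff g s.
Proof.
  apply cdiff_mult; [apply cdiff_const|].
  apply cdiff_minus; [apply cdiff_const | apply cdiff_id].
Qed.

Lemma affine_part_means : bounded_means g (2 * N).
Proof.
  intros r Hr. rewrite <- (average_const (2 * N)). assert (H0 := value_at_0_bound).
  apply average_le.
  - intros th. apply continuous_mean_integrand; [intros; apply cdiff_affine_part | exact Hr].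
  - intros; apply continuous_const.
  - intros th. unfold g. rewrite Cmod_mult.
    assert (T := Cmod_triangle_sub 1 (circle r th)). rewrite Cmod_1, Cmod_circle in T by lra.
    rewrite Rmult_comm. apply Rmult_le_compat; try apply Cmod_ge_0; lra.
Qed.

Lemma centered_part_means : bounded_means f0 (3 * N).
Proof.
  intros r Hr.
  assert (C1 : forall th, continuous (fun th => Cmod (f (circle r th))) th)
    by (intros; apply continuous_mean_integrand; assumption).
  assert (C2 : forall th, continuous (fun th => Cmod (g (circle r th))) th)
    by (intros; apply continuous_mean_integrand; [intros; apply cdiff_affine_part | assumption]).
  apply Rle_trans with
    (average (fun th => Cmod (f (circle r th)) + Cmod (g (circle r th)))).
  - apply average_le.
    + intros th. apply continuous_mean_integrand; [|exact Hr].
      intros s Hs. apply cdiff_minus; [apply Hf, Hs | apply cdiff_affine_part].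
    + intros th. apply continuous_R_plus; [apply C1 | apply C2].
    + intros th. apply Cmod_triangle_sub.
  - rewrite average_plus by assumption.
    assert (A1 := HN r Hr). assert (A2 := affine_part_means r Hr). lra.
Qed.

Lemma cdiff_centered_part (s : C) : Cmod s < 1 -> cdiff f0 s.
Proof. intros Hs. apply cdiff_minus; [apply Hf, Hs | apply cdiff_affine_part]. Qed.

(** The operator maps [1 - z] to a function bounded by [1], because
    [1 - t <= |1 - t z|]. *)
Lemma Hb_affine_part_bound (z : C) : Cmod z < 1 -> Cmod (Hb b g z) <= N.
Proof.
  intros Hz. assert (H0 := value_at_0_bound). assert (Hm := Cmod_ge_0 z).
  apply (le_of_power_tail b (tail_constant b (2 * N) (Cmod z) / b)); [exact Hb0|].
  intros T HT.
  assert (A := Hb_tail b (2 * N) g Hb0 (fun s _ => cdiff_affine_part s) affine_part_means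
    z (Cmod z) T Hz (Rle_refl _) HT).
  destruct (integrand_dominated b (2 * N) g Hb0 (fun s _ => cdiff_affine_part s)
    affine_part_means z (Cmod z) Hz (Rle_refl _)) as [Ci _].
  assert (B : Cmod (CI (Hb_integrand b g z) 0 T) <= Cmod (f 0) * (T - 0)).
  { apply CI_norm_const; [lra| |].
    - intros t Ht. apply Ci. lra.
    - intros t Ht. unfold Hb_integrand, g.
      rewrite !Cmod_mult, Cmod_div, Cmod_Cpower, <- RtoC_minus, !Cmod_R by apply Cpower_neq_0.
      rewrite !Rabs_pos_eq by (lra || (left; apply Rpower_pos)).
      assert (L := one_sub_lower t z ltac:(lra)).
      assert (P : Rpower (1 - t) (b + 1) <= Rpower (Cmod (1 - RtoC t * z)) (b + 1))
        by (apply Rle_Rpower_l; [lra | split; nra]).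
      assert (E : Rpower (1 - t) (b + 1) = (1 - t) * Rpower (1 - t) b).
      { rewrite Rpower_plus, Rpower_1 by lra. ring. }
      assert (Q := Rpower_pos (Cmod (1 - RtoC t * z)) (b + 1)).
      rewrite Rmult_assoc. rewrite <- (Rmult_1_r (Cmod (f 0))) at 2.
      apply Rmult_le_compat_l; [apply Cmod_ge_0|].
      unfold Rdiv. rewrite <- Rmult_assoc, <- E. apply div_le_of_le_mul; [exact Q|]. lra. }
  replace (Hb b g z) with (CI (Hb_integrand b g z) 0 T
    + (Hb b g z - CI (Hb_integrand b g z) 0 T))%C by ring.
  eapply Rle_trans; [apply Cmod_triangle|]. apply Rplus_le_compat; [|exact A].
  assert (P := Cmod_ge_0 (f 0)). nra.
Qed.

Lemma Hb_split (z : C) : Cmod z < 1 -> Hb b f z = (Hb b f0 z + Hb b g z)%C.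
Proof.
  intros Hz. assert (Hm := Cmod_ge_0 z).
  apply Cmod_eq_0_sub. apply Rle_antisym; [|apply Cmod_ge_0].
  set (K := fun N => tail_constant b N (Cmod z) / b).
  apply (le_of_power_tail b (K N + K (3 * N) + K (2 * N))); [exact Hb0|].
  intros T HT.
  assert (A1 := Hb_tail b N f Hb0 Hf HN z (Cmod z) T Hz (Rle_refl _) HT).
  assert (A2 := Hb_tail b (3 * N) f0 Hb0 cdiff_centered_part centered_part_means
    z (Cmod z) T Hz (Rle_refl _) HT).
  assert (A3 := Hb_tail b (2 * N) g Hb0 (fun s _ => cdiff_affine_part s) affine_part_means
    z (Cmod z) T Hz (Rle_refl _) HT).
  destruct (integrand_dominated b (3 * N) f0 Hb0 cdiff_centered_part
    centered_part_means z (Cmod z) Hz (Rle_refl _)) as [C2 _].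
  destruct (integrand_dominated b (2 * N) g Hb0 (fun s _ => cdiff_affine_part s)
    affine_part_means z (Cmod z) Hz (Rle_refl _)) as [C3 _].
  assert (E : CI (Hb_integrand b f z) 0 T =
    (CI (Hb_integrand b f0 z) 0 T + CI (Hb_integrand b g z) 0 T)%C).
  { rewrite <- CI_plus; [|lra|intros; apply C2; lra|intros; apply C3; lra].
    apply CI_ext; [lra|]. intros t _. unfold Hb_integrand, f0. ring. }
  replace (Hb b f z - (Hb b f0 z + Hb b g z))%C with
    ((Hb b f z - CI (Hb_integrand b f z) 0 T) - (Hb b f0 z - CI (Hb_integrand b f0 z) 0 T)
     - (Hb b g z - CI (Hb_integrand b g z) 0 T))%C by (rewrite E; ring).
  eapply Rle_trans; [apply Cmod_triangle_sub|].
  eapply Rle_trans; [apply Rplus_le_compat_r, Cmod_triangle_sub|].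
  unfold K. lra.
Qed.

(** The sharp bound needs a zero at the origin, so [f 0 * (1 - z)] is split off. *)
Lemma Hb_bounded_means : bounded_means (Hb b f) ((3 / b + 1) * N).
Proof.
  intros r Hr.
  assert (Hf00 : f0 0 = 0) by (unfold f0, g; ring).
  assert (A := Hb_mean_bound b (3 * N) f0 Hb0 cdiff_centered_part centered_part_means r Hf00 Hr).
  assert (Cc : forall h M, (forall s, Cmod s < 1 -> cdiff h s) -> bounded_means h M ->
    forall th, continuous (fun th => Cmod (Hb b h (circle r th))) th).
  { intros h M Hh HM th. apply continuous_mean_integrand; [|exact Hr].
    intros s Hs. exact (Hb_analytic b M h Hb0 Hh HM s Hs). }
  assert (C0 := Cc f0 _ cdiff_centered_part centered_part_means).
  apply Rle_trans with (average (fun th => Cmod (Hb b f0 (circle r th)) + N)).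
  - apply average_le.
    + exact (Cc f N Hf HN).
    + intros th. apply continuous_R_plus; [apply C0 | apply continuous_const].
    + intros th. rewrite Hb_split by (rewrite Cmod_circle; lra).
      eapply Rle_trans; [apply Cmod_triangle|]. apply Rplus_le_compat_l.
      apply Hb_affine_part_bound. rewrite Cmod_circle; lra.
  - rewrite average_plus, average_const by (auto; intros; apply continuous_const).
    replace ((3 / b + 1) * N) with (3 * N / b + N) by (field; lra). lra.
Qed.

End Boundedness.

(** * Lower bounds on the positive cone *)

(** On the real axis the kernel is positive, so truncation only decreases the integral. *)
Lemma Hb_real_lower_bound (b N : R) (f : C -> C) (x T : R) :
  0 < b -> (forall s, Cmod s < 1 -> cdiff f s) -> bounded_means f N ->
  (forall t, 0 <= t < 1 -> snd (f (RtoC t)) = 0 /\ 0 <= fst (f (RtoC t))) ->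
  -1 < x < 1 -> 0 <= T < 1 ->
  RInt (fun t => fst (f (RtoC t)) * (Rpower (1 - t) b * Rpower (1 - t * x) (- (b + 1)))) 0 T
    <= fst (Hb b f (RtoC x)).
Proof.
  intros Hb0 Hf HN Hpos Hx HT.
  set (rho := fun t => fst (f (RtoC t)) * (Rpower (1 - t) b * Rpower (1 - t * x) (- (b + 1)))).
  assert (Hx1 : Cmod (RtoC x) < 1) by (rewrite Cmod_R; apply Rabs_def1; lra).
  assert (Htx : forall t, 0 <= t < 1 -> 0 < 1 - t * x) by (intros; nra).
  destruct (integrand_dominated b N f Hb0 Hf HN (RtoC x) (Cmod (RtoC x)) Hx1 (Rle_refl _))
    as [Ci _].
  assert (Ei : forall t, 0 <= t < 1 -> Hb_integrand b f (RtoC x) t = RtoC (rho t)).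
  { intros t Ht. unfold Hb_integrand, rho.
    rewrite <- RtoC_mult, <- RtoC_minus, Cpower_RtoC by (apply Htx, Ht).
    rewrite Rpower_Ropp, !RtoC_mult, RtoC_inv by apply Rgt_not_eq, Rpower_pos.
    replace (f (RtoC t)) with (RtoC (fst (f (RtoC t)))).
    - reflexivity.
    - destruct (Hpos t Ht) as [H1 _]. destruct (f (RtoC t)) as [u v]. simpl in *.
      rewrite H1. reflexivity. }
  assert (Cf : forall t, 0 <= t < 1 -> continuous (fun t => f (RtoC t)) t).
  { intros t Ht. apply (continuous_comp RtoC f);
      [apply (continuous_RtoC (fun t => t)), continuous_id|].
    apply cdiff_continuous, Hf, real_point_in_disk, Ht. }
  assert (Cr : forall t, 0 <= t < 1 -> continuous rho t).
  { intros t Ht. specialize (Cf t Ht). assert (H := Htx t Ht). unfold rho. cont; lra. }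
  assert (Hr0 : forall t, 0 <= t < 1 -> 0 <= rho t).
  { intros t Ht. apply Rmult_le_pos; [apply Hpos, Ht|].
    apply Rmult_le_pos; left; apply Rpower_pos. }
  apply (le_of_power_tail b (tail_constant b N (Cmod (RtoC x)) / b)); [exact Hb0|].
  intros S HS.
  set (E := tail_constant b N (Cmod (RtoC x)) / b).
  assert (HE : 0 <= E).
  { apply Rdiv_le_0_compat; [|exact Hb0]. unfold tail_constant.
    apply Rmult_le_pos; [|left; apply Rpower_pos].
    assert (H := bounded_means_nonneg N f Hf HN). lra. }
  assert (Main : forall S, T <= S < 1 -> RInt rho 0 T <= fst (Hb b f (RtoC x)) + E * Rpower (1 - S) b).
  { intros U HU.
    assert (A := Hb_tail b N f Hb0 Hf HN (RtoC x) (Cmod (RtoC x)) U Hx1 (Rle_refl _) ltac:(lra)).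
    rewrite (CI_ext 0 U ltac:(lra) _ (fun t => RtoC (rho t))) in A by (intros; apply Ei; lra).
    rewrite CI_RtoC in A.
    assert (B := Rabs_fst_le_Cmod (Hb b f (RtoC x) - RtoC (RInt rho 0 U))).
    change (fst (Hb b f (RtoC x) - RtoC (RInt rho 0 U))%C)
      with (fst (Hb b f (RtoC x)) - RInt rho 0 U) in B.
    assert (B2 := Rabs_maj2 (fst (Hb b f (RtoC x)) - RInt rho 0 U)).
    assert (D : RInt rho 0 U = RInt rho 0 T + RInt rho T U)
      by (apply RInt_Chasles_cont; try lra; intros; apply Cr; lra).
    assert (D2 : 0 <= RInt rho T U)
      by (apply RInt_nonneg_cont; try lra; intros; [apply Cr | apply Hr0]; lra).
    fold E in A. lra. }
  destruct (Rle_dec T S) as [H|H]; [apply Main; lra|].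
  eapply Rle_trans; [apply (Main T); lra|]. apply Rplus_le_compat_l.
  apply Rmult_le_compat_l; [exact HE|]. apply Rle_Rpower_l; lra.
Qed.

(** * Unboundedness on bounded functions *)

Lemma RInt_inverse_one_sub (k T : R) : 0 <= k <= 1 -> 0 <= T < 1 ->
  RInt (fun t => k / (1 - k * t)) 0 T = - ln (1 - k * T).
Proof.
  intros Hk HT. assert (Hp : forall t, 0 <= t <= T -> 0 < 1 - k * t) by (intros; nra).
  rewrite (RInt_FTC (fun t => - ln (1 - k * t))).
  - R_equation. rewrite Rmult_0_r, Rminus_0_r, ln_1. ring.
  - lra.
  - intros t Ht. specialize (Hp t Ht). auto_derive; [lra|]. field. lra.
  - intros t Ht. specialize (Hp t Ht). cont. lra.
Qed.

(** [Hb b 1] grows logarithmically at [1]: for [t <= T] the kernel at [z = T] is at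
    least [2^(-b-1) / (1 - t)], because [1 - t T <= 2 (1 - t)]. *)
Lemma Hb_one_lower_bound (b T : R) : 0 < b -> 0 <= T < 1 ->
  Rpower 2 (- (b + 1)) * - ln (1 - T) <= fst (Hb b (fun _ => RtoC 1) (RtoC T)).
Proof.
  intros Hb0 HT.
  assert (H := Hb_real_lower_bound b 1 (fun _ => RtoC 1) T T Hb0
    (fun s _ => cdiff_const 1 s)).
  eapply Rle_trans; [|apply H; try lra].
  - replace (- ln (1 - T)) with (- ln (1 - 1 * T)) by (do 2 f_equal; ring).
    rewrite <- RInt_inverse_one_sub by lra.
    assert (C1 : forall t, 0 <= t <= T -> continuous (fun t => 1 / (1 - 1 * t)) t)
      by (intros; cont; lra).
    rewrite <- RInt_scal_cont by (auto; lra).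
    apply RInt_le_cont; [lra| | |].
    + intros t Ht. apply continuous_R_mult; [apply continuous_const | auto].
    + intros t Ht. cont; simpl; nra.
    + intros t Ht. simpl. rewrite Rmult_1_l, Rmult_1_l.
      replace (1 / (1 - t)) with (Rpower (1 - t) b * Rpower (1 - t) (- (b + 1))).
      2: { rewrite <- Rpower_plus. replace (b + - (b + 1)) with (- (1)) by ring.
           rewrite Rpower_Ropp, Rpower_1 by lra. field. lra. }
      rewrite <- Rmult_assoc, (Rmult_comm (Rpower 2 _)), Rmult_assoc.
      apply Rmult_le_compat_l; [left; apply Rpower_pos|].
      rewrite Rpower_mult_distr by lra. rewrite !Rpower_Ropp.
      apply Rinv_le_contravar; [apply Rpower_pos|]. apply Rle_Rpower_l; [lra|]. split; nra.
  - intros r Hr. rewrite (average_ext _ (fun _ => 1)) by (intros; apply Cmod_1).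
    rewrite average_const. lra.
  - intros t Ht. simpl. lra.
Qed.

Lemma not_bounded_on_Hinf (b : R) : 0 < b ->
  ~ bounded_operator Hinf Hinf_norm Hinf Hinf_norm (Hb b).
Proof.
  intros Hb0 [Hmap _].
  assert (Hub : forall f z, disk z -> Rbar_le (Cmod (f z)) (Hinf_norm f)).
  { intros f z Hz. unfold Hinf_norm.
    destruct (Lub_Rbar_correct (fun y : R => exists z : C, disk z /\ y = Cmod (f z))) as [H _].
    apply H. exists z. split; [exact Hz | reflexivity]. }
  assert (H1 : Hinf (fun _ => RtoC 1)).
  { split.
    - intros z _. apply cdiff_ex_derive, cdiff_const.
    - apply Rbar_le_lt_trans with (Finite 1); [|exact I]. unfold Hinf_norm.
      destruct (Lub_Rbar_correct (fun y : R => exists z : C, disk z /\ y = Cmod 1)) as [_ H].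
      apply H. intros y [z [_ ->]]. rewrite Cmod_1. apply Rle_refl. }
  destruct (Hmap _ H1) as [_ Hfin].
  specialize (Hub (Hb b (fun _ => RtoC 1))).
  destruct (Hinf_norm (Hb b (fun _ => RtoC 1))) as [B| |].
  - set (k := Rpower 2 (- (b + 1))). assert (Hk : 0 < k) by apply Rpower_pos.
    (* chosen so that the lower bound at [T] is [|B| + 1] *)
    set (L := (Rabs B + 1) / k).
    assert (HL : 0 < L) by (apply Rdiv_lt_0_compat; [generalize (Rabs_pos B)|]; lra).
    set (T := 1 - exp (- L)).
    assert (HT : 0 <= T < 1).
    { unfold T. assert (E1 := exp_pos (- L)).
      assert (E2 := exp_increasing (- L) 0 ltac:(lra)). rewrite exp_0 in E2. lra. }
    assert (A := Hb_one_lower_bound b T Hb0 HT). fold k in A.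
    replace (- ln (1 - T)) with L in A
      by (unfold T; replace (1 - (1 - exp (- L))) with (exp (- L)) by ring; rewrite ln_exp; ring).
    replace (k * L) with (Rabs B + 1) in A by (unfold L; field; lra).
    assert (D : disk (RtoC T)) by (apply real_point_in_disk, HT).
    assert (U := Hub (RtoC T) D). simpl in U.
    assert (V := Rabs_fst_le_Cmod (Hb b (fun _ => RtoC 1) (RtoC T))).
    assert (W := Rle_abs (fst (Hb b (fun _ => RtoC 1) (RtoC T)))).
    assert (X := Rle_abs B). lra.
  - exact Hfin.
  - apply (Hub (RtoC 0)). unfold disk. rewrite Cmod_0. lra.
Qed.


(** * Nearly extremal functions *)

Lemma sin_half_lower (x : R) : 0 <= x <= 1 -> x / 2 <= sin x.
Proof.
  intros Hx. assert (HP := PI2_1). assert (P3 : 1 <= PI / 2) by lra.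
  destruct (Req_dec x 0) as [->|Hx0]; [rewrite sin_0; lra|].
  destruct (MVT_gen sin 0 x cos) as [c [Hc E]].
  - intros t _. apply is_derive_sin || (auto_derive; [exact I | ring]).
  - intros t _. apply continuity_sin.
  - rewrite Rmin_left, Rmax_right in Hc by lra. rewrite sin_0 in E.
    assert (Hcos : 1 / 2 <= cos c).
    { assert (P : 3 < PI) by (generalize PI2_3_2; lra).
      rewrite <- cos_PI3. apply cos_decr_1; lra. }
    nra.
Qed.

Section InverseMean.
Context (s e : R) (Hs : 0 <= s <= 1 - e) (He : 0 < e <= 1).

Let q (th : R) : R := / Cmod (1 - RtoC s * circle 1 th).

Lemma Cmod_sqr_one_sub_scaled_circle (th : R) :
  Cmod (1 - RtoC s * circle 1 th) * Cmod (1 - RtoC s * circle 1 th)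
  = 1 + s * s - 2 * s * cos th.
Proof.
  rewrite <- circle_10, <- circle_polar, Cmod_sqr_circle_sub.
  replace (0 - th) with (- th) by ring. rewrite cos_neg. ring.
Qed.

Lemma modulus_lower (th : R) : e <= Cmod (1 - RtoC s * circle 1 th).
Proof.
  assert (L := one_sub_lower s (circle 1 th) ltac:(lra)). rewrite Cmod_circle in L; lra.
Qed.

Lemma continuous_q (th : R) : continuous q th.
Proof. unfold q. assert (H := modulus_lower th). cont. lra. Qed.

Lemma q_le (th m : R) : 0 < m -> m * m <= 1 + s * s - 2 * s * cos th -> q th <= / m.
Proof.
  intros Hm H. apply Rinv_le_contravar; [exact Hm|].
  rewrite <- Cmod_sqr_one_sub_scaled_circle in H.
  generalize (Cmod_ge_0 (1 - RtoC s * circle 1 th)). nra.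
Qed.

Lemma q_le_sin (th : R) : 0 < sin th -> q th <= / sin th.
Proof.
  intros Hsin. apply q_le; [exact Hsin|]. assert (H := sin2_cos2 th). unfold Rsqr in H.
  generalize (Rle_0_sqr (cos th - s)). unfold Rsqr. lra.
Qed.

Lemma q_le_1 (th : R) : cos th <= 0 -> q th <= / 1.
Proof. intros H. apply q_le; [lra|]. nra. Qed.

(** [ln (tan (t / 2))] is a primitive of [1 / sin t]. *)
Lemma RInt_inverse_sin : RInt (fun th => / sin th) e (PI / 2) <= - ln e + ln 4.
Proof.
  assert (HP := PI2_1). assert (HP' : 1 < PI / 2) by lra.
  assert (Hpos : forall t, e <= t <= PI / 2 -> 0 < sin (t / 2) /\ 0 < cos (t / 2) /\ 0 < sin t).
  { intros t Ht. repeat split; [apply sin_gt_0 | apply cos_gt_0 | apply sin_gt_0]; lra. }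
  rewrite (RInt_FTC (fun t => ln (sin (t / 2)) - ln (cos (t / 2)))).
  - replace (PI / 2 / 2) with (PI / 4) by field.
    rewrite sin_PI4, cos_PI4.
    destruct (Hpos e ltac:(lra)) as [S1 [S2 _]].
    assert (S3 := sin_half_lower (e / 2) ltac:(lra)).
    assert (S4 : ln (e / 4) <= ln (sin (e / 2))) by (apply ln_le; lra).
    assert (S5 : ln (cos (e / 2)) <= 0).
    { rewrite <- ln_1. apply ln_le; [exact S2|]. apply COS_bound. }
    unfold Rdiv at 1 in S4. rewrite ln_mult, ln_Rinv in S4 by lra. lra.
  - lra.
  - intros t Ht. destruct (Hpos t Ht) as [P1 [P2 P3]].
    replace (/ sin t) with (/ (2 * sin (t / 2) * cos (t / 2)))
      by (rewrite <- sin_2a; do 2 f_equal; field).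
    assert (E := sin2_cos2 (t / 2)). unfold Rsqr in E.
    auto_derive; [repeat split; assumption|].
    change (t * / 2) with (t / 2).
    replace (/ (2 * sin (t / 2) * cos (t / 2))) with
      ((sin (t / 2) * sin (t / 2) + cos (t / 2) * cos (t / 2)) / (2 * sin (t / 2) * cos (t / 2)))
      by (rewrite E; field; lra).
    field. lra.
  - intros t Ht. destruct (Hpos t Ht) as [P1 [P2 P3]]. cont; lra.
Qed.

Lemma half_circle_bound : RInt q 0 PI <= - ln e + (1 + ln 4 + PI / 2).
Proof.
  assert (HP := PI2_1). assert (HP' : 1 < PI / 2) by lra.
  rewrite (RInt_Chasles_cont q 0 e PI), (RInt_Chasles_cont q e (PI / 2) PI)
    by (try lra; intros; apply continuous_q).
  assert (A1 : RInt q 0 e <= / e * (e - 0)).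
  { rewrite <- RInt_const_R. apply RInt_le_cont; try lra.
    - intros; apply continuous_q.
    - intros; apply continuous_const.
    - intros t _. apply Rinv_le_contravar; [lra | apply modulus_lower]. }
  assert (A2 : RInt q e (PI / 2) <= RInt (fun th => / sin th) e (PI / 2)).
  { assert (Hpos : forall t, e <= t <= PI / 2 -> 0 < sin t) by (intros; apply sin_gt_0; lra).
    apply RInt_le_cont; try lra.
    - intros; apply continuous_q.
    - intros t Ht. specialize (Hpos t Ht). cont; lra.
    - intros t Ht. apply q_le_sin, Hpos, Ht. }
  assert (A3 : RInt q (PI / 2) PI <= / 1 * (PI - PI / 2)).
  { rewrite <- RInt_const_R. apply RInt_le_cont; try lra.
    - intros; apply continuous_q.
    - intros; apply continuous_const.
    - intros t Ht. apply q_le_1, cos_le_0; lra. }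
  assert (A4 := RInt_inverse_sin). rewrite Rinv_1 in A3.
  rewrite Rminus_0_r, Rinv_l in A1 by lra. lra.
Qed.

(** The modulus is at least [e], at least [sin th], and at least [1] on the left half plane;
    these three bounds give the sharp coefficient [1 / PI] of the logarithm. *)
Lemma inverse_mean_bound :
  average (fun th => / Cmod (1 - RtoC s * circle 1 th)) <= (- ln e + (1 + ln 4 + PI / 2)) / PI.
Proof.
  assert (HP := PI_RGT_0). change (average q <= (- ln e + (1 + ln 4 + PI / 2)) / PI).
  assert (Hsym : RInt q PI (2 * PI) = RInt q 0 PI).
  { assert (H := RInt_comp_lin (V := R_CompleteNormedModule) q (-1) (2 * PI) PI 0).
    replace (-1 * PI + 2 * PI) with PI in H by ring.
    replace (-1 * 0 + 2 * PI) with (2 * PI) in H by ring.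
    rewrite <- H.
    - rewrite <- (opp_RInt_swap (V := R_CompleteNormedModule)).
      + rewrite <- (RInt_opp (V := R_CompleteNormedModule)).
        * apply RInt_ext_le; [lra|]. intros t _.
          change (- (-1 * q (-1 * t + 2 * PI)) = q t).
          replace (q (-1 * t + 2 * PI)) with (q t); [ring|].
          unfold q. f_equal.
          rewrite <- (sqrt_square (Cmod (1 - RtoC s * circle 1 t))) by apply Cmod_ge_0.
          rewrite <- (sqrt_square (Cmod (1 - RtoC s * circle 1 (-1 * t + 2 * PI))))
            by apply Cmod_ge_0.
          rewrite !Cmod_sqr_one_sub_scaled_circle. do 3 f_equal.
          replace (-1 * t + 2 * PI) with (- t + 2 * PI) by ring.
          rewrite cos_plus, cos_2PI, sin_2PI, cos_neg. ring.
        * apply ex_RInt_cont; [lra|]. intros t _.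
          apply (continuous_R_mult (fun _ => -1)); [apply continuous_const|].
          apply (continuous_comp (fun t => -1 * t + 2 * PI) q); [cont | apply continuous_q].
      + apply ex_RInt_cont; [lra|]. intros t _.
        apply (continuous_R_mult (fun _ => -1)); [apply continuous_const|].
        apply (continuous_comp (fun t => -1 * t + 2 * PI) q); [cont | apply continuous_q].
    - apply ex_RInt_cont; [lra|]. intros; apply continuous_q. }
  unfold average. rewrite (RInt_Chasles_cont q 0 PI (2 * PI))
    by (try lra; intros; apply continuous_q).
  rewrite Hsym. assert (H := half_circle_bound).
  set (I := RInt q 0 PI) in *.
  replace (/ (2 * PI) * (I + I)) with (I / PI) by (field; lra).
  apply Rmult_le_compat_r; [left; apply Rinv_0_lt_compat, HP | exact H].
Qed.

End InverseMean.

Section TestFunction.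
Context (b a k : R) (Hb0 : 0 < b) (Ha : 0 < a < 1) (Hk : 0 < k).

(** A multiple of [z / (1 - a z)].  As [a] tends to [1] its mass concentrates near
    the point of tangency [1], and [contraction] becomes sharp for every [t] at once. *)
Definition pole_function (s : C) : C := (RtoC k * (s / (1 - RtoC a * s)))%C.

Lemma pole_denominator (s : C) : Cmod s <= 1 -> (1 - RtoC a * s)%C <> 0.
Proof. intros Hs. apply one_sub_neq_0; nra. Qed.

Lemma cdiff_pole_function (s : C) : Cmod s < 1 -> cdiff pole_function s.
Proof.
  intros Hs. apply cdiff_mult; [apply cdiff_const|].
  apply cdiff_div; [apply cdiff_id| |apply pole_denominator; lra].
  apply cdiff_minus; [apply cdiff_const|].
  apply cdiff_mult; [apply cdiff_const | apply cdiff_id].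
Qed.

Lemma pole_function_means :
  bounded_means pole_function (k * ((- ln (1 - a) + (1 + ln 4 + PI / 2)) / PI)).
Proof.
  intros r Hr. assert (Har : 0 <= a * r <= 1 - (1 - a)) by nra.
  assert (Nz : forall th, (1 - RtoC (a * r) * circle 1 th)%C <> 0).
  { intros th. apply one_sub_neq_0; [lra|]. rewrite Cmod_circle; nra. }
  assert (Cq : forall th, continuous (fun th => / Cmod (1 - RtoC (a * r) * circle 1 th)) th).
  { intros th. cont. apply Rgt_not_eq, Cmod_gt_0, Nz. }
  eapply Rle_trans; [|apply Rmult_le_compat_l;
    [lra | apply (inverse_mean_bound (a * r) (1 - a) Har ltac:(lra))]].
  rewrite <- average_scal by exact Cq.
  apply average_le.
  - intros th. apply continuous_mean_integrand; [apply cdiff_pole_function | exact Hr].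
  - intros th. apply continuous_R_mult; [apply continuous_const | apply Cq].
  - intros th. unfold pole_function.
    assert (E : (1 - RtoC a * circle r th)%C = (1 - RtoC (a * r) * circle 1 th)%C)
      by (rewrite circle_polar, RtoC_mult; ring).
    rewrite E, Cmod_mult, Cmod_div, Cmod_R, Rabs_pos_eq, Cmod_circle by (lra || apply Nz).
    apply Rmult_le_compat_l; [lra|]. unfold Rdiv.
    rewrite <- (Rmult_1_l (/ Cmod (1 - RtoC (a * r) * circle 1 th))) at 2.
    apply Rmult_le_compat_r; [|lra]. left. apply Rinv_0_lt_compat, Cmod_gt_0, Nz.
Qed.

Lemma pole_function_real (t : R) : 0 <= t < 1 ->
  pole_function (RtoC t) = RtoC (k * (t / (1 - a * t))).
Proof.
  intros Ht. unfold pole_function.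
  rewrite RtoC_mult, RtoC_div, RtoC_minus, RtoC_mult by nra. reflexivity.
Qed.

(** The factor [t * r] makes the integrand an exact derivative, also when [t = 0]. *)
Lemma radial_kernel_integral (r t : R) : 0 < r < 1 -> 0 <= t < 1 ->
  RInt (fun l => t * r * Rpower (1 - t * (l * r)) (- (b + 1))) 0 1
  = (Rpower (1 - t * r) (- b) - 1) / b.
Proof.
  intros Hr Ht.
  assert (Hp : forall l, 0 <= l <= 1 -> 0 < 1 - t * (l * r)).
  { intros l Hl. assert (0 <= l * r < 1) by nra. nra. }
  rewrite (RInt_FTC (fun l => / b * Rpower (1 - t * (l * r)) (- b))).
  - R_equation. rewrite Rmult_0_l, Rmult_0_r, Rminus_0_r, Rpower_1_base, Rmult_1_l. field. lra.
  - lra.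
  - intros l Hl. specialize (Hp l Hl).
    replace (Rpower (1 - t * (l * r)) (- (b + 1))) with
      (Rpower (1 - t * (l * r)) (- b) / (1 - t * (l * r))).
    2: { replace (- (b + 1)) with (- b + - (1)) by ring.
         rewrite Rpower_plus, (Rpower_Ropp _ 1), Rpower_1 by exact Hp. reflexivity. }
    unfold Rpower. auto_derive; [lra|].
    change (1 + - (t * (l * r))) with (1 - t * (l * r)). field. lra.
  - intros l Hl. specialize (Hp l Hl). cont; lra.
Qed.

(** On [t <= T] the ratio [(1 - t) / (1 - t r)] tends to [1] uniformly as [r] tends to [1];
    this [r] makes it at least [p]. *)
Lemma weight_ratio_lower (p T r t : R) : 0 < p < 1 -> 0 <= T < 1 ->
  r = 1 - (1 - p) * (1 - T) -> 0 <= t <= T ->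
  Rpower p b <= Rpower (1 - t) b * Rpower (1 - t * r) (- b).
Proof.
  intros Hp HT Er Ht. assert (Hr : 0 < r < 1) by nra.
  assert (H1 : 0 < 1 - t * r) by nra.
  rewrite Rpower_Ropp. apply le_div_of_mul_le; [apply Rpower_pos|].
  rewrite Rpower_mult_distr by lra.
  apply Rle_Rpower_l; [lra|]. split; [apply Rmult_lt_0_compat; lra|].
  assert (Q : (1 - r) * t <= (1 - p) * (1 - t * r)).
  { apply Rle_trans with ((1 - p) * (1 - T) * 1).
    - rewrite Er. replace (1 - (1 - (1 - p) * (1 - T))) with ((1 - p) * (1 - T)) by ring.
      apply Rmult_le_compat_l; nra.
    - rewrite Rmult_1_r. apply Rmult_le_compat_l; [lra|]. nra. }
  lra.
Qed.

Context (B : R) (HB : bounded_means (Hb b pole_function) B).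

(** By [diameter_integral_bound] the mean of [Hb b f] controls its integral over the real
    diameter, where everything is positive; exchanging the integrals and using
    [radial_kernel_integral] reduces that to [int_0^T a / (1 - a t) dt]. *)
Lemma pole_function_image_bound_aux (p T : R) : 0 < p < 1 -> 0 <= T < 1 ->
  k / b * (Rpower p b * - ln (1 - a * T) - / b) <= PI * B.
Proof.
  intros Hp HT. assert (HP := PI_RGT_0).
  set (r := 1 - (1 - p) * (1 - T)). assert (Hr : 0 < r < 1) by (unfold r; nra).
  set (F := Hb b pole_function).
  assert (HF : forall s, Cmod s < 1 -> cdiff F s)
    by (apply (Hb_analytic b _ _ Hb0 cdiff_pole_function pole_function_means)).
  set (w := fun t => k * (t / (1 - a * t))).
  assert (Hw : forall t, 0 <= t < 1 -> 0 <= w t).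
  { intros t Ht. unfold w. apply Rmult_le_pos; [lra|]. apply Rdiv_le_0_compat; nra. }
  set (rho := fun t l => w t * (Rpower (1 - t) b * Rpower (1 - t * (l * r)) (- (b + 1)))).
  assert (Hlow : forall l x, -1 < x < 1 -> x = l * r -> RInt (fun t => rho t l) 0 T <= fst (F (RtoC x))).
  { intros l x Hx Ex. assert (H := Hb_real_lower_bound b _ pole_function x T Hb0
      cdiff_pole_function pole_function_means).
    rewrite (RInt_ext_le (fun t => rho t l) (fun t => fst (pole_function (RtoC t)) *
      (Rpower (1 - t) b * Rpower (1 - t * x) (- (b + 1))))); [|lra|].
    - apply H; try assumption. intros t Ht. rewrite pole_function_real by exact Ht.
      split; [reflexivity | apply Hw, Ht].
    - intros t Ht. rewrite pole_function_real by lra. unfold rho, w. rewrite <- Ex. reflexivity. }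
  assert (Hrho0 : forall t l, 0 <= t <= T -> 0 <= rho t l).
  { intros t l Ht. unfold rho. apply Rmult_le_pos; [apply Hw; lra|].
    apply Rmult_le_pos; left; apply Rpower_pos. }
  assert (Crho : forall t l, 0 <= t <= T -> -1 <= l <= 1 ->
    continuous (fun u : R * R => rho (fst u) (snd u)) (t, l)).
  { intros t l Ht Hl. unfold rho, w.
    assert (-1 < l * r < 1) by nra. cont; simpl; nra. }
  assert (Hpos : forall x, - r <= x <= r -> 0 <= fst (F (RtoC x))).
  { intros x Hx. eapply Rle_trans; [|apply (Hlow (x / r) x); [lra | field; lra]].
    assert (Hl : -1 <= x / r <= 1).
    { split; [apply le_div_of_mul_le | apply div_le_of_le_mul]; lra. }
    apply RInt_nonneg_cont; [lra| |].
    - intros t Ht. apply (continuous_slice_1 rho), Crho; lra.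
    - intros t Ht. apply Hrho0, Ht. }
  assert (HFr : forall s, Cmod s <= r -> cdiff F s) by (intros; apply HF; lra).
  assert (D := diameter_integral_bound F r (proj1 Hr) HFr Hpos).
  assert (D2 := HB r ltac:(lra)).
  apply Rle_trans with (PI * average (fun th => Cmod (F (circle r th))));
    [|apply Rmult_le_compat_l; [lra | exact D2]].
  eapply Rle_trans; [|exact D].
  assert (CI2 : forall l, 0 <= l <= 1 -> continuous (fun l => RInt (fun t => rho t l) 0 T) l).
  { intros l Hl. apply (continuous_RInt_param rho); [lra| |].
    - intros t Ht. apply Crho; lra.
    - assert (Hloc : locally l (fun u => -1 < u < / r)).
      { assert (1 < / r) by (rewrite <- Rinv_1; apply Rinv_lt_contravar; lra).
        apply filter_and; [apply open_gt; lra | apply open_lt; lra]. }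
      revert Hloc. apply filter_imp. intros u Hu t Ht.
      assert (Hur : u * r < 1).
      { apply Rmult_lt_reg_r with (/ r); [apply Rinv_0_lt_compat; lra|].
        rewrite Rmult_assoc, Rinv_r; lra. }
      assert (-1 < u * r) by nra.
      unfold rho, w. cont; simpl; nra. }
  apply Rle_trans with (RInt (fun l => RInt (fun t => rho t l) 0 T) 0 1).
  2: { apply RInt_le_cont; [lra|exact CI2| |].
       - intros l Hl. apply (continuous_C_fst (fun l => F (RtoC (l * r)))).
         apply (continuous_comp (fun l => RtoC (l * r)) F); [cont|].
         apply cdiff_continuous, HFr. rewrite Cmod_R, Rabs_pos_eq; nra.
       - intros l Hl. apply Hlow; [nra | reflexivity]. }
  rewrite (RInt_swap (fun l t => rho t l) 0 1 0 T); try lra.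
  2: { intros l t Hl Ht. apply continuous_swap, Crho; lra. }
  assert (Ht1 : forall t, 0 <= t <= T -> 0 < 1 - a * t /\ 0 < 1 - t * r /\ 0 < 1 - t).
  { intros t Ht. repeat split; nra. }
  set (inner := fun t => k / (1 - a * t) * Rpower (1 - t) b
                 * ((Rpower (1 - t * r) (- b) - 1) / b / r)).
  rewrite (RInt_ext_le _ inner); [|lra|].
  2: { intros t Ht. destruct (Ht1 t Ht) as [T1 [T2 T3]].
       assert (Cp : forall l, 0 <= l <= 1 ->
         continuous (fun l => t * r * Rpower (1 - t * (l * r)) (- (b + 1))) l).
       { intros l Hl. assert (0 <= l * r < 1) by nra. cont. nra. }
       unfold inner. rewrite <- radial_kernel_integral by lra.
       replace (k / (1 - a * t) * Rpower (1 - t) b *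
         (RInt (fun l => t * r * Rpower (1 - t * (l * r)) (- (b + 1))) 0 1 / r))
         with (k / (1 - a * t) * Rpower (1 - t) b / r *
         RInt (fun l => t * r * Rpower (1 - t * (l * r)) (- (b + 1))) 0 1) by (unfold Rdiv; ring).
       rewrite <- RInt_scal_cont by (auto; lra).
       apply RInt_ext_le; [lra|]. intros l Hl. unfold rho, w. field. lra. }
  set (lower := fun t => k / b * (Rpower p b * (a / (1 - a * t)) - Rpower (1 - t) (b - 1))).
  apply Rle_trans with (RInt lower 0 T).
  - unfold lower.
    assert (C1 : forall t, 0 <= t <= T -> continuous (fun t => a / (1 - a * t)) t).
    { intros t Ht. destruct (Ht1 t Ht) as [T1 [T2 T3]]. cont. lra. }
    assert (C2 : forall t, 0 <= t <= T -> continuous (fun t => Rpower (1 - t) (b - 1)) t).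
    { intros t Ht. cont; lra. }
    assert (C3 : forall t, 0 <= t <= T -> continuous (fun t => Rpower p b * (a / (1 - a * t))) t).
    { intros t Ht. apply continuous_R_mult; [apply continuous_const | auto]. }
    rewrite RInt_scal_cont; [|lra|intros; apply continuous_R_minus; auto].
    rewrite (RInt_minus_cont (fun t => Rpower p b * (a / (1 - a * t)))) by (auto; lra).
    rewrite RInt_scal_cont, RInt_inverse_one_sub, power_integral by (auto; lra).
    apply Rmult_le_compat_l; [apply Rdiv_le_0_compat; lra|].
    rewrite Rminus_0_r, Rpower_1_base.
    assert (PT := Rpower_pos (1 - T) b). assert (0 < / b) by (apply Rinv_0_lt_compat; lra). nra.
  - apply RInt_le_cont; [lra| | |].
    + intros t Ht. destruct (Ht1 t Ht) as [T1 [T2 T3]]. unfold lower. cont; lra.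
    + intros t Ht. destruct (Ht1 t Ht) as [T1 [T2 T3]]. unfold inner. cont; lra.
    + intros t Ht. destruct (Ht1 t Ht) as [T1 [T2 T3]].
      assert (W := weight_ratio_lower p T r t Hp HT eq_refl Ht).
      set (X := Rpower (1 - t) b) in *. set (Y := Rpower (1 - t * r) (- b)) in *.
      assert (HX : 0 < X) by apply Rpower_pos.
      assert (HY : 1 <= Y).
      { unfold Y. rewrite Rpower_Ropp, <- Rinv_1. apply Rinv_le_contravar; [apply Rpower_pos|].
        assert (0 <= t * r) by (apply Rmult_le_pos; lra).
        apply Rle_trans with (Rpower 1 b); [apply Rle_Rpower_l; lra|].
        right. apply Rpower_1_base. }
      unfold lower, inner. fold X Y. rewrite Rpower_minus_1 by lra. fold X.
      apply Rle_trans with (k / b * ((X * Y - X) / (1 - a * t))).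
      * apply Rmult_le_compat_l; [apply Rdiv_le_0_compat; lra|].
        assert (I1 : 0 < / (1 - a * t)) by (apply Rinv_0_lt_compat; lra).
        assert (I2 : / (1 - a * t) <= / (1 - t)) by (apply Rinv_le_contravar; nra).
        assert (HPp := Rpower_pos p b).
        unfold Rdiv. rewrite (Rmult_minus_distr_r (X * Y)).
        apply Rplus_le_compat.
        -- rewrite <- Rmult_assoc. apply Rmult_le_compat_r; [lra|]. nra.
        -- apply Ropp_le_contravar. apply Rmult_le_compat_l; lra.
      * replace (k / (1 - a * t) * X * ((Y - 1) / b / r))
          with (k / b * ((X * Y - X) / (1 - a * t)) * / r) by (field; lra).
        rewrite <- (Rmult_1_r (k / b * ((X * Y - X) / (1 - a * t)))) at 1.
        apply Rmult_le_compat_l.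
        -- apply Rmult_le_pos; [apply Rdiv_le_0_compat; lra|].
           apply Rdiv_le_0_compat; [nra | exact T1].
        -- rewrite <- Rinv_1. apply Rinv_le_contravar; lra.
Qed.

(** The choice [T = a], followed by the limit [p -> 1]. *)
Lemma pole_function_image_bound : k / b * (- ln (1 - a) - ln 2 - / b) <= PI * B.
Proof.
  assert (H : k / b * (Rpower 1 b * - ln (1 - a * a) - / b) <= PI * B).
  { apply (limit_bound_at_1 (fun p => k / b * (Rpower p b * - ln (1 - a * a) - / b))).
    - cont; lra.
    - intros p Hp. apply pole_function_image_bound_aux; lra. }
  eapply Rle_trans; [|exact H]. rewrite Rpower_1_base, Rmult_1_l.
  apply Rmult_le_compat_l; [apply Rdiv_le_0_compat; lra|].
  replace (1 - a * a) with ((1 - a) * (1 + a)) by ring.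
  rewrite ln_mult by lra.
  assert (ln (1 + a) <= ln 2) by (apply ln_le; lra). lra.
Qed.

End TestFunction.

(** * The operator norm *)

(** [Rpower x 0 = 1], so the integrand has the primitive [- (1 - x)^b / b]; it vanishes at
    [1] because [b > 0]. *)
Lemma Beta_1 (b : R) : 0 < b -> Beta 1 b = / b.
Proof.
  intros Hb0. unfold Beta.
  apply (is_RInt_gen_unique (V := R_CompleteNormedModule)).
  set (G := fun x => - / b * Rpower (1 - x) b).
  replace (/ b) with (0 - - / b) by ring.
  assert (Hin : filter_prod (at_right 0) (at_left 1)
    (fun ab : R * R => 0 < fst ab /\ snd ab < 1)).
  { apply (Filter_prod _ _ _ (fun x => 0 < x) (fun x => x < 1)).
    - exists (mkposreal 1 Rlt_0_1). intros y _ Hy. exact Hy.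
    - exists (mkposreal 1 Rlt_0_1). intros y _ Hy. exact Hy.
    - intros x y Hx Hy. split; assumption. }
  assert (Hhalf : filter_prod (at_right 0) (at_left 1)
    (fun ab : R * R => fst ab < 1 /\ 0 < snd ab)).
  { apply (Filter_prod _ _ _ (fun x => x < 1) (fun x => 0 < x)).
    - exists (mkposreal 1 Rlt_0_1). intros y Hy _. 
      change (Rabs (y - 0) < 1) in Hy. apply Rabs_def2 in Hy. lra.
    - exists (mkposreal 1 Rlt_0_1). intros y Hy _.
      change (Rabs (y - 1) < 1) in Hy. apply Rabs_def2 in Hy. lra.
    - intros x y Hx Hy. split; assumption. }
  assert (DG : forall x, x < 1 -> is_derive G x (Rpower (1 - x) (b - 1)))
    by (intros; apply is_derive_one_sub_power; lra).
  apply (is_RInt_gen_ext (Derive G)).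
  - generalize (filter_and _ _ Hin Hhalf). apply filter_imp.
    intros [u v] [[H1 H2] [H3 H4]] x Hx. simpl in *.
    assert (Hx1 : x < 1) by (destruct Hx as [_ Hx]; revert Hx; apply Rmax_case; lra).
    assert (Hx0 : 0 < x) by (destruct Hx as [Hx _]; revert Hx; apply Rmin_case; lra).
    rewrite (is_derive_unique G x _ (DG x Hx1)).
    rewrite Rminus_diag, Rpower_O by exact Hx0. rewrite Rmult_1_l. reflexivity.
  - apply is_RInt_gen_Derive.
    + generalize (filter_and _ _ Hin Hhalf). apply filter_imp.
      intros [u v] [[H1 H2] [H3 H4]] x [_ Hx]. simpl in *.
      exists (Rpower (1 - x) (b - 1)). apply DG. revert Hx. apply Rmax_case; lra.
    + generalize (filter_and _ _ Hin Hhalf). apply filter_imp.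
      intros [u v] [[H1 H2] [H3 H4]] x [_ Hx]. simpl in *.
      assert (Hx1 : x < 1) by (revert Hx; apply Rmax_case; lra).
      apply (continuous_ext_loc _ (fun x => Rpower (1 - x) (b - 1))).
      * assert (Hloc : locally x (fun y => y < 1)) by (apply open_lt, Hx1).
        revert Hloc. apply filter_imp. intros y Hy. symmetry. apply is_derive_unique, DG, Hy.
      * cont; lra.
    + assert (CG : continuous G 0)
        by (apply (@ex_derive_continuous R_AbsRing R_NormedModule); eexists; apply DG; lra).
      replace (- / b) with (G 0).
      * intros P HP. destruct (CG P HP) as [d Hd]. exists d. intros y Hy _. apply Hd, Hy.
      * unfold G. rewrite Rminus_0_r, Rpower_1_base. ring.
    + intros P [eps HP].
      destruct (Rpower_small b (eps * b / 2) Hb0) as [d [Hd Hd2]].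
      { assert (Pe := cond_pos eps). nra. }
      exists (mkposreal d (proj1 Hd)). intros y Hy Hy1. apply HP.
      change (Rabs (y - 1) < d) in Hy. apply Rabs_def2 in Hy.
      change (Rabs (G y - 0) < eps).
      specialize (Hd2 (1 - y) ltac:(lra)). assert (P1 := Rpower_pos (1 - y) b).
      unfold G. rewrite Rminus_0_r, Ropp_mult_distr_l_reverse, Rabs_Ropp, Rabs_pos_eq.
      * rewrite Rmult_comm. apply div_lt_of_lt_mul; [exact Hb0|].
        assert (Pe := cond_pos eps). nra.
      * apply Rmult_le_pos; [left; apply Rinv_0_lt_compat|]; lra.
Qed.

(** For the lower bound, [L = - ln (1 - a)]: the pole function normalized by its mean bound
    [(L + C0) / PI] has an image of norm at least [(L - C1) / (b * (L + C0))], which tends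
    to [1 / b]. *)
Lemma op_norm_H10 (b : R) : 0 < b -> op_norm H10 H1_norm H1_norm (Hb b) = Finite (/ b).
Proof.
  intros Hb0. unfold op_norm. apply Rbar_is_lub_unique. split.
  - intros y [f [[Hf Hf0] [Hnorm ->]]].
    destruct (H1_spec f Hf) as [Hd _].
    apply H1_norm_le. intros r Hr. replace (/ b) with (1 / b) by (field; lra).
    apply Hb_mean_bound; try assumption. apply H1_norm_le, Hnorm.
  - intros y Hy. assert (HP := PI_RGT_0).
    set (C0 := 1 + ln 4 + PI / 2). set (C1 := ln 2 + / b).
    assert (Hln2 : 0 < ln 2) by (rewrite <- ln_1; apply ln_increasing; lra).
    assert (Hln4 : 0 < ln 4) by (rewrite <- ln_1; apply ln_increasing; lra).
    assert (HC0 : 0 < C0) by (unfold C0; lra).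
    assert (Hib : 0 < / b) by (apply Rinv_0_lt_compat, Hb0).
    assert (HC1 : 0 < C1) by (unfold C1; lra).
    assert (Test : forall L B, 0 < L -> Rbar_le y (Finite B) ->
      / b * (L - C1) <= B * (L + C0)).
    { intros L B HL HyB.
      set (a := 1 - exp (- L)).
      assert (Ha : 0 < a < 1).
      { unfold a. assert (E1 := exp_pos (- L)).
        assert (E2 := exp_increasing (- L) 0 ltac:(lra)). rewrite exp_0 in E2. lra. }
      assert (EL : - ln (1 - a) = L).
      { unfold a. replace (1 - (1 - exp (- L))) with (exp (- L)) by ring. rewrite ln_exp. ring. }
      set (k := PI / (L + C0)). assert (Hk : 0 < k) by (apply Rdiv_lt_0_compat; lra).
      assert (HM := pole_function_means a k Ha Hk). rewrite EL in HM. fold C0 in HM.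
      replace (k * ((L + C0) / PI)) with 1 in HM by (unfold k; field; lra).
      assert (HX : H10 (pole_function a k)).
      { split; [exact (H1_intro _ 1 (cdiff_pole_function a k Ha) HM)|].
        unfold pole_function, Cdiv. ring. }
      assert (HB : bounded_means (Hb b (pole_function a k)) B).
      { apply H1_norm_le. apply Rbar_le_trans with y; [|exact HyB].
        apply Hy. exists (pole_function a k). split; [exact HX|].
        split; [apply H1_norm_le, HM | reflexivity]. }
      assert (R := pole_function_image_bound b a k Hb0 Ha Hk B HB).
      rewrite EL in R.
      apply Rmult_le_reg_l with k; [exact Hk|].
      replace (k * (B * (L + C0))) with (PI * B) by (unfold k; field; lra).
      replace (k * (/ b * (L - C1))) with (k / b * (L - ln 2 - / b))
        by (unfold C1; field; lra).
      exact R. }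
    assert (Concl : forall B, Rbar_le y (Finite B) -> / b <= B).
    { intros B HyB. apply Rnot_lt_le. intros Hlt.
      (* large enough to contradict [Test], which bounds [(/ b - B) * L] *)
      set (L := (/ b * (C1 + C0)) / (/ b - B) + 1).
      assert (HL : 0 < L).
      { unfold L. assert (0 < / b * (C1 + C0) / (/ b - B))
          by (apply Rdiv_lt_0_compat; [apply Rmult_lt_0_compat|]; lra). lra. }
      assert (R := Test L B HL HyB).
      assert (E : (/ b - B) * L = / b * (C1 + C0) + (/ b - B)) by (unfold L; generalize (/ b) Hlt; intros u Hu; field; lra).
      assert (F : B * C0 <= / b * C0) by (apply Rmult_le_compat_r; lra). lra. }
    destruct y as [B| |].
    + apply Concl. apply Rle_refl.
    + exact I.
    + assert (H := Concl 0 I). lra.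
Qed.

Theorem theorem1p2 (b : R) (hb : 0 < b) :
  ((forall f : C -> C, H1 f -> Hb_converges b f) /\
   bounded_operator H1 H1_norm H1 H1_norm (Hb b) /\
   op_norm H10 H1_norm H1_norm (Hb b) = Finite (Beta 1 b)) /\
  ~ bounded_operator Hinf Hinf_norm Hinf Hinf_norm (Hb b).
Proof.
  split; [|apply not_bounded_on_Hinf, hb].
  split; [|split].
  - intros f Hf. destruct (H1_spec f Hf) as [Hd [N [_ HN]]].
    exact (Hb_converges_bounded_means b N f hb Hd HN).
  - split.
    + intros f Hf. destruct (H1_spec f Hf) as [Hd [N [_ HN]]].
      apply (H1_intro _ ((3 / b + 1) * N)).
      * exact (Hb_analytic b N f hb Hd HN).
      * exact (Hb_bounded_means b N f hb Hd HN).
    + exists (3 / b + 1). intros f Hf. destruct (H1_spec f Hf) as [Hd [N [EN HN]]].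
      rewrite EN. apply H1_norm_le. exact (Hb_bounded_means b N f hb Hd HN).
  - rewrite Beta_1 by exact hb. apply op_norm_H10, hb.
Qed.
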